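(* Let $b\ge2$ and let $T_n$ be the complete $b$-ary tree of height $m$ with $n=(b^{m+1}-1)/(b-1)$ nodes. Let $$X_n=\frac{I(T_n)-\mathbb E[I(T_n)]}{n}\qquad\text{and}\qquad X=\sum_{d\ge0}\sum_{j=1}^{b^d}\frac{U_{d,j}}{b^d},$$ where $(U_{d,j})_{d\ge0,\,j\ge1}$ are independent random variables uniformly distributed on $[-1/2,1/2]$. Then, as $m\to\infty$, $X_n$ converges in distribution to $X$, and $\mathbb E[e^{tX_n}]\to\mathbb E[e^{tX}]<\infty$ for every $t\in\mathbb R$. Moreover, $X$ is the unique random variable (in distribution) with cumulants $$\varkappa_{2k-1}(X)=0,\qquad \varkappa_{2k}(X)=\frac{B_{2k}}{2k}\,\frac{b^{2k-1}}{b^{2k-1}-1},\qquad k\ge1.$$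
   Context: For nodes $u,v$ of a rooted tree, $u<v$ means that $u$ is a proper ancestor of $v$. For a rooted tree $T$ with node set $V$ and a bijection $\lambda:V\to\{1,\dots,|V|\}$ let $I(T,\lambda)=\sum_{u<v}\mathbf 1_{\lambda(u)>\lambda(v)}$; $I(T)$ is $I(T,\lambda)$ with $\lambda$ a uniformly random such bijection. In the complete $b$-ary tree of height $m$ there are $b^d$ nodes at each depth $d\in\{0,\dots,m\}$, every node at depth less than $m$ having exactly $b$ children. $\varkappa_k(X)$ denotes the $k$-th cumulant. Bernoulli numbers $B_k$ are defined by $\sum_{k\ge0}B_kx^k/k!=x/(e^x-1)$. *)

(* Defs.v *)
From HB Require Import structures.
From mathcomp Require Import all_boot all_order all_algebra.
From mathcomp Require Import all_classical all_reals all_analysis.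

Set Implicit Arguments.
Unset Strict Implicit.
Unset Printing Implicit Defensive.

Import Order.TTheory GRing.Theory Num.Theory.
Import numFieldNormedType.Exports.

Local Open Scope classical_set_scope.
Local Open Scope ring_scope.

(** [anc u v] means that [u] is a proper ancestor of [v].  Labels range over
    {0, ..., |V| - 1} rather than {1, ..., |V|}; only their order matters. *)
Definition inversions (V : finType) (anc : rel V) (lam : V -> 'I_#|V|) : nat :=
  (\sum_(u : V) \sum_(v : V | anc u v) (lam v < lam u))%N.

(** The complete [b]-ary tree of height [m]: the nodes at depth [d <= m] are the
    words of length [d] over ['I_b], the children of a node [s] at depth
    [d < m] being the words [rcons s c], with [c : 'I_b]. *)
Definition bary_level (b m : nat) (d : 'I_m.+1) : finType := d.-tuple 'I_b.
Definition bary_node (b m : nat) : finType := {d : 'I_m.+1 & bary_level b d}.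
Definition bary_anc (b m : nat) : rel (bary_node b m) :=
  fun u v => (tag u < tag v)%N && prefix (tagged u : seq 'I_b) (tagged v).

Definition bary_size (b m : nat) : nat := ((b ^ m.+1 - 1) %/ (b - 1))%N.

Lemma card_bary_node (b m : nat) : (2 <= b)%N ->
  #|bary_node b m| = bary_size b m.
Proof.
move=> b2; have b1 : (0 < b - 1)%N by rewrite subn_gt0.
rewrite card_tagged sumnE big_map big_enum /=.
under eq_bigr do rewrite card_tuple card_ord.
by rewrite /bary_size !subn1 predn_exp mulKn // -subn1.
Qed.

Section Probability.
Context (R : realType).

Definition uniform_labelling d (T : measurableType d) (P : probability T R)
    (V : finType) (lam : T -> {ffun V -> 'I_#|V|}) : Prop :=
  (forall w, bijective (lam w)) /\
  forall f : {ffun V -> 'I_#|V|}, bijective f ->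
    measurable (lam @^-1` [set f]) /\
    P (lam @^-1` [set f]) = ((#|V| `!)%:R^-1)%:E.

Definition mutually_independent d (T : measurableType d) (P : probability T R)
    (I : choiceType) (X : I -> T -> R) : Prop :=
  forall (J : seq I) (A : I -> set R), uniq J -> (forall i, measurable (A i)) ->
    P (\bigcap_(i in [set` J]) (X i @^-1` A i)) =
    (\prod_(i <- J) P (X i @^-1` A i))%E.

Lemma opp_half_lt_half : - 2^-1 < 2^-1 :> R.
Proof. by rewrite (@lt_trans _ _ 0) ?oppr_lt0 ?invr_gt0 ?ltr0n. Qed.

Definition uniform_half d (T : measurableType d) (P : probability T R)
    (X : {RV P >-> R}) : Prop :=
  forall A : set R, measurable A ->
    distribution P X A = uniform_prob opp_half_lt_half A.

Definition same_distribution d (T : measurableType d) (P : probability T R)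
    (X : {RV P >-> R}) d' (T' : measurableType d') (P' : probability T' R)
    (Y : {RV P' >-> R}) : Prop :=
  forall A : set R, measurable A -> distribution P X A = distribution P' Y A.

Definition cvg_in_distribution
    (d_ : nat -> measure_display) (T_ : forall n, measurableType (d_ n))
    (P_ : forall n, probability (T_ n) R) (X_ : forall n, T_ n -> R)
    d (T : measurableType d) (P : probability T R) (X : T -> R) : Prop :=
  forall f : R -> R, continuous f -> (exists M, forall x, `|f x| <= M) ->
    'E_(P_ n)[f \o X_ n]%E @[n --> \oo] --> 'E_P[f \o X]%E.

Definition has_moments d (T : measurableType d) (P : probability T R)
    (X : T -> R) : Prop :=
  forall k : nat, P.-integrable setT (fun w => (X w ^+ k)%R%:E).

Definition moment d (T : measurableType d) (P : probability T R)
    (X : T -> R) (k : nat) : R := fine ('E_P[fun w => (X w ^+ k)%R])%E.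

Definition mgf_trunc d (T : measurableType d) (P : probability T R)
    (X : T -> R) (k : nat) : {poly R} :=
  \poly_(j < k.+1) (moment P X j / (j`!)%:R).

(** The [k]-th cumulant, for [k >= 1], is [k!] times the coefficient of [t ^ k]
    in the formal power series [log E[exp (t X)]], which makes sense as soon as
    [X] has moments of all orders.  Truncating the moment series after [t ^ k]
    and the series [log (1 + z) = \sum_(r >= 1) (-1) ^ (r - 1) z ^ r / r] after
    [z ^ k] does not affect that coefficient, because [E[exp (t X)] - 1] has
    zero constant term. *)
Definition cumulant d (T : measurableType d) (P : probability T R)
    (X : T -> R) (k : nat) : R :=
  (k`!)%:R * (\sum_(1 <= r < k.+1)
     ((-1) ^+ r.-1 / r%:R) *: (mgf_trunc P X k - 1) ^+ r)`_k.

(** The neighbourhood is punctured because [x / (e ^ x - 1)] has a removable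
    singularity at 0. *)
Definition bernoulli_numbers (B : nat -> R) : Prop :=
  \forall x \near (0 : R)^',
    series (fun k => B k * x ^+ k / (k`!)%:R) @ \oo --> x / (expR x - 1).

Definition normalized_inversions (b m : nat) d (T : measurableType d)
    (P : probability T R)
    (lam : T -> {ffun bary_node b m -> 'I_#|bary_node b m|}) (w : T) : R :=
  let I w' : R := (inversions (@bary_anc b m) (lam w'))%:R in
  (I w - fine 'E_P[I]%E) / (bary_size b m)%:R.

(** The outer series converges almost surely but need not converge everywhere.
    The inner index [j] starts at 0 instead of 1. *)
Definition is_level_series (b : nat) d (T : measurableType d)
    (P : probability T R) (U : nat -> nat -> T -> R) (X : T -> R) : Prop :=
  {ae P, forall w,
    series (fun i => \sum_(0 <= j < b ^ i) U i j w / b%:R ^+ i) @ \oo --> X w}.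

End Probability.

(* Main.v *)
Require Import Defs.
From HB Require Import structures.
From mathcomp Require Import all_boot all_order all_algebra perm.
From mathcomp Require Import all_classical all_reals all_analysis.
From mathcomp Require Import measurable_realfun ring lra zify.

Set Implicit Arguments.
Unset Strict Implicit.
Unset Printing Implicit Defensive.

Import Order.TTheory GRing.Theory Num.Theory.
Import numFieldNormedType.Exports.

Local Open Scope ring_scope.

(** Let the rank of a node be the number of its proper descendants that carry a
    smaller label.  Each inversion is counted once, at its upper end, so the
    number of inversions is the sum of the ranks ([inversions_sum_rank]).  When
    the labelling is uniform, the ranks are independent, and the rank of [u] is
    uniform on [{0, ..., h u - 1}], where [h u] is the size of the subtree rooted
    at [u] ([sum_ranks]): exchanging the label of [u] with the next larger one
    below [u] raises the rank of [u] by one and changes no other rank, so all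
    rank vectors are equally likely.  Hence [(I - E I) / n] is a sum of
    independent centred uniform variables with ranges close to [h u / n], and at
    depth [d] of the complete [b]-ary tree this ratio is close to [1 / b ^ d].

    The law of the ranks is that of the cells [floor (h u * (U u + 1/2))] of the
    variables [U] from which the limit is built ([normalized_inversionsE],
    [Rexpectation_labelling_ranks]).  This couples all [X_m] with [X] on one
    probability space.  Each node contributes a centred discretisation error of
    at most [1 / n], and these errors are independent, so the mean square of
    [X_m] minus the sum of the first [m + 1] levels is at most
    [1 / n <= 1 / 2 ^ m] ([coupling_gap_sqr]).  This is summable, and so are the
    mean squares of the levels; thus [X] exists and the coupled variables
    converge to it almost surely ([coupled_cvg_ae]).  The moment generating
    functions of the [X_m] are bounded uniformly in [m] ([coupled_exp_moment]),
    so that [F (X_m)] is bounded in mean square for every continuous [F] of at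
    most exponential growth, and its expectation converges to that of [F (X)]
    ([coupled_Rexpectation_cvg]).  Bounded, exponential and power functions [F]
    give convergence in distribution, of the moment generating functions and of
    the moments.

    For the cumulants, the logarithm of a moment series is encoded by the
    recursion on coefficients that expresses [A' = (log A)' * A]
    ([log_recursion]).  With [E (z) = (e ^ z - 1) / z], the uniform law on
    [{0, ..., h - 1}] has moment series [E (h z) / E (z)], and the logarithmic
    derivative of [E] has the coefficients [B_(k+1) / (k+1)!] beyond the constant
    one.  Summed over the nodes and divided by the appropriate power of [n],
    [h u ^ (k+1) - 1] tends to a geometric series ([subtree_power_sum_cvg]), and
    the recursion passes to the limit ([cumulant_level_series]).

    Finally the cumulants determine the moments ([moment_eq_of_cumulants]), and
    the moments of a variable with finite exponential moments determine its law
    ([same_distribution_of_moments]): Taylor series give the expectations of all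
    [cos (t Y + q)], hence those of polynomials in them, hence the probabilities
    of intervals. *)

(** * Ranks in a uniformly labelled forest *)

Section ForestRanks.
Variables (V : finType) (anc : rel V).
Hypothesis anc_irr : irreflexive anc.
Hypothesis anc_trans : transitive anc.
Hypothesis anc_forest :
  forall u v w, anc u w -> anc v w -> [|| u == v, anc u v | anc v u].
Implicit Types (lam : {ffun V -> 'I_#|V|}) (u v w x : V) (a : V -> nat).

Definition desc u : {set V} := [set v | anc u v].
Definition subtree_size u : nat := #|desc u|.+1.
Definition rank lam u : nat := #|[set v in desc u | (lam v < lam u)%N]|.

Let lab_neq lam u v : injective lam -> u != v -> (lam u != lam v :> nat).
Proof. by move=> inj; apply: contraNneq => /val_inj/inj ->. Qed.

Lemma rank_lt_size lam u : (rank lam u < subtree_size u)%N.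
Proof. by rewrite ltnS subset_leq_card //; apply/fintype.subsetP=> v; rewrite inE => /andP[]. Qed.

Lemma subtree_size_le u : (subtree_size u <= #|V|)%N.
Proof.
have: (#|desc u| < #|[set: V]|)%N.
  apply: proper_card; apply/properP; split; first exact: finset.subsetT.
  by exists u; rewrite ?inE // anc_irr.
by rewrite cardsT.
Qed.

(** [v] carries the smallest label exceeding that of [u] among the
    descendants of [u]. *)
Definition next_label lam u v :=
  [&& anc u v, (lam u < lam v)%N &
      [forall x, anc u x ==> ~~ ((lam u < lam x) && (lam x < lam v))%N]].

Lemma next_labelP lam u : injective lam ->
  ((rank lam u).+1 < subtree_size u)%N -> exists v, next_label lam u v.
Proof.
move=> inj; rewrite ltnS => lt.
have [v0 Pv0] : exists v0, anc u v0 && (lam u < lam v0)%N.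
  apply/existsP; apply: contraLR lt; rewrite negb_exists => /forallP H.
  rewrite -leqNgt subset_leq_card //; apply/fintype.subsetP=> v; rewrite !inE => uv.
  rewrite uv /=; have := H v; rewrite uv /= -leqNgt leq_eqVlt => /orP[|//].
  by move=> /eqP/val_inj/inj vu; move: uv; rewrite vu anc_irr.
case: (@arg_minnP _ v0 (fun v => anc u v && (lam u < lam v)%N) (fun v => lam v) Pv0) => v
  /andP[uv luv] vmin.
exists v; apply/and3P; split=> //; apply/forallP=> x; apply/implyP=> ux.
apply/negP=> /andP[lux lxv]; have := vmin x; rewrite ux lux /= => /(_ isT).
by rewrite leqNgt lxv.
Qed.

Definition swap lam u v : {ffun V -> 'I_#|V|} := [ffun x => lam (tperm u v x)].

Lemma swap_inj lam u v : injective lam -> injective (swap lam u v).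
Proof. by move=> inj x y; rewrite !ffunE => /inj/perm_inj. Qed.

(** Only [v] crosses the label of [u]: no label below [u] lies strictly
    between the two that are exchanged. *)
Lemma rank_swap_self lam u v : injective lam -> next_label lam u v ->
  rank (swap lam u v) u = (rank lam u).+1.
Proof.
move=> inj /and3P[uv luv /forallP btw].
rewrite /rank (cardsD1 v) !inE uv !ffunE tpermL tpermR luv add1n; congr (_.+1).
apply: eq_card => x; rewrite !inE !ffunE ?tpermL.
have [->|xv] := eqVneq x v; first by rewrite uv /= ltnNge ltnW.
case ux: (anc u x) => //=.
rewrite tpermD; [|by apply: contraTneq ux => <-; rewrite anc_irr|by rewrite eq_sym].
have := btw x; rewrite ux /=.
have : (lam x != lam u :> nat) by apply: lab_neq; last by apply: contraTneq ux => ->;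
  rewrite anc_irr.
by move: luv; move: (nat_of_ord (lam x)) (nat_of_ord (lam u)) (nat_of_ord (lam v)); clear; lia.
Qed.

(** The two exchanged labels compare alike with every other label below
    [u], so only a node [w] related to [u] or [v] could be affected; the
    three positions of [w] above [u], at [v] and between [u] and [v] are
    checked separately, and this is where the forest property enters. *)
Lemma rank_swap_other lam u v w : injective lam -> next_label lam u v ->
  w != u -> rank (swap lam u v) w = rank lam w.
Proof.
move=> inj /and3P[uv luv /forallP btw] wu.
have vu : v != u by apply: contraTneq uv => ->; rewrite anc_irr.
have [wuP|nwu] := boolP (anc w u).
  (* The exchange permutes the labels found below [w]. *)
  have wv := anc_trans wuP uv.
  have wNv : w != v by apply: contraTneq wv => ->; rewrite anc_irr.
  rewrite /rank -[RHS](card_imset _ (@perm_inj _ (tperm u v))).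
  apply: eq_card => x; rewrite -{2}(tpermK u v x) mem_imset; last exact: perm_inj.
  rewrite !inE !ffunE (tpermD (z := w)) 1?eq_sym //; congr (_ && _).
  by case: tpermP => // ->; rewrite wuP wv.
have [wv|wNv] := eqVneq w v.
  (* Here [v] receives the label of [u], and no label below [v] lies
     between the old and the new one. *)
  rewrite wv in nwu *; apply: eq_card => x; rewrite !inE !ffunE tpermR.
  case vx: (anc v x) => //=; have ux := anc_trans uv vx.
  rewrite tpermD; last 2 first.
  - by apply: contraTneq vx => <-.
  - by apply: contraTneq vx => <-; rewrite anc_irr.
  have := btw x; rewrite ux /=.
  have : (lam x != lam u :> nat) by apply: lab_neq; last by apply: contraTneq ux => ->;
    rewrite anc_irr.
  have : (lam x != lam v :> nat) by apply: lab_neq; last by apply: contraTneq vx => ->;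
    rewrite anc_irr.
  by move: luv; move: (nat_of_ord (lam x)) (nat_of_ord (lam u)) (nat_of_ord (lam v)); clear; lia.
apply: eq_card => x; rewrite !inE !ffunE (tpermD (z := w)) 1?eq_sym //.
case wx: (anc w x) => //=; case: tpermP => // xE.
  by rewrite xE (negbTE nwu) in wx.
(* As [v] is below [w] but [u] is not, [w] lies below [u]; its label is
   then not between those of [u] and [v]. *)
have := anc_forest uv; rewrite xE in wx => /(_ w wx).
rewrite eq_sym (negbTE wu) (negbTE nwu) orbF /= => uw.
have := btw w; rewrite uw /= xE.
have : (lam w != lam u :> nat) by exact: lab_neq.
have : (lam w != lam v :> nat) by exact: lab_neq.
by move: luv; move: (nat_of_ord (lam w)) (nat_of_ord (lam u)) (nat_of_ord (lam v)); clear; lia.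
Qed.

(** The exchanged labelling determines the exchanged pair, hence the
    exchange can be undone. *)
Lemma swap_next_inj lam1 lam2 u v1 v2 : injective lam1 -> injective lam2 ->
  next_label lam1 u v1 -> next_label lam2 u v2 ->
  swap lam1 u v1 = swap lam2 u v2 -> lam1 = lam2.
Proof.
move=> inj1 inj2 /and3P[a1 l1 /forallP b1] /and3P[a2 l2 /forallP b2] E.
have Ex x : lam1 (tperm u v1 x) = lam2 (tperm u v2 x).
  by move/ffunP/(_ x): E; rewrite !ffunE.
suff E12 : v1 = v2.
  by apply/ffunP=> x; have := Ex (tperm u v1 x); rewrite -E12 !tpermK.
have Eu : lam1 v1 = lam2 v2 by have := Ex u; rewrite !tpermL.
have [//|v12] := eqVneq v1 v2.
have uv1 : u != v1 by apply: contraTneq a1 => <-; rewrite anc_irr.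
have uv2 : u != v2 by apply: contraTneq a2 => <-; rewrite anc_irr.
have E1 : lam1 u = lam2 v1.
  by have := Ex v1; rewrite tpermR tpermD // eq_sym.
have E2 : lam1 v2 = lam2 u.
  by have := Ex v2; rewrite tpermR tpermD.
(* Under both labellings the next label of [u] is the same. If [v1] and
   [v2] differed, the larger of the two labels of [u] would lie strictly
   between the smaller one and this next label, and under the labelling
   with the smaller one it belongs to a descendant of [u]. *)
have := b1 v2; have := b2 v1; rewrite a1 a2 -E2 -E1 E2 -Eu /=.
have : (lam1 u != lam1 v2 :> nat) by exact: lab_neq.
move: l1 l2; rewrite -Eu -E2; move: (nat_of_ord (lam1 u)) (nat_of_ord (lam1 v1)) (nat_of_ord
  (lam1 v2)); clear; lia.
Qed.

Definition with_ranks a : {set {ffun V -> 'I_#|V|}} :=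
  [set lam : {ffun V -> 'I_#|V|} | injectiveb lam && [forall u, rank lam u == a u]].

(** The exchange of [u] with the holder of its next label injects the first
    set of labellings into the second. *)
Lemma card_with_ranks_leS a u : ((a u).+1 < subtree_size u)%N ->
  (#|with_ranks a| <= #|with_ranks (fun v => a v + (v == u))|)%N.
Proof.
move=> ltu.
pose f lam := swap lam u (odflt u [pick v | next_label lam u v]).
have fP lam : lam \in with_ranks a -> exists2 v, next_label lam u v & f lam = swap lam u v.
  rewrite inE => /andP[/injectiveP inj /forallP/(_ u)/eqP r].
  have [v0 v0P] := next_labelP inj (etrans (congr1 (fun k => k.+1 < _)%N r) ltu).
  by rewrite /f; case: pickP => [v vP|/(_ v0)]; [exists v | rewrite v0P].
rewrite -(card_in_imset (f := f)).
  apply/subset_leq_card/fintype.subsetP=> _ /imsetP[lam lamA ->].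
  have [v vP ->] := fP _ lamA; move: lamA; rewrite !inE => /andP[/injectiveP inj /forallP rk].
  apply/andP; split; first exact/injectiveP/swap_inj.
  apply/forallP=> w; have [->|wu] := eqVneq w u.
    by rewrite rank_swap_self // (eqP (rk u)) addn1.
  by rewrite rank_swap_other // addn0 rk.
move=> lam1 lam2 L1 L2; have [v1 v1P ->] := fP _ L1; have [v2 v2P ->] := fP _ L2.
move: L1 L2; rewrite !inE => /andP[/injectiveP i1 _] /andP[/injectiveP i2 _].
exact: swap_next_inj.
Qed.

(** Reversing the order of all labels turns the number of smaller labels
    below [u] into the number of larger ones. *)
Lemma card_with_ranks_rev a : (forall u, a u < subtree_size u)%N ->
  (#|with_ranks a| <= #|with_ranks (fun u => (subtree_size u).-1 - a u)|)%N.
Proof.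
move=> alt; pose f lam : {ffun V -> 'I_#|V|} := [ffun x => rev_ord (lam x)].
rewrite -(card_imset (f := f)); last first.
  by move=> l1 l2 /ffunP E; apply/ffunP=> x; have := E x; rewrite !ffunE => /rev_ord_inj.
apply/subset_leq_card/fintype.subsetP=> _ /imsetP[lam + ->].
rewrite !inE => /andP[/injectiveP inj /forallP rk]; apply/andP; split.
  by apply/injectiveP=> x y; rewrite !ffunE => /rev_ord_inj/inj.
apply/forallP=> u; rewrite -(eqP (rk u)) /= /rank.
rewrite -[X in (X - _)%N](cardsID [set v | (lam v < lam u)%N]) -setIdE addKn.
apply/eqP/eq_card => v; rewrite !inE !ffunE /= andbC; case uv: (anc u v); rewrite ?andbF //=.
have : (lam v != lam u :> nat) by apply: lab_neq; last by apply: contraTneq uv => ->;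
  rewrite anc_irr.
have revP n p q : (p < n -> q < n -> p != q -> (n - p.+1 < n - q.+1) = ~~ (p < q))%N by lia.
by rewrite !andbT => ne; apply: revP ne.
Qed.

Lemma eq_with_ranks a a' : a =1 a' -> with_ranks a = with_ranks a'.
Proof.
by move=> E; apply/setP=> lam; rewrite !inE; congr (_ && _); apply: eq_forallb => u; rewrite E.
Qed.

(** Reversal exchanges raising with lowering a rank, so the inequality
    [card_with_ranks_leS] holds in both directions. *)
Lemma card_with_ranksS a u : (forall v, a v < subtree_size v)%N ->
  ((a u).+1 < subtree_size u)%N ->
  #|with_ranks a| = #|with_ranks (fun v => a v + (v == u))%N|.
Proof.
move=> alt ltu; apply/eqP; rewrite eqn_leq card_with_ranks_leS //=.
have lt' v : (a v + (v == u) < subtree_size v)%N.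
  by have [->|_] := eqVneq v u; rewrite ?addn1 ?addn0.
apply: leq_trans (card_with_ranks_rev lt') _.
apply: leq_trans (card_with_ranks_leS (u := u) _) _.
  by rewrite eqxx /subtree_size; move: ltu; rewrite /subtree_size /=; lia.
rewrite (eq_with_ranks (a' := fun v => (subtree_size v).-1 - a v)%N); last first.
  move=> v; have [->|_] := eqVneq v u; last by rewrite !addn0.
  by move: ltu; rewrite /subtree_size /=; lia.
apply: leq_trans (card_with_ranks_rev _) _; first by move=> v; rewrite /subtree_size /=; lia.
rewrite (eq_with_ranks (a' := a)) // => v.
by move: (alt v); rewrite /subtree_size /=; lia.
Qed.

(** Rank vectors within bounds are joined to zero by unit steps, each of
    which preserves the count. *)
Lemma card_with_ranks_const a : (forall v, a v < subtree_size v)%N ->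
  #|with_ranks a| = #|with_ranks (fun=> 0%N)|.
Proof.
move: {2}(\sum_v a v)%N (leqnn (\sum_v a v)%N) => k; elim: k a => [|k IH] a ak alt.
  rewrite leqn0 sum_nat_eq0 in ak; congr #|pred_of_set _|; apply: eq_with_ranks => v.
  exact/eqP/(forallP ak).
have [/forallP a0|] := boolP [forall v, a v == 0%N].
  by congr #|pred_of_set _|; apply: eq_with_ranks => v; apply/eqP.
rewrite negb_forall => /existsP[u au].
pose a' v := (a v - (v == u))%N.
have aE v : a v = (a' v + (v == u))%N.
  by rewrite /a'; have [->|_] := eqVneq v u; lia.
rewrite (eq_with_ranks aE) -card_with_ranksS; last 2 first.
- by move=> v; rewrite /a'; have := alt v; lia.
- by rewrite /a' eqxx; have := alt u; lia.
apply: IH => [|v]; last by rewrite /a'; have := alt v; lia.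
rewrite -ltnS; apply: leq_trans ak; rewrite (bigD1 u) //= [in X in (_ < X)%N](bigD1 u) //=.
rewrite (eq_bigr a) => [|v vu]; last by rewrite /a' (negbTE vu) subn0.
by rewrite ltn_add2r /a' eqxx; lia.
Qed.

Lemma rank_lt_card lam u : (rank lam u < #|V|)%N.
Proof. exact: leq_trans (rank_lt_size lam u) (subtree_size_le u). Qed.

Definition ranks lam : {ffun V -> 'I_#|V|} := [ffun u => Ordinal (rank_lt_card lam u)].

Definition rank_box : {pred {ffun V -> 'I_#|V|}} :=
  family (fun u => [pred j : 'I_#|V| | (j < subtree_size u)%N]).

Lemma card_ranks_fibre (r : {ffun V -> 'I_#|V|}) :
  #|[pred lam : {ffun V -> 'I_#|V|} | injectiveb lam & ranks lam == r]| =
  if r \in rank_box then #|with_ranks (fun=> 0%N)| else 0%N.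
Proof.
have E : [pred lam : {ffun V -> 'I_#|V|} | injectiveb lam & ranks lam == r] =i with_ranks (fun
  u => r u).
  move=> lam; rewrite !inE; congr (_ && _).
  apply/eqP/forallP => [<- u|H]; first by rewrite ffunE.
  by apply/ffunP=> u; apply/val_inj; rewrite ffunE /=; exact/eqP.
rewrite (eq_card E); case: ifPn => [/familyP H|]; first exact: card_with_ranks_const.
apply: contraNeq; rewrite -lt0n => /card_gt0P[lam]; rewrite -E inE => /andP[_ /eqP <-].
by apply/familyP=> u; rewrite ffunE inE /= rank_lt_size.
Qed.

Lemma sum_ranks_mulrn (R : nmodType) (G : {ffun V -> 'I_#|V|} -> R) :
  \sum_(lam : {ffun V -> 'I_#|V|} | injectiveb lam) G (ranks lam) =
  (\sum_(r in rank_box) G r) *+ #|with_ranks (fun=> 0%N)|.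
Proof.
rewrite (partition_big ranks predT) //= -sumrMnl [RHS]big_mkcond /=.
apply: eq_bigr => r _; rewrite (eq_bigr (fun=> G r)) => [|lam /andP[_ /eqP ->]] //.
rewrite sumr_const card_ranks_fibre.
by case: ifP.
Qed.

Lemma card_rank_box : #|rank_box| = (\prod_u subtree_size u)%N.
Proof.
rewrite card_family /image_mem foldrE big_map big_enum /=; apply: eq_bigr => u _.
have winj : injective (widen_ord (subtree_size_le u)) by move=> i j [/val_inj].
rewrite -[RHS]card_ord -(card_imset _ winj).
apply: eq_card => j; apply/idP/imsetP => [lt|[i _ ->]].
  by exists (Ordinal lt) => //; apply: val_inj.
by rewrite unfold_in /= ltn_ord.
Qed.

(** In probabilistic terms: for a uniform labelling of a forest the ranks
    are independent, each uniform below the size of the subtree. *)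
Lemma sum_ranks (R : numFieldType) (G : {ffun V -> 'I_#|V|} -> R) :
  (#|V| `!)%:R^-1 * \sum_(lam : {ffun V -> 'I_#|V|} | injectiveb lam) G (ranks lam) =
  (\prod_u (subtree_size u)%:R)^-1 * \sum_(r in rank_box) G r.
Proof.
set N := #|with_ranks (fun=> 0%N)|.
have EN : (#|V| `!)%:R = (\prod_u (subtree_size u)%:R) * N%:R :> R.
  have := @sum_ranks_mulrn R (fun=> 1); rewrite !sumr_const card_rank_box natr_prod.
  rewrite (eq_card (B := [set f : {ffun V -> 'I_#|V|} | injectiveb f])); last first.
    by move=> f; rewrite inE.
  by rewrite card_inj_ffuns card_ord ffactnn mulr_natr.
have := fact_gt0 #|V|; rewrite -(ltr0n R) EN => /lt0r_neq0.
rewrite mulf_eq0 negb_or => /andP[p0 N0].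
by rewrite sum_ranks_mulrn -/N -[X in _ * X]mulr_natl invfM mulrA mulfVK.
Qed.
End ForestRanks.

(** * The complete b-ary tree *)

Section BaryTree.
Variables (b m : nat).
Hypothesis b_gt1 : (1 < b)%N.

Lemma bary_anc_irr : irreflexive (@bary_anc b m).
Proof. by move=> u; rewrite /bary_anc ltnn. Qed.

Lemma bary_anc_trans : transitive (@bary_anc b m).
Proof.
move=> v u w /andP[uv puv] /andP[vw pvw]; rewrite /bary_anc (ltn_trans uv vw) /=.
exact: prefix_trans puv pvw.
Qed.

Lemma bary_anc_forest (u v w : bary_node b m) : bary_anc u w -> bary_anc v w ->
  [|| u == v, bary_anc u v | bary_anc v u].
Proof.
have prefix_le (s1 s2 s : seq 'I_b) : (size s1 <= size s2)%N ->
    prefix s1 s -> prefix s2 s -> prefix s1 s2.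
  rewrite !prefixE => le /eqP E1 /eqP E2.
  by rewrite -{1}E2 take_takel // E1.
case: u v w => [d s] [e t] [f r]; rewrite /bary_anc /= => /andP[_ ps] /andP[_ pt].
have [de|ed|/val_inj de] := ltngtP d e.
- by rewrite (prefix_le _ _ _ _ ps pt) ?size_tuple 1?ltnW ?orbT.
- by rewrite (prefix_le _ _ _ _ pt ps) ?size_tuple 1?ltnW ?orbT.
rewrite -{e}de in t pt *; suff -> : s = t by rewrite eqxx.
by move: ps pt; rewrite !prefixE !size_tuple => /eqP Es /eqP Et; apply: val_inj; rewrite /= -Es -Et.
Qed.

Lemma inversions_sum_rank (V : finType) (anc : rel V) (lam : {ffun V -> 'I_#|V|}) :
  inversions anc lam = (\sum_u rank anc lam u)%N.
Proof.
apply: eq_bigr => u _; rewrite -big_mkcondr /= sum1_card /rank.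
by apply: eq_card => v; rewrite !inE.
Qed.

Lemma card_prefix_tuple (s : seq 'I_b) e : (size s <= e)%N ->
  #|[pred t : e.-tuple 'I_b | prefix s t]| = (b ^ (e - size s))%N.
Proof.
move=> le; pose f (t : (e - size s).-tuple 'I_b) : e.-tuple 'I_b :=
  tcast (subnKC le) (cat_tuple (in_tuple s) t).
have fE t : f t = s ++ t :> seq _ by rewrite val_tcast.
have finj : injective f.
  move=> t1 t2 /(congr1 (fun t : e.-tuple _ => t : seq _)); rewrite !fE => /eqP.
  by rewrite eqseq_cat // eqxx /= => /eqP/val_inj.
rewrite -[X in (X ^ _)%N](card_ord b) -card_tuple -(card_imset _ finj).
apply: eq_card => t; rewrite !inE; apply/idP/imsetP => [/prefixP[r tE]|[r _ ->]].
  have sr : size r == (e - size s)%N.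
    by rewrite -(size_tuple t) tE size_cat addKn.
  by exists (Tuple sr) => //; apply: val_inj; rewrite /= fE.
by rewrite fE prefix_prefix.
Qed.

Lemma bary_sizeE k : bary_size b k = (\sum_(i < k.+1) b ^ i)%N.
Proof. by rewrite /bary_size !subn1 predn_exp mulKn // -subn1 subn_gt0. Qed.

(** The subtree at depth [d] is a complete [b]-ary tree of height [m - d]. *)
Lemma bary_subtree_size (u : bary_node b m) :
  subtree_size (@bary_anc b m) u = bary_size b (m - tag u).
Proof.
rewrite /subtree_size bary_sizeE big_ord_recl expn0 add1n; congr (_.+1).
rewrite -sum1_card (eq_bigl (fun v : bary_node b m => (tag u < tag v)%N && prefix (tagged u :
  seq 'I_b) (tagged v))); last first.
  by move=> v; rewrite !inE.
rewrite -(@sig_big_dep _ _ _ _ _ (fun e : 'I_m.+1 => (tag u < e)%N)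
   (fun (e : 'I_m.+1) (t : bary_level b e) => prefix (tagged u : seq 'I_b) t)
   (fun _ _ => 1%N)) /=.
transitivity (\sum_(e < m.+1 | (tag u < e)%N) b ^ (e - tag u))%N.
  apply: eq_bigr => e ue; rewrite sum1_card card_prefix_tuple size_tuple //.
  exact: ltnW.
rewrite -(big_mkord (fun e => tag u < e)%N (fun e => b ^ (e - tag u))%N).
have um : (tag u < m.+1)%N := ltn_ord _.
rewrite (@big_cat_nat _ _ _ (tag u).+1) //= big_nat_cond big1 => [|i]; last by lia.
rewrite add0n -(big_mkord predT (fun i => b ^ (bump 0 i))%N) big_nat_cond.
rewrite (eq_bigl (fun i => (((tag u).+1 <= i < m.+1) && true)%N)); last by move=> i;
  rewrite andbT; case: (tag u < i)%N; rewrite ?andbT ?andbF.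
rewrite -big_nat_cond -{1}[(tag u).+1]add0n big_addn subSS.
by apply: eq_bigr => i _; congr (b ^ _)%N; rewrite /bump leq0n addnS -addSn addnK.
Qed.

End BaryTree.

(** Independence of the ranks in product form: over a box a sum of products
    factorises. *)
Lemma sum_rank_box_prod (V : finType) (anc : rel V) (R : comNzRingType) (g : V -> nat -> R) :
  irreflexive anc ->
  \sum_(r in rank_box anc) \prod_u g u (r u) =
  \prod_u \sum_(j < subtree_size anc u) g u j.
Proof.
move=> irr; rewrite (eq_bigr (fun u => \sum_(j : 'I_#|V| | (j < subtree_size anc u)%N) g u j));
  last first.
  by move=> u _; rewrite (big_ord_narrow (subtree_size_le irr u)).
by rewrite bigA_distr_big_dep.
Qed.

(** The nodes at depth [d] are indexed by [0, ..., b ^ d - 1], to match the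
    indices of the double sequence of uniform variables. *)
Lemma sum_bary_nodes (b m : nat) (R : nmodType) (F : nat -> nat -> R) :
  \sum_(u : bary_node b m) F (tag u) (enum_rank (tagged u)) =
  \sum_(d < m.+1) \sum_(0 <= j < b ^ d) F d j.
Proof.
rewrite (eq_bigl (fun u : bary_node b m => true && true)) //.
rewrite -(@sig_big_dep _ _ _ _ _ (fun=> true) (fun _ _ => true)
  (fun (d : 'I_m.+1) (t : bary_level b d) => F d (enum_rank t))) /=.
apply: eq_bigr => d _.
rewrite (reindex (@enum_val (bary_level b d) (mem predT))) /=; last first.
  by apply: onW_bij; exact: enum_val_bij.
rewrite (eq_bigr (fun j : 'I__ => F d j)) => [|j _]; last by rewrite enum_valK.
by rewrite -(big_mkord predT (F d)) /bary_level card_tuple card_ord.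
Qed.

Lemma bary_node_index_inj (b m : nat) :
  injective (fun u : bary_node b m => (tag u : nat, enum_rank (tagged u) : nat)).
Proof.
move=> [d s] [e t] [/= /val_inj de]; rewrite -{e}de in t *.
by move=> /val_inj/enum_rank_inj ->.
Qed.

(** * Formal power series and Bernoulli numbers *)

Section FormalPowerSeries.
Variable R : realFieldType.

(** The record keeps the Cauchy product apart from the pointwise product
    that the function type [nat -> R] already carries. *)
Record fps : Type := Fps { fcoef : nat -> R }.

Lemma fpsP (f g : fps) : fcoef f =1 fcoef g -> f = g.
Proof. by case: f g => [f] [g] /= /funext ->. Qed.

HB.instance Definition _ := gen_eqMixin fps.
HB.instance Definition _ := gen_choiceMixin fps.

Definition fadd f g := Fps (fun i => fcoef f i + fcoef g i).
Definition fopp f := Fps (fun i => - fcoef f i).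
Definition fconst c := Fps (fun i => if i == 0%N then c else 0).
Definition fmul f g := Fps (fun i => \sum_(j < i.+1) fcoef f j * fcoef g (i - j)).
Definition ftrunc K f : {poly R} := \poly_(i < K) fcoef f i.

Lemma coef_ftrunc K f i : (i < K)%N -> (ftrunc K f)`_i = fcoef f i.
Proof. by rewrite coef_poly => ->. Qed.

(** A coefficient of a product only sees truncations, so ring laws for
    series follow from those for polynomials. *)
Lemma fcoef_fmul K f g i : (i < K)%N ->
  fcoef (fmul f g) i = (ftrunc K f * ftrunc K g)`_i.
Proof.
move=> iK; rewrite coefM; apply: eq_bigr => j _.
by rewrite !coef_ftrunc //; have := ltn_ord j; lia.
Qed.

Fact faddA : associative fadd.
Proof. by move=> f g h; apply: fpsP => i /=; rewrite addrA. Qed.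
Fact faddC : commutative fadd.
Proof. by move=> f g; apply: fpsP => i /=; rewrite addrC. Qed.
Fact fadd0 : left_id (fconst 0) fadd.
Proof. by move=> f; apply: fpsP => i /=; rewrite if_same add0r. Qed.
Fact faddN : left_inverse (fconst 0) fopp fadd.
Proof. by move=> f; apply: fpsP => i /=; rewrite if_same addNr. Qed.
HB.instance Definition _ := GRing.isZmodule.Build fps faddA faddC fadd0 faddN.

Fact fmulC : commutative fmul.
Proof. by move=> f g; apply: fpsP => i; rewrite !(fcoef_fmul _ _ (ltnSn i)) mulrC. Qed.
Fact fmulA : associative fmul.
Proof.
have E f g h i : fcoef (fmul f (fmul g h)) i =
    (ftrunc i.+1 f * (ftrunc i.+1 g * ftrunc i.+1 h))`_i.
  rewrite coefM; apply: eq_bigr => j _; have ji := ltn_ord j.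
  by rewrite coef_ftrunc // (@fcoef_fmul i.+1) // ltnS leq_subr.
by move=> f g h; apply: fpsP => i; rewrite [fmul (fmul f g) h]fmulC !E [in RHS]mulrC mulrA.
Qed.
Fact fmul1 : left_id (fconst 1) fmul.
Proof.
move=> f; apply: fpsP => i /=; rewrite big_ord_recl /= mul1r subn0 big1 ?addr0 // => j _.
by rewrite mul0r.
Qed.
Fact fmulDl : left_distributive fmul fadd.
Proof.
by move=> f g h; apply: fpsP => i /=; rewrite -big_split /=; apply: eq_bigr => j _; rewrite mulrDl.
Qed.
Fact fps1_neq0 : fconst 1 != fconst 0.
Proof. by apply/eqP=> /(congr1 (fun f => fcoef f 0)) /= /eqP; rewrite oner_eq0. Qed.
HB.instance Definition _ :=
  GRing.Zmodule_isComNzRing.Build fps fmulA fmulC fmul1 fmulDl fps1_neq0.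

Lemma fcoefD f g i : fcoef (f + g) i = fcoef f i + fcoef g i. Proof. by []. Qed.
Lemma fcoefN f i : fcoef (- f) i = - fcoef f i. Proof. by []. Qed.
Lemma fcoefM f g i : fcoef (f * g) i = \sum_(j < i.+1) fcoef f j * fcoef g (i - j).
Proof. by []. Qed.
Lemma fcoef1 i : fcoef 1 i = (i == 0%N)%:R. Proof. by rewrite /=; case: eqP. Qed.
Lemma fcoef_sum (I : Type) (r : seq I) (P : pred I) (F : I -> fps) i :
  fcoef (\sum_(k <- r | P k) F k) i = \sum_(k <- r | P k) fcoef (F k) i.
Proof.
apply: (big_morph (fun f => fcoef f i)) => [f g|]; first exact: fcoefD.
by rewrite /= if_same.
Qed.
Lemma fcoef_constM c f i : fcoef (fconst c * f) i = c * fcoef f i.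
Proof.
rewrite fcoefM big_ord_recl /= subn0 big1 ?addr0 // => j _; by rewrite mul0r.
Qed.

Definition fX := Fps (fun i => (i == 1%N)%:R).

Lemma fcoef_XM f i : fcoef (fX * f) i = if i is j.+1 then fcoef f j else 0.
Proof.
rewrite fcoefM; case: i => [|i]; first by rewrite big_ord1 mul0r.
rewrite !big_ord_recl big1 /= ?mul0r ?mul1r ?add0r ?addr0 ?subSS ?subn0 // => j _.
by rewrite mul0r.
Qed.

Lemma fX_inj f g : fX * f = fX * g -> f = g.
Proof. by move=> E; apply: fpsP => i; rewrite -!(fcoef_XM _ i.+1) E. Qed.

Definition fderiv f := Fps (fun i => i.+1%:R * fcoef f i.+1).

Lemma fderivD f g : fderiv (f + g) = fderiv f + fderiv g.
Proof. by apply: fpsP => i; rewrite /= mulrDr. Qed.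

Lemma fderivM f g : fderiv (f * g) = fderiv f * g + f * fderiv g.
Proof.
apply: fpsP => i; pose F := ftrunc i.+2 f; pose G := ftrunc i.+2 g.
transitivity ((F * G)^`())`_i.
  by rewrite coef_deriv -mulr_natl /= -(fcoef_fmul f g (ltnSn i.+1)).
rewrite derivM coefD !coefM fcoefD !fcoefM; congr (_ + _); apply: eq_bigr => j _;
  have ji := ltn_ord j; rewrite coef_deriv !coef_ftrunc /= ?mulr_natl //; lia.
Qed.

Lemma fderiv_const c : fderiv (fconst c) = 0.
Proof. by apply: fpsP => i; rewrite /= mulr0 if_same. Qed.

Lemma fderiv_X : fderiv fX = 1.
Proof. by apply: fpsP => i; rewrite fcoef1 /= eqSS; case: eqP => [->|_]; rewrite ?mulr1 ?mulr0. Qed.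

(** The logarithmic derivative turns products into sums. *)
Lemma fderiv_prod_log (I : Type) (r : seq I) (F L : I -> fps) :
  (forall k, fderiv (F k) = L k * F k) ->
  fderiv (\prod_(k <- r) F k) = (\sum_(k <- r) L k) * \prod_(k <- r) F k.
Proof.
move=> FL; elim: r => [|k r IH]; first by rewrite !big_nil mul0r; exact: fderiv_const.
by rewrite !big_cons fderivM IH FL; ring.
Qed.

(** The series [f (s * X)]. *)
Definition fscale s f := Fps (fun i => s ^+ i * fcoef f i).

Lemma fscaleM s f g : fscale s (f * g) = fscale s f * fscale s g.
Proof.
apply: fpsP => i; rewrite /= mulr_sumr; apply: eq_bigr => j _.
by rewrite mulrACA -exprD subnKC // -ltnS.
Qed.

Lemma fscaleD s f g : fscale s (f + g) = fscale s f + fscale s g.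
Proof. by apply: fpsP => i /=; rewrite mulrDr. Qed.

Lemma fscale_const s c : fscale s (fconst c) = fconst c.
Proof. by apply: fpsP => -[|i] /=; rewrite ?mul1r ?mulr0. Qed.

Lemma fscale_sum s (I : Type) (r : seq I) (P : pred I) (F : I -> fps) :
  fscale s (\sum_(k <- r | P k) F k) = \sum_(k <- r | P k) fscale s (F k).
Proof. by apply: (big_morph (fscale s)) => [f g|]; [exact: fscaleD | exact: fscale_const]. Qed.

Lemma fderiv_scale s f : fderiv (fscale s f) = fconst s * fscale s (fderiv f).
Proof. by apply: fpsP => i; rewrite fcoef_constM /= exprS; ring. Qed.

(** The series [e ^ (x * X)]. *)
Definition fexp x := Fps (fun i => x ^+ i / i`!%:R).

Lemma fexp0 : fexp 0 = 1.
Proof. by apply: fpsP => -[|i] /=; rewrite ?expr0 ?divr1 // expr0n /= mul0r. Qed.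

Lemma fexpD x y : fexp (x + y) = fexp x * fexp y.
Proof.
apply: fpsP => i; rewrite fcoefM /= addrC exprDn mulr_suml; apply: eq_bigr => j _.
have ji : (j <= i)%N by rewrite -ltnS.
rewrite -(bin_fact ji) !natrM -mulr_natl.
have f0 k : k`!%:R != 0 :> R by rewrite pnatr_eq0 -lt0n fact_gt0.
have c0 : 'C(i, j)%:R != 0 :> R by rewrite pnatr_eq0 -lt0n bin_gt0.
by field; rewrite !f0 c0.
Qed.

Lemma fexp_sum (I : Type) (r : seq I) (F : I -> R) :
  fexp (\sum_(k <- r) F k) = \prod_(k <- r) fexp (F k).
Proof. by apply: (big_morph fexp); [exact: fexpD | exact: fexp0]. Qed.

Lemma fexp_natmul x j : fexp (j%:R * x) = fexp x ^+ j.
Proof.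
elim: j => [|j IH]; first by rewrite mul0r fexp0.
by rewrite -natr1 mulrDl mul1r fexpD IH exprSr.
Qed.

Lemma fderiv_exp x : fderiv (fexp x) = fconst x * fexp x.
Proof.
apply: fpsP => i; rewrite fcoef_constM /= factS natrM exprS.
have f0 : i`!%:R != 0 :> R by rewrite pnatr_eq0 -lt0n fact_gt0.
have : i.+1%:R != 0 :> R by rewrite pnatr_eq0.
by move: (i.+1%:R) => c c0; field; rewrite f0 c0.
Qed.

Lemma fscale_exp s x : fscale s (fexp x) = fexp (s * x).
Proof. by apply: fpsP => i /=; rewrite exprMn mulrA. Qed.

Lemma fconstM x y : fconst (x * y) = fconst x * fconst y.
Proof. by apply: fpsP => -[|i]; rewrite fcoef_constM /= ?mulr0. Qed.

(** The series [(e ^ X - 1) / X], given by its coefficients since [X] is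
    not invertible. *)
Definition fexpm1X := Fps (fun i => (i.+1)`!%:R^-1).

Lemma mulX_fexpm1X : fX * fexpm1X = fexp 1 - 1.
Proof.
apply: fpsP => -[|i]; rewrite fcoef_XM fcoefD fcoefN fcoef1 /=; first by rewrite expr0 divr1 subrr.
by rewrite expr1n mul1r subr0.
Qed.

Lemma mulX_fscale_expm1X h : fconst h * fX * fscale h fexpm1X = fexp h - 1.
Proof.
apply: fpsP => -[|i]; rewrite -mulrA fcoef_constM fcoef_XM fcoefD fcoefN fcoef1 /=.
  by rewrite mulr0 expr0 divr1 subrr.
by rewrite subr0 mulrA exprS.
Qed.

Section BernoulliLogDerivative.
Variable beta : fps.
Hypothesis betaE : beta * fexpm1X = 1.

Lemma expm1X_cancel f g : f * fexpm1X = g * fexpm1X -> f = g.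
Proof.
by move=> /(congr1 (fun h => h * beta)); rewrite -!mulrA [_ * beta]mulrC betaE !mulr1.
Qed.

(** The logarithmic derivative of [(e ^ X - 1) / X], see [fderiv_expm1X]:
    from [X * (log E)^() = X + X / (e ^ X - 1) - 1] its coefficients beyond
    the constant one are those of [beta], shifted. *)
Definition fexpm1X_logderiv := Fps (fun i => if i == 0%N then 2%:R^-1 else fcoef beta i.+1).

(** The identity [-X / (e ^ -X - 1) = X / (e ^ X - 1) + X], which says that
    [beta + X / 2] is even. *)
Lemma beta_opp : fscale (-1) beta = beta + fX.
Proof.
have E1 : fscale (-1) beta * (fexp (-1) * fexpm1X) = 1.
  have := congr1 (fscale (-1)) betaE; rewrite fscaleM => E.
  have -> : fexp (-1) * fexpm1X = fscale (-1) fexpm1X; last first.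
    by rewrite E (fscale_const _ 1).
  apply: fX_inj; rewrite mulrCA mulX_fexpm1X mulrBr -fexpD addNr fexp0 mulr1.
  have := mulX_fscale_expm1X (-1); rewrite -mulrA => E2.
  rewrite -[1 - _]opprB -E2; have -> : fconst (-1) = - 1 by apply: fpsP => -[|i] /=; rewrite ?oppr0.
  by rewrite mulN1r opprK.
have -> : beta + fX = beta * fexp 1.
  have -> : fexp 1 = 1 + fX * fexpm1X by rewrite mulX_fexpm1X addrC subrK.
  by rewrite mulrDr mulr1 mulrCA betaE mulr1.
apply: expm1X_cancel.
rewrite -mulrA [fexp 1 * _]mulrC mulrA betaE mul1r.
rewrite -[RHS]mulr1 -E1.
have ee : fexp 1 * fexp (-1) = 1 by rewrite -fexpD subrr fexp0.
rewrite -[LHS]mulr1 -ee; move: (fscale _ _) (fexp 1) (fexp (- 1)) fexpm1X => a b c d; ring.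
Qed.

Lemma beta1 : fcoef beta 1 = - 2%:R^-1.
Proof.
have := congr1 (fun f => fcoef f 1) beta_opp; rewrite fcoefD /= => E.
by move: E; rewrite expr1; lra.
Qed.

Lemma beta_odd k : fcoef beta (k.*2.+3) = 0.
Proof.
have := congr1 (fun f => fcoef f k.*2.+3) beta_opp; rewrite fcoefD /= => E.
by move: E; rewrite -signr_odd /= odd_double /= expr1 addr0; lra.
Qed.

Lemma mulX_fexpm1X_logderiv : fX * fexpm1X_logderiv = fX + beta - 1.
Proof.
have b0 : fcoef beta 0 = 1.
  have := congr1 (fun f => fcoef f 0) betaE.
  by rewrite fcoefM big_ord1 fcoef1 /= invr1 mulr1.
apply: fpsP => -[|[|i]]; rewrite fcoef_XM !fcoefD fcoefN fcoef1 /=.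
- by rewrite b0; ring.
- by rewrite beta1; field.
- by rewrite add0r subr0.
Qed.

Lemma fderiv_expm1X : fderiv fexpm1X = fexpm1X_logderiv * fexpm1X.
Proof.
apply: fX_inj; rewrite mulrA mulX_fexpm1X_logderiv mulrDl mulrDl betaE mulN1r.
have := congr1 fderiv mulX_fexpm1X.
rewrite fderivM fderiv_X mul1r fderivD fderiv_exp mul1r.
have -> : fderiv (- 1) = 0 by apply: fpsP => i; rewrite /= oppr0 mulr0 if_same.
have -> : fexp 1 = fX * fexpm1X + 1 by rewrite mulX_fexpm1X subrK.
rewrite addr0 => E; transitivity (fexpm1X + fX * fderiv fexpm1X - fexpm1X); first by ring.
rewrite E; ring.
Qed.

(** The moment series [G] of the uniform law on [{0, ..., h - 1}] is a
    geometric sum, equal to [E (h * X) / E (X)] with [E = (e ^ X - 1) / X];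
    its logarithmic derivative is a difference of two copies of that of
    [E]. *)
Lemma fderiv_unif_series (h : nat) : (0 < h)%N ->
  let G := fconst h%:R^-1 * \sum_(j < h) fexp j%:R in
  fderiv G = Fps (fun i => fcoef fexpm1X_logderiv i * (h%:R ^+ i.+1 - 1)) * G.
Proof.
move=> h0 G.
have hn0 : h%:R != 0 :> R by rewrite pnatr_eq0 -lt0n.
have chV : fconst h%:R * fconst h%:R^-1 = 1 by rewrite -fconstM mulfV.
have EG : G * fexpm1X = fscale h%:R fexpm1X.
  apply: fX_inj; rewrite mulrCA mulX_fexpm1X.
  have S : (\sum_(j < h) fexp j%:R) * (fexp 1 - 1) = fexp h%:R - 1.
    rewrite -[h%:R]mulr1 fexp_natmul subrX1 mulrC; congr (_ * _).
    by apply: eq_bigr => j _; rewrite -[j%:R]mulr1 fexp_natmul.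
  rewrite /G -mulrA S -mulX_fscale_expm1X !mulrA [_ * fconst h%:R]mulrC chV mul1r.
  by [].
set C := Fps _.
have CE : C = fconst h%:R * fscale h%:R fexpm1X_logderiv - fexpm1X_logderiv.
  by apply: fpsP => i; rewrite fcoefD fcoefN fcoef_constM /= exprS; ring.
apply: expm1X_cancel.
have : fderiv (G * fexpm1X) = fderiv (fscale h%:R fexpm1X) by rewrite EG.
rewrite fderivM fderiv_scale fderiv_expm1X fscaleM -EG CE => E.
transitivity (fderiv G * fexpm1X +
  G * (fexpm1X_logderiv * fexpm1X) - G * (fexpm1X_logderiv * fexpm1X)); first by ring.
by rewrite E; ring.
Qed.

(** The coefficients of the logarithmic derivative for the centred uniform
    law on [h] points: centring removes the constant term, which is the
    mean. *)
Definition unif_logderiv (h : nat) := Fps (fun i =>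
  if i == 0%N then 0 else fcoef beta i.+1 * (h%:R ^+ i.+1 - 1)).

Lemma fderiv_centered_unif (h : nat) (s : R) : (0 < h)%N ->
  let G := fconst h%:R^-1 * \sum_(j < h) fexp (s * (j%:R - (h%:R - 1) / 2)) in
  fderiv G = fconst s * fscale s (unif_logderiv h) * G.
Proof.
move=> h0 G; set G0 := fconst h%:R^-1 * \sum_(j < h) fexp j%:R.
have E := fderiv_unif_series h0; cbv zeta in E; rewrite -/G0 in E.
pose c : R := (h%:R - 1) / 2.
have GE : G = fscale s (fexp (- c) * G0).
  rewrite /G /G0 [fexp (- c) * _]mulrCA fscaleM fscale_const; congr (_ * _).
  rewrite mulr_sumr fscale_sum.
  by apply: eq_bigr => j _; rewrite -fexpD fscale_exp addrC.
rewrite GE fderiv_scale fderivM fderiv_exp E -[RHS]mulrA -[in RHS]fscaleM; congr (_ * fscale _ _).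
have -> : unif_logderiv h = fconst (- c) +
  Fps (fun i => fcoef fexpm1X_logderiv i * (h%:R ^+ i.+1 - 1)).
  by apply: fpsP => -[|i]; rewrite fcoefD /= ?add0r // expr1 /c; field.
ring.
Qed.

End BernoulliLogDerivative.
End FormalPowerSeries.

Local Open Scope classical_set_scope.
Local Open Scope ring_scope.

(** * Cumulants through the logarithmic derivative *)

Section CumulantRecursion.
Variable R : realFieldType.
Implicit Types (a c : nat -> R) (k : nat).

(** The equation [A^() = C * A] between series, on the coefficients of
    degree less than [k]; thus [C] is the derivative of [log A]. *)
Definition log_recursion a c k :=
  forall j, (j < k)%N -> j.+1%:R * a j.+1 = \sum_(i < j.+1) c i * a (j - i)%N.

(** Let [L] be the truncation of [log P]. Then
    [P * L^() = P^() - (1 - P) ^ (k+1) * P^()], a geometric sum, and the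
    last term has no coefficient of degree at most [k] because [1 - P] is
    divisible by [X]. So [L^()] obeys the recursion that defines [c], and
    the two agree up to degree [k]. *)
Lemma log_recursion_coef a c k : a 0%N = 1 -> log_recursion a c k.+1 ->
  k.+1%:R * (\sum_(1 <= r < k.+2)
     ((-1) ^+ r.-1 / r%:R) *: (\poly_(j < k.+2) a j - 1) ^+ r)`_k.+1 = c k.
Proof.
move=> a0 rec; set P := \poly_(j < k.+2) a j; set L := \sum_(1 <= r < _) _.
pose C := \poly_(j < k.+1) c j.
have P0 : P`_0 = 1 by rewrite coef_poly.
have PL : P * L^`() = P^`() - (1 - P) ^+ k.+1 * P^`().
  have -> : L^`() = (\sum_(r < k.+1) (1 - P) ^+ r) * P^`().
    rewrite /L big_add1 big_mkord raddf_sum mulr_suml; apply: eq_bigr => r _ /=.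
    rewrite derivZ deriv_exp derivB derivC subr0 /=.
    rewrite -[_ * _ *+ _]scaler_nat scalerA divfK ?pnatr_eq0 // [P^`() * _]mulrC scalerAl;
      congr (_ * _).
    by rewrite -[1 - P]opprB [(- (P - 1)) ^+ r]exprNn -mul_polyC polyC_exp polyCN.
  rewrite mulrA -{1}[P](subKr 1) -opprB mulNr -subrX1; ring.
have low j : (j < k.+1)%N -> ((1 - P) ^+ k.+1 * P^`())`_j = 0.
  move=> jk; have /factor_theorem[q qE] : root (1 - P) 0.
    by rewrite /root horner_coef0 coefB coef1 P0 subrr.
  by rewrite qE subr0 exprMn mulrAC coefMXn jk.
have LC j : (j < k.+1)%N -> L^`()`_j = C`_j.
  elim/ltn_ind: j => j IH jk.
  have : (P * L^`())`_j = (P * C)`_j.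
    rewrite PL coefB low // subr0 mulrC coefM coef_deriv coef_poly ltnS jk -mulr_natl rec //.
    apply: eq_bigr => i _; have ij := ltn_ord i; rewrite !coef_poly.
    by rewrite !ifT //; lia.
  rewrite !coefM !big_ord_recl P0 !mul1r subn0 (eq_bigr (fun i : 'I_j => P`_(lift ord0 i) *
    C`_(j - lift ord0 i))).
    by move/addIr.
  by move=> i _; rewrite IH //; have := ltn_ord i; rewrite /= /bump; lia.
by have := LC k (ltnSn k); rewrite coef_deriv coef_poly ltnSn mulr_natl.
Qed.

Lemma log_recursion_exists a k : a 0%N = 1 -> exists c, log_recursion a c k.
Proof.
move=> a0; elim: k => [|k [c rec]]; first by exists (fun=> 0).
exists (fun i => if i == k then k.+1%:R * a k.+1 - \sum_(i < k) c i * a (k - i)%N else c i).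
move=> j; rewrite ltnS leq_eqVlt => /orP[/eqP ->|jk].
  rewrite big_ord_recr /= eqxx subnn a0 mulr1.
  rewrite (eq_bigr (fun i : 'I_k => c i * a (k - i)%N)) ?subrKC //.
  by move=> i _; rewrite ltn_eqF.
rewrite rec //; apply: eq_bigr => i _; rewrite ltn_eqF //.
exact: leq_trans (ltn_ord i) jk.
Qed.

Lemma log_recursion_inj a a' c c' k : a 0%N = a' 0%N ->
  log_recursion a c k -> log_recursion a' c' k ->
  (forall j, (j < k)%N -> c j = c' j) -> forall j, (j <= k)%N -> a j = a' j.
Proof.
move=> a0 rec rec' cc'; elim/ltn_ind => -[//|j] IH jk.
apply: (@mulfI _ j.+1%:R); first by rewrite pnatr_eq0.
rewrite rec // rec' //; apply: eq_bigr => i _; have ij := ltn_ord i.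
by rewrite cc' ?IH //; lia.
Qed.
End CumulantRecursion.

(** * Bernoulli numbers as formal coefficients *)

Section BernoulliSeries.
Variable R : realType.

(** The lowest nonzero term would dominate near 0. *)
Lemma poly_small_coef0 (q : {poly R}) (C : R) (d : R) K : 0 < d ->
  (forall x, 0 < x <= d -> `|q.[x]| <= C * x ^+ K) ->
  forall i, (i < K)%N -> q`_i = 0.
Proof.
move=> d0; elim: K q => // K IH q qC.
have q0 : q.[0] = 0.
  have cq : q.[x] @[x --> (0 : R)^'+] --> q.[0].
    by apply: cvg_at_right_filter; exact: continuous_horner.
  have cz : q.[x] @[x --> (0 : R)^'+] --> (0 : R).
    apply/norm_cvg0P; apply: (@squeeze_cvgr _ _ _ _ (fun=> 0) (fun x => C * x ^+ K.+1)).
    - near=> x; rewrite normr_ge0 /=; apply: qC.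
      by apply/andP; split; [near: x; exact: nbhs_right_gt | near: x; exact: nbhs_right_le].
    - exact: cvg_cst.
    - rewrite -[X in _ --> X](mulr0 C) -[X in _ * X](expr0n _ K.+1) /=.
      apply: cvg_at_right_filter; apply: cvgMr; exact: exprn_continuous.
  by apply: cvg_unique cq cz.
have /factor_theorem[p pE] : root q 0 by apply/eqP.
rewrite subr0 in pE.
case=> [_|i]; first by rewrite -horner_coef0.
rewrite ltnS => iK; rewrite pE coefMX /=; apply: IH iK => x xd.
have x0 : 0 < x by case/andP: xd.
have := qC x xd; rewrite pE hornerMX normrM (gtr0_norm x0) exprSr mulrA.
by rewrite ler_pM2r.
Unshelve. all: by end_near. Qed.

(** Convergence at [r] bounds the terms there, so at [x <= r / 2] the tail
    is dominated by a geometric series. *)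
Lemma power_series_remainder (b : nat -> R) (r : R) : 0 < r ->
  cvgn (series (fun k => b k * r ^+ k)) ->
  forall K, exists C, forall x l, 0 < x <= r / 2 ->
    series (fun k => b k * x ^+ k) @ \oo --> l ->
    `|l - \sum_(i < K) b i * x ^+ i| <= C * x ^+ K.
Proof.
move=> r0 cvr K.
have [M M0 bM] : exists2 M, 0 <= M & forall k, `|b k * r ^+ k| <= M.
  have /cvg_seq_bounded : cvgn (fun k => b k * r ^+ k).
    by apply/cvg_ex; exists 0; exact: cvg_series_cvg_0.
  move=> [M [Mr bM]]; exists (`|M| + 1); first by rewrite addr_ge0.
  by move=> k; apply: bM => //; rewrite (le_lt_trans (ler_norm M)) // ltrDl.
exists (2 * M / r ^+ K) => x l /andP[x0 xr] cvl.
have q0 : 0 <= x / r by rewrite divr_ge0 // ltW.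
have q2 : x / r <= 2^-1 by rewrite ler_pdivrMr // mulrC.
have bnd k : `|b k * x ^+ k| <= M * (x / r) ^+ k.
  rewrite (_ : b k * x ^+ k = b k * r ^+ k * (x / r) ^+ k); last first.
    by rewrite expr_div_n; field; rewrite expf_neq0 // gt_eqF.
  by rewrite normrM [X in _ * X]ger0_norm ?exprn_ge0 // ler_wpM2r ?exprn_ge0.
have part n : `|series (fun k => b k * x ^+ k) (K + n)%N - \sum_(i < K) b i * x ^+ i|
   <= 2 * M / r ^+ K * x ^+ K.
  rewrite /series /= -(big_mkord predT (fun i => b i * x ^+ i)).
  rewrite (@big_cat_nat _ _ _ K) ?leq_addr //= addrC addrK.
  apply: le_trans (ler_norm_sum _ _ _) _.
  apply: le_trans (_ : \sum_(K <= i < K + n) M * (x / r) ^+ i <= _).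
    by apply: ler_sum => i _; exact: bnd.
  rewrite -{1}[K]add0n big_addn addKn -mulr_sumr.
  rewrite (eq_bigr (fun i => (x / r) ^+ K * (x / r) ^+ i)); last first.
    by move=> i _; rewrite exprD mulrC.
  rewrite -mulr_sumr (_ : 2 * M / r ^+ K * x ^+ K = M * ((x / r) ^+ K * 2)); last first.
    by rewrite expr_div_n; ring.
  rewrite ler_wpM2l // ler_wpM2l ?exprn_ge0 //.
  apply: le_trans (_ : \sum_(0 <= i < n) (2^-1) ^+ i <= _).
    by apply: ler_sum => i _; rewrite lerXn2r // nnegrE invr_ge0.
  elim: n => [|n IH]; first by rewrite big_nil.
  rewrite big_nat_recl // expr0 (eq_bigr (fun i => 2^-1 * 2^-1 ^+ i)); last by move=> i _;
    rewrite exprS.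
  by rewrite -mulr_sumr; lra.
have cv2 : (fun n => `|series (fun k => b k * x ^+ k) (n + K)%N - \sum_(i < K) b i * x ^+ i|) @ \oo
    --> `|l - \sum_(i < K) b i * x ^+ i|.
  by apply: cvg_norm; apply: cvgB; [rewrite cvg_shiftn | exact: cvg_cst].
by apply: (cvgr_to_le cv2); near=> n; rewrite addnC part.
Unshelve. all: by end_near. Qed.

Lemma cvg_series_expR (x : R) : series (fun k => (k`!)%:R^-1 * x ^+ k) @ \oo --> expR x.
Proof.
rewrite (_ : series _ = series (exp_coeff x)); first exact: is_cvg_series_exp_coeff.
by congr series; apply/funext => k; rewrite /exp_coeff mulrC.
Qed.

(** The analytic definition of the Bernoulli numbers yields the formal one:
    at small [x > 0] the product of the truncated series [p] and [q] for
    [x / (e ^ x - 1)] and [(e ^ x - 1) / x] differs from 1 by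
    [O(x ^ (K+1))], so the coefficients of [p * q - 1] up to [K] vanish. *)
Lemma bernoulli_fps (B : nat -> R) : bernoulli_numbers B ->
  Fps (fun k => B k / (k`!)%:R) * fexpm1X R = 1.
Proof.
case/nbhs_ballP => e /= e0 HB.
pose b k := B k / (k`!)%:R.
have {}HB x : 0 < x < e -> series (fun k => b k * x ^+ k) @ \oo --> x / (expR x - 1).
  move=> /andP[x0 xe].
  rewrite (_ : series _ = series (fun k => B k * x ^+ k / (k`!)%:R)).
    apply: HB; last by rewrite gt_eqF.
    by rewrite /ball /= sub0r normrN gtr0_norm.
  by congr series; apply/funext => k; rewrite /b mulrAC.
pose r := Num.min (e / 2) 1.
have r0 : 0 < r by rewrite lt_min ltr01 andbT divr_gt0.
have r1 : r <= 1 by rewrite ge_min lexx orbT.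
have re : r < e by rewrite gt_min; apply/orP; left; rewrite ltr_pdivrMr // ltr_pMr // ltr1n.
have cvb : cvgn (series (fun k => b k * r ^+ k)).
  by apply/cvg_ex; exists (r / (expR r - 1)); apply: HB; rewrite r0.
have cve : cvgn (series (fun k => (k`!)%:R^-1 * r ^+ k)).
  by apply/cvg_ex; exists (expR r); exact: cvg_series_expR.
have [C1 HC1] := power_series_remainder r0 cve 1.
apply: fpsP => K; rewrite (@fcoef_fmul _ K.+1) // fcoef1.
set p := ftrunc K.+1 _; set q := ftrunc K.+1 _.
suff : (p * q - 1)`_K = 0 by rewrite coefB coef1 => /eqP; rewrite subr_eq0 => /eqP.
have [C HC] := power_series_remainder r0 cvb K.+1.
have [D HD] := power_series_remainder r0 cve K.+2.
pose A := \sum_(i < K.+1) `|b i|.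
apply: (@poly_small_coef0 _ (`|C| * `|C1| + A * `|D|) (r / 2) K.+1) => //; first exact: divr_gt0.
move=> x /[dup] xr /andP[x0 xr2].
have x1 : x <= 1 by apply: le_trans xr2 _; rewrite ler_pdivrMr //; lra.
have xe : 0 < x < e by rewrite x0 /=; apply: le_lt_trans xr2 _; lra.
have {HC}hC := HC x _ xr (HB x xe).
have {HD}hD := HD x _ xr (@cvg_series_expR x).
have {HC1}hC1 := HC1 x _ xr (@cvg_series_expR x).
have pE : p.[x] = \sum_(i < K.+1) b i * x ^+ i by rewrite horner_poly.
have qE : \sum_(i < K.+2) (i`!)%:R^-1 * x ^+ i = 1 + x * q.[x].
  rewrite big_ord_recl expr0 mulr1 invr1 horner_poly mulr_sumr; congr (_ + _).
  by apply: eq_bigr => i _; rewrite /= exprS; ring.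
rewrite -pE in hC; rewrite qE in hD.
rewrite big_ord1 expr0 mulr1 invr1 expr1 in hC1.
have ex0 : expR x - 1 != 0 by rewrite gt_eqF // subr_gt0 expR_gt1.
have pA : `|p.[x]| <= A.
  rewrite pE; apply: le_trans (ler_norm_sum _ _ _) _; apply: ler_sum => i _.
  rewrite normrM ler_piMr // normrX exprn_ile1 // gtr0_norm //.
have key : x * (p.[x] * q.[x] - 1) =
   - ((x / (expR x - 1) - p.[x]) * (expR x - 1) + p.[x] * (expR x - (1 + x * q.[x]))).
  by field.
rewrite -(ler_pM2l x0) -{1}(gtr0_norm x0) -normrM (_ : (p * q - 1).[x] =
  p.[x] * q.[x] - 1) ?key ?normrN; last by rewrite !hornerE.
apply: le_trans (ler_normD _ _) _; rewrite !normrM.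
have -> : x * ((`|C| * `|C1| + A * `|D|) * x ^+ K.+1) =
   (`|C| * x ^+ K.+1) * (`|C1| * x) + A * (`|D| * x ^+ K.+2).
  by rewrite [x ^+ K.+2]exprS; ring.
have xk k : 0 <= x ^+ k by rewrite exprn_ge0 // ltW.
apply: lerD; apply: ler_pM => //.
- by apply: le_trans hC _; rewrite ler_wpM2r // ler_norm.
- by apply: le_trans hC1 _; rewrite ler_wpM2r // ?ler_norm // ltW.
- by apply: le_trans hD _; rewrite ler_wpM2r // ler_norm.
Qed.
End BernoulliSeries.

(** * Expectations of real random variables *)

Section RealExpectation.
Context d (T : measurableType d) (R : realType) (P : probability T R).
Implicit Types f g : T -> R.

Local Notation mfun f := (measurable_fun [set: T] (f : T -> R)).
Local Notation intg f := (P.-integrable [set: T] (EFin \o (f : T -> R))).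

Lemma integrable_bounded f (M : R) : mfun f -> (forall x, `|f x| <= M) -> intg f.
Proof.
move=> mf fM; apply: measurable_bounded_integrable => //.
  by rewrite (le_lt_trans (probability_le1 P _)) ?ltry.
by exists M; split; rewrite ?num_real // => y My x _; apply: le_trans (fM x) (ltW My).
Qed.

Lemma le_integrable_norm f g : mfun f -> (forall x, `|f x| <= g x) -> intg g -> intg f.
Proof.
move=> mf fg; apply: le_integrable => //; first exact/measurable_EFinP.
by move=> x _ /=; rewrite lee_fin; apply: le_trans (fg x) (ler_norm _).
Qed.

Lemma integrable_addR f g : intg f -> intg g -> intg (fun x => f x + g x).
Proof. exact: integrableD. Qed.

Lemma integrable_subR f g : intg f -> intg g -> intg (fun x => f x - g x).
Proof. exact: integrableB. Qed.

Lemma integrable_mulrl (c : R) f : intg f -> intg (fun x => c * f x).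
Proof. exact: integrableZl. Qed.

Lemma integrable_mulrr (c : R) f : intg f -> intg (fun x => f x * c).
Proof. exact: integrableZr. Qed.

Lemma expectationE f : intg f -> 'E_P[f]%E = (\int[P]_x f x)%:E.
Proof. by move=> fi; rewrite unlock /Rintegral fineK // integrable_fin_num. Qed.

Lemma Rexpectation_cst (r : R) : \int[P]_x r = r :> R.
Proof. by rewrite Rintegral_cst // (_ : fine _ = 1) ?mulr1 //;
  exact: (congr1 fine (probability_setT P)). Qed.

Lemma Rexpectation_sum (I : eqType) (s : seq I) (F : I -> T -> R) :
  {in s, forall i, intg (F i)} ->
  intg (fun x => \sum_(i <- s) F i x) /\
  \int[P]_x (\sum_(i <- s) F i x) = \sum_(i <- s) \int[P]_x F i x.
Proof.
elim: s => [|i s IH] Fi.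
  have E : (fun x : T => \sum_(i <- [::]) F i x) = cst 0.
    by apply/funext=> x; rewrite big_nil.
  rewrite E big_nil Rexpectation_cst; split=> //.
  exact: finite_measure_integrable_cst.
have [|si se] := IH; first by move=> j js; apply: Fi; rewrite in_cons js orbT.
have ii : intg (F i) by apply: Fi; rewrite mem_head.
have -> : (fun x => \sum_(j <- i :: s) F j x) = (fun x => F i x + \sum_(j <- s) F j x).
  by apply/funext=> x; rewrite big_cons.
split; last by rewrite RintegralD // se big_cons.
exact: integrable_addR.
Qed.

Lemma dominated_Rintegral (F : nat -> T -> R) f (g : T -> R) :
  (forall m, mfun (F m)) -> mfun f -> {ae P, forall x, F ^~ x @ \oo --> f x} ->
  intg g -> (forall m x, `|F m x| <= g x) ->
  intg f /\ \int[P]_x F m x @[m --> \oo] --> \int[P]_x f x.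
Proof.
move=> mF mf Ff gi Fg.
have [] := @dominated_convergence _ _ _ P setT measurableT (fun m => EFin \o F m) (EFin \o f)
  (EFin \o g).
- by move=> m; exact/measurable_EFinP.
- exact/measurable_EFinP.
- by apply: filterS Ff => x Fx _; apply/cvg_EFin => //; near=> n.
- exact: gi.
- by apply: aeW => x m _ /=; rewrite lee_fin.
move=> fi _ cv; split=> //; apply: fine_cvg.
by rewrite /Rintegral fineK ?integrable_fin_num //.
Unshelve. all: by end_near. Qed.

Lemma bounded_cvg_Rintegral (F : nat -> T -> R) f (M : R) :
  (forall m, mfun (F m)) -> mfun f -> {ae P, forall x, F ^~ x @ \oo --> f x} ->
  (forall m x, `|F m x| <= M) ->
  \int[P]_x F m x @[m --> \oo] --> \int[P]_x f x.
Proof.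
move=> mF mf Ff FM; apply: (proj2 (@dominated_Rintegral _ _ (cst M) mF mf Ff _ FM)).
exact: finite_measure_integrable_cst.
Qed.

(** Truncated at a level [c], the variables are bounded and converge in
    mean; letting [c] grow gives the bound for the limit. *)
Lemma fatou_Rintegral (F : nat -> T -> R) f (K : R) :
  (forall m, mfun (F m)) -> mfun f -> {ae P, forall x, F ^~ x @ \oo --> f x} ->
  (forall m x, 0 <= F m x) -> (forall x, 0 <= f x) ->
  (forall m, intg (F m)) -> (forall m, \int[P]_x F m x <= K) ->
  intg f /\ \int[P]_x f x <= K.
Proof.
move=> mF mf Ff F0 f0 Fi FK.
have mmin (h : T -> R) (c : R) : mfun h -> mfun (fun x => Num.min (h x) c).
  by move=> mh; apply: measurable_minr.
have mf' (c : nat) : mfun (fun x => Num.min (f x) c%:R) by exact: mmin.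
have minb (y : R) (c : nat) : 0 <= y -> `|Num.min y c%:R| <= c%:R.
  by move=> y0; rewrite ger0_norm ?ge_min ?lexx ?orbT // le_min y0 ler0n.
have cK (c : nat) : \int[P]_x Num.min (f x) c%:R <= K.
  have cv : \int[P]_x Num.min (F m x) c%:R @[m --> \oo] --> \int[P]_x Num.min (f x) c%:R.
    apply: (@bounded_cvg_Rintegral _ _ c%:R) => [m|||m x]; [exact: mmin|exact: mmin| |exact: minb].
    apply: filterS Ff => x Fx; apply: (cvg_comp (F ^~ x) (fun y : R => Num.min y c%:R) Fx).
    by apply: (@continuous_min R R id (cst c%:R) (f x)); [exact: cvg_id | exact: cvg_cst].
  apply: (cvgr_to_le cv); near=> m; apply: le_trans (FK m).
  apply: le_Rintegral => //; first by apply: (@integrable_bounded _ c%:R) => [|x];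
    [exact: mmin | exact: minb].
  by move=> x _; rewrite ge_min lexx.
have le : (\int[P]_x (f x)%:E <= K%:E)%E.
  pose g (c : nat) (x : T) := (Num.min (f x) c%:R)%:E.
  have mg c : measurable_fun setT (g c) by exact/measurable_EFinP.
  have g0 c x : (0 <= g c x)%E by rewrite lee_fin le_min f0 ler0n.
  have ndg x : setT x -> {homo g^~ x : m n / (m <= n)%N >-> (m <= n)%E}.
    by move=> _ m n mn; rewrite lee_fin le_min2 // ler_nat.
  have gf x : (limn (g ^~ x) = (f x)%:E).
    apply: cvg_lim => //; apply: cvg_near_cst; near=> c; rewrite /g min_l //.
    by near: c; exact: nbhs_infty_ger.
  under eq_integral do rewrite -gf.
  rewrite monotone_convergence //; apply: lime_le.
    by apply: ereal_nondecreasing_is_cvgn => m n mn; apply: ge0_le_integral => // x _; exact: ndg.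
  apply: nearW => c; rewrite -[leLHS]fineK; first by rewrite lee_fin cK.
  by apply: integrable_fin_num => //; apply: (@integrable_bounded _ c%:R) => [|x];
    [exact: mmin | exact: minb].
have fi : intg f.
  apply/integrableP; split; first exact/measurable_EFinP.
  under eq_integral do rewrite /= ger0_norm //.
  by rewrite (le_lt_trans le) ?ltry.
split=> //; rewrite -lee_fin /Rintegral fineK //; exact: integrable_fin_num.
Unshelve. all: by end_near. Qed.
End RealExpectation.

(** * Consequences of mean square bounds *)

Section L2Convergence.
Context d (T : measurableType d) (R : realType) (P : probability T R).
Implicit Types f g : T -> R.

Local Notation mfun f := (measurable_fun [set: T] (f : T -> R)).
Local Notation intg f := (P.-integrable [set: T] (EFin \o (f : T -> R))).

Definition clip (c x : R) := Num.max (- c) (Num.min x c).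

Lemma clip_bound c x : 0 <= c -> `|clip c x| <= c.
Proof. by move=> c0; rewrite ler_norml /clip le_max lexx /= ge_max ge_min lexx orbT andbT; lra. Qed.

Lemma clip_id c x : `|x| <= c -> clip c x = x.
Proof. by rewrite ler_norml => /andP[cx xc]; rewrite /clip min_l // max_r. Qed.

(** Clipping at a high level is negligible in mean for variables bounded in
    mean square. *)
Lemma clip_dist c x : 0 < c -> `|x - clip c x| <= x ^+ 2 / c.
Proof.
move=> c0; have [xc|xc] := lerP `|x| c.
  by rewrite clip_id // subrr normr0 divr_ge0 ?sqr_ge0 // ltW.
rewrite ler_pdivlMr // -real_normK ?num_real // expr2 ler_pM //; first exact: ltW.
  rewrite /clip; have [x0|x0] := lerP 0 x.
    by move: xc; rewrite ger0_norm // => xc; rewrite min_r ?max_r ?ger0_norm; lra.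
  by move: xc; rewrite ltr0_norm // => xc; rewrite min_l ?max_l ?ler0_norm; lra.
exact: ltW.
Qed.

Lemma continuous_clip c : continuous (clip c).
Proof.
move=> x; apply: (@continuous_max R R (cst (- c)) (fun y => Num.min y c) x); first exact: cvg_cst.
by apply: (@continuous_min R R id (cst c) x); [exact: cvg_id | exact: cvg_cst].
Qed.

Lemma measurable_clip c : measurable_fun [set: R] (clip c).
Proof. exact: continuous_measurable_fun (@continuous_clip c). Qed.

Lemma integrable_of_sqr f : mfun f -> intg (fun x => f x ^+ 2) -> intg f.
Proof.
move=> mf f2; apply: (@le_integrable_norm _ _ _ P f (fun x => 1 + f x ^+ 2)) => //.
  move=> x; rewrite -[f x ^+ 2]real_normK ?num_real //.
  by have := sqr_ge0 (`|f x| - 1); have := sqr_ge0 (`|f x|); nra.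
by apply: integrable_addR => //; exact: finite_measure_integrable_cst.
Qed.

(** A bound in mean square gives uniform integrability: clipping at [c]
    changes every expectation by at most [K / c], and the clipped variables
    converge by boundedness. *)
Lemma L2_bounded_cvg_Rintegral (F : nat -> T -> R) f (K : R) :
  (forall m, mfun (F m)) -> mfun f -> {ae P, forall x, F ^~ x @ \oo --> f x} ->
  (forall m, intg (fun x => F m x ^+ 2)) -> (forall m, \int[P]_x (F m x ^+ 2) <= K) ->
  intg f /\ \int[P]_x F m x @[m --> \oo] --> \int[P]_x f x.
Proof.
move=> mF mf Ff F2 FK.
have msq g : mfun g -> mfun (fun x => g x ^+ 2) by move=> mg; exact: measurable_funX.
have [f2 fK] : intg (fun x => f x ^+ 2) /\ \int[P]_x (f x ^+ 2) <= K.
  apply: (@fatou_Rintegral _ _ _ P (fun m x => F m x ^+ 2)) => //.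
  - by move=> m; exact: msq.
  - exact: msq.
  - by apply: filterS Ff => x Fx; apply: (cvg_comp (F ^~ x) (fun y : R => y ^+ 2) Fx);
    exact: exprn_continuous.
  - by move=> m x; exact: sqr_ge0.
  - by move=> x; exact: sqr_ge0.
have fi := integrable_of_sqr mf f2.
have Fi m := integrable_of_sqr (mF m) (F2 m).
have K0 : 0 <= K by apply: le_trans fK; apply: Rintegral_ge0 => x _; exact: sqr_ge0.
have mclip c g : mfun g -> mfun (fun x => clip c (g x)).
  by move=> mg; exact: measurableT_comp (measurable_clip c) mg.
have iclip c g : 0 <= c -> mfun g -> intg (fun x => clip c (g x)).
  by move=> c0 mg; apply: (@integrable_bounded _ _ _ _ _ c); [exact: mclip | move=> x;
    exact: clip_bound].
have near_clip c g : 0 < c -> mfun g -> intg g -> intg (fun x => g x ^+ 2) ->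
  \int[P]_x (g x ^+ 2) <= K ->
    `|\int[P]_x g x - \int[P]_x clip c (g x)| <= K / c.
  move=> c0 mg gi g2 gK; have ic := iclip c g (ltW c0) mg.
  have id : intg (fun x => g x - clip c (g x)).
    exact: integrable_subR.
  rewrite -RintegralB //; apply: le_trans (le_normr_Rintegral _ _) _ => //.
  apply: le_trans (_ : \int[P]_x (c^-1 * g x ^+ 2) <= _).
    apply: le_Rintegral => //; [exact: integrable_norm | | by move=> x _; rewrite mulrC;
      exact: clip_dist].
    exact: integrable_mulrl.
  by rewrite RintegralZl // mulrC ler_wpM2r // invr_ge0 ltW.
split=> //; apply/cvgrPdist_lt => e e0.
(* Chosen so that clipping costs at most [e / 4] for each of the two
   expectations; the summand 1 keeps [c] positive when [K] is 0. *)
pose c := 4 * K / e + 1.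
have c0 : 0 < c by rewrite /c ltr_wpDl // divr_ge0 ?mulr_ge0 // ltW.
have Kc : K / c < e / 2.
  rewrite ltr_pdivrMr // /c mulrDr mulr1.
  have -> : e / 2 * (4 * K / e) = 2 * K by field; rewrite gt_eqF.
  by apply: le_lt_trans (_ : 2 * K < _); rewrite ?ltrDl ?divr_gt0 //; lra.
have Kc' : K / c <= e / 4.
  rewrite ler_pdivrMr // /c mulrDr mulr1.
  have -> : e / 4 * (4 * K / e) = K by field; rewrite gt_eqF.
  by rewrite lerDl divr_ge0 // ltW.
have cv : \int[P]_x clip c (F m x) @[m --> \oo] --> \int[P]_x clip c (f x).
  apply: (@bounded_cvg_Rintegral _ _ _ _ _ _ c) => [m|||m x].
  - exact: mclip.
  - exact: mclip.
  - by apply: filterS Ff => x Fx; apply: (cvg_comp (F ^~ x) (clip c) Fx); exact: continuous_clip.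
  - by apply: clip_bound; exact: ltW.
near=> m.
have h1 := near_clip c f c0 mf fi f2 fK.
have h2 := near_clip c (F m) c0 (mF m) (Fi m) (F2 m) (FK m).
have h3 : `|\int[P]_x clip c (f x) - \int[P]_x clip c (F m x)| < e / 4.
  by near: m; move/cvgrPdist_lt: cv; apply; rewrite divr_gt0.
move: h1 h2 h3; move: (\int[P]_x f x) (\int[P]_x F m x) (\int[P]_x clip c (f x)) (\int[P]_x
  clip c (F m x)) => A B C D.
rewrite !ler_norml !ltr_norml => /andP[? ?] /andP[? ?] /andP[? ?]; apply/andP; split; lra.
Unshelve. all: by end_near. Qed.

(** The sum of [(3/2) ^ m * F m x ^ 2] has finite expectation, hence is
    finite almost surely, and [|y| <= q ^ m * y ^ 2 + q ^ (- m)] then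
    bounds the series of absolute values. *)
Lemma series_cvg_ae (F : nat -> T -> R) :
  (forall m, mfun (F m)) -> (forall m, intg (fun x => F m x ^+ 2)) ->
  (forall m, \int[P]_x (F m x ^+ 2) <= 2^-1 ^+ m) ->
  {ae P, forall x, cvgn (series (F ^~ x))}.
Proof.
move=> mF F2 FK; pose q : R := 3 / 2.
pose g m (x : T) := (q ^+ m * F m x ^+ 2)%:E.
have q0 m : 0 <= q ^+ m by rewrite exprn_ge0 // /q; lra.
have mg m : measurable_fun [set: T] (g m).
  by apply/measurable_EFinP; apply: measurable_funM => //; exact: measurable_funX.
have g0 m x : (0 <= g m x)%E by rewrite lee_fin mulr_ge0 ?sqr_ge0.
have ig : (\int[P]_x \sum_(0 <= m <oo) g m x < +oo)%E.
  rewrite integral_nneseries //.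
  apply: le_lt_trans (_ : _ <= 4%:E)%E _; last exact: ltry.
  apply: lime_le; first by apply: is_cvg_nneseries => n _ _; apply: integral_ge0.
  apply: nearW => n; apply: le_trans (_ : _ <= \sum_(0 <= i < n) ((3 / 4) ^+ i)%:E)%E _.
    apply: lee_sum => i _; rewrite /g.
    under eq_integral do rewrite EFinM.
    rewrite ge0_integralZl_EFin //; [|by move=> x _;
      rewrite lee_fin sqr_ge0|by apply/measurable_EFinP; exact: measurable_funX].
    rewrite -[X in (_ * X)%E]fineK; last exact: integrable_fin_num (F2 i).
    have -> : 3 / 4 = q * 2^-1 :> R by rewrite /q; field.
    by rewrite -EFinM lee_fin [leRHS]exprMn ler_wpM2l // FK.
  rewrite sumEFin lee_fin.
  elim: n => [|n IH]; first by rewrite big_nil.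
  rewrite big_nat_recl // expr0 (eq_bigr (fun i => 3 / 4 * (3 / 4) ^+ i)); last by move=> i _;
    rewrite exprS.
  by rewrite -mulr_sumr; lra.
have ae : {ae P, forall x, setT x -> (\sum_(0 <= m <oo) g m x)%E \is a fin_num}.
  apply: integrable_ae => //; apply/integrableP; split.
    by apply: ge0_emeasurable_sum.
  by under eq_integral do rewrite gee0_abs ?nneseries_ge0 //.
apply: filterS ae => x /(_ I) fx; apply: normed_cvg.
pose M := fine (\sum_(0 <= m <oo) g m x)%E.
apply: (@nondecreasing_is_cvgn _ (series (fun m => `|F m x|))).
  by apply/nondecreasing_seqP => n; rewrite /series /= big_nat_recr //= lerDl.
exists (M + 3) => _ [n _ <-]; rewrite /series /=.
have h1 : \sum_(0 <= m < n) q ^+ m * F m x ^+ 2 <= M.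
  rewrite -lee_fin -sumEFin /M fineK //.
  by apply: (@nneseries_lim_ge _ (fun m => g m x)) => k _ _; exact: g0.
have h2 : \sum_(0 <= m < n) (2 / 3 : R) ^+ m <= 3.
  elim: (n) => [|k IH]; first by rewrite big_nil.
  rewrite big_nat_recl // expr0 (eq_bigr (fun i => 2 / 3 * (2 / 3) ^+ i)); last by move=> i _;
    rewrite exprS.
  by rewrite -mulr_sumr; lra.
apply: le_trans (lerD h1 h2); rewrite -big_split /=; apply: ler_sum => m _.
set a := q ^+ m; set b := _ ^+ m; set y := F m x.
have ab : a * b = 1 by rewrite -exprMn /q (_ : 3 / 2 * (2 / 3) = 1) ?expr1n //; field.
have a0 : 0 < a by rewrite exprn_gt0 // /q; lra.
have b0 : 0 < b by rewrite exprn_gt0 //; lra.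
rewrite -[y ^+ 2]real_normK ?num_real //; move: `|y| => z.
by rewrite -(ler_pM2l a0) mulrDr ab; have := sqr_ge0 (a * z - 2^-1); nra.
Qed.
End L2Convergence.

(** * Independence *)

Section Independence.
Context d (T : measurableType d) (R : realType) (P : probability T R).
Implicit Types f g : T -> R.

Local Notation mfun f := (measurable_fun [set: T] (f : T -> R)).
Local Notation intg f := (P.-integrable [set: T] (EFin \o (f : T -> R))).

Lemma finite_Rexpectation (V : finType) (Z : T -> V) (g : V -> R) :
  (forall v, measurable (Z @^-1` [set v])) ->
  intg (fun x => g (Z x)) /\
  \int[P]_x g (Z x) = \sum_v g v * fine (P (Z @^-1` [set v])).
Proof.
move=> mZ.
have E : (fun x => g (Z x)) = (fun x => \sum_v g v * \1_(Z @^-1` [set v]) x).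
  apply/funext=> x; rewrite (bigD1 (Z x)) //= indicE mem_set // mulr1 big1 ?addr0 // => v vZ.
  by rewrite indicE memNset ?mulr0 // => /= Zv; rewrite Zv eqxx in vZ.
have i1 v : intg (\1_(Z @^-1` [set v])) by exact: integrable_indic.
rewrite E; have [|si ->] := @Rexpectation_sum _ _ _ P _ (index_enum V) (fun v x => g v * \1_(Z
  @^-1` [set v]) x).
  by move=> v _; exact: integrable_mulrl.
split=> //; apply: eq_bigr => v _; rewrite RintegralZl //; congr (_ * fine _).
by rewrite integral_indic // setIT.
Qed.

(** The joint law is the product of the two laws, so the iterated integral
    splits. *)
Lemma indep_Rexpectation_mul f g (M : R) : mfun f -> mfun g ->
  (forall x, `|f x| <= M) -> (forall x, `|g x| <= M) ->
  (forall A B : set R, measurable A -> measurable B ->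
     P (f @^-1` A `&` g @^-1` B) = (P (f @^-1` A) * P (g @^-1` B))%E) ->
  \int[P]_x (f x * g x) = \int[P]_x f x * \int[P]_x g x.
Proof.
move=> mf mg fM gM fg.
pose X : {RV P >-> R} := HB.pack f (isMeasurableFun.Build _ _ _ _ _ mf).
pose Y : {RV P >-> R} := HB.pack g (isMeasurableFun.Build _ _ _ _ _ mg).
have mXY : measurable_fun setT (fun x => (f x, g x)) by exact: measurable_fun_pair.
pose Z : {RV P >-> (R * R)%type} := HB.pack (fun x => (f x,
  g x)) (isMeasurableFun.Build _ _ _ _ _ mXY).
have mu W : measurable W -> (distribution P X \x distribution P Y)%E W = distribution P Z W.
  by apply: product_measure_unique => A B mA mB; rewrite -fg.
(* The product of coordinates is unbounded on the plane; clipping makes it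
   integrable without changing it on the values taken. *)
pose h (z : R * R) := (clip M z.1 * clip M z.2)%:E.
have mh : measurable_fun setT h.
  apply/measurable_EFinP; apply: measurable_funM.
    exact: measurableT_comp (measurable_clip M) measurable_fst.
  exact: measurableT_comp (measurable_clip M) measurable_snd.
have ifi : intg f by exact: integrable_bounded fM.
have igi : intg g by exact: integrable_bounded gM.
have M0 : 0 <= M by apply: le_trans (fM point); exact: normr_ge0.
have cb x y : `|clip M x * clip M y| <= M * M by rewrite normrM ler_pM ?clip_bound.
have push (phi : R -> R) (W : {RV P >-> R}) (N : R) : measurable_fun setT phi ->
  (forall y, `|phi y| <= N) ->
    (\int[distribution P W]_y (phi y)%:E = \int[P]_x (phi (W x))%:E)%E.
  move=> mphi phiN; rewrite integral_distribution //; first exact/measurable_EFinP.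
  apply: (@integrable_bounded _ _ _ P (phi \o W) N) => [|x /=]; last exact: phiN.
  exact: measurableT_comp.
have E1 : (\int[P]_x (f x * g x)%:E = \int[distribution P Z]_z h z)%E.
  rewrite integral_distribution //.
    by apply: eq_integral => x _; rewrite /h /= !clip_id.
  apply: (@integrable_bounded _ _ _ P (fun x => clip M (f x) * clip M (g x)) (M * M)) => [|x];
    last exact: cb.
  by apply: measurable_funM; apply: measurableT_comp => //; exact: measurable_clip.
have ih : (distribution P X \x distribution P Y)%E.-integrable setT h.
  apply: measurable_bounded_integrable => //; last first.
  - exists (M * M); split; rewrite ?num_real // => y My z _; exact: le_trans (cb _ _) (ltW My).
  - exact/measurable_EFinP.
  - have := mu _ measurableT; rewrite /= => ->.
    exact: le_lt_trans (probability_le1 (distribution P Z) measurableT) (ltry _).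
rewrite /Rintegral E1 (eq_measure_integral (distribution P X \x distribution P Y)%E);
  last by move=> W mW _; exact/esym/mu.
have E2 x : (\int[distribution P Y]_y h (x, y) = (clip M x)%:E * (\int[P]_x g x)%:E)%E.
  rewrite /h /=; under eq_integral do rewrite EFinM.
  rewrite integralZl //; last first.
    by apply: (@integrable_bounded _ _ _ (distribution P Y) (clip M) M) => [|y];
      [exact: measurable_clip | exact: clip_bound].
  rewrite (push (clip M) Y M (measurable_clip M) (fun y => clip_bound y M0)); congr (_ * _)%E.
  rewrite (eq_integral (EFin \o g)); last by move=> y _; rewrite /= clip_id.
  by rewrite /Rintegral fineK //; exact: integrable_fin_num.
rewrite -integral12_prod_meas1 // /fubini_F.
rewrite (eq_integral _ _ (fun x _ => E2 x)).
rewrite integralZr //; last first.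
  apply: (@integrable_bounded _ _ _ (distribution P X) (clip M) M) => [|y];
    [exact: measurable_clip | exact: clip_bound].
rewrite (push (clip M) X M (measurable_clip M) (fun y => clip_bound y M0)).
rewrite (eq_integral (EFin \o f) (fun x => (clip M (X x))%:E)); last by move=> y _;
  rewrite /= clip_id.
by rewrite fineM //=; exact: integrable_fin_num.
Qed.

(** Orthogonal summands: the mean square of the sum is the sum of the mean
    squares. *)
Lemma sum_sqr_Rexpectation_le (I : eqType) (s : seq I) (F : I -> T -> R) (c : R) :
  uniq s -> (forall i, mfun (F i)) -> (forall i x, `|F i x| <= c) ->
  (forall i j, i != j -> \int[P]_x (F i x * F j x) = 0) ->
  intg (fun x => (\sum_(i <- s) F i x) ^+ 2) /\
  \int[P]_x ((\sum_(i <- s) F i x) ^+ 2) <= (size s)%:R * c ^+ 2.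
Proof.
move=> us mF Fc orth.
have mS r : mfun (fun x => \sum_(i <- r) F i x) by exact: measurable_sum.
have bS r x : `|\sum_(i <- r) F i x| <= (size r)%:R * c.
  elim: r => [|i r IH]; first by rewrite big_nil normr0 mul0r.
  rewrite big_cons /= -natr1 mulrDl mul1r [leRHS]addrC; apply: le_trans (ler_normD _ _) _.
  exact: lerD.
have ib f g N M : mfun f -> mfun g -> (forall x, `|f x| <= N) -> (forall x, `|g x| <= M) ->
  intg (fun x => f x * g x).
  move=> mf mg fN gM; apply: (@integrable_bounded _ _ _ P _ (N * M)) => [|x].
    exact: measurable_funM.
  by rewrite normrM ler_pM.
have iS r : intg (fun x => (\sum_(i <- r) F i x) ^+ 2) by apply: ib;
  [exact: mS|exact: mS|exact: bS|exact: bS].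
split=> //.
elim: s us => [_|i s IH /andP[iNs us]].
  under eq_Rintegral do rewrite big_nil expr0n /=.
  by rewrite Rexpectation_cst mul0r.
have iFS : intg (fun x => F i x * \sum_(j <- s) F j x) by exact: ib.
have iF2 : intg (fun x => F i x ^+ 2) by exact: ib.
have cross : \int[P]_x (F i x * \sum_(j <- s) F j x) = 0.
  under eq_Rintegral do rewrite mulr_sumr.
  have [|_ ->] := @Rexpectation_sum _ _ _ P _ s (fun j x => F i x * F j x).
    by move=> j _; apply: ib.
  rewrite big_seq big1 // => j js; apply: orth; by apply: contraNneq iNs => ->.
rewrite (_ : \int[P]_x _ = \int[P]_x (F i x ^+ 2 + (2 * (F i x * \sum_(j <- s) F j x) +
  (\sum_(j <- s) F j x) ^+ 2))); last first.
  by apply: eq_Rintegral => x _; rewrite big_cons; ring.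
rewrite !RintegralD ?RintegralZl //; try exact: integrable_mulrl; last first.
  by apply: integrable_addR => //; exact: integrable_mulrl.
rewrite cross mulr0 add0r -natr1 mulrDl mul1r [leRHS]addrC lerD ?IH //.
apply: le_trans (_ : \int[P]_x c ^+ 2 <= _); last by rewrite Rexpectation_cst.
apply: le_Rintegral => //; first exact: finite_measure_integrable_cst.
by move=> x _; rewrite -real_normK ?num_real // lerXn2r ?nnegrE // (le_trans _ (Fc i x)).
Qed.
End Independence.

(** * Cells of the unit interval *)

Section UniformDiscretisation.
Context d (T : measurableType d) (R : realType) (P : probability T R).
Variable U : {RV P >-> R}.
Hypothesis hU : uniform_half U.

(** The index of the cell containing [x + 1/2] when the unit interval is
    cut into [h] equal parts. The clipping and the minimum matter only on a
    null event; thanks to them [cell_lt] and [cell_bounds] hold for every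
    [x]. *)
Definition cell (h : nat) (x : R) : nat :=
  minn (Num.truncn (h%:R * (clip 2^-1 x + 2^-1))) h.-1.

Let half_ge0 : 0 <= 2^-1 :> R. Proof. by rewrite invr_ge0. Qed.

Lemma clip_half_itv (x : R) : 0 <= clip 2^-1 x + 2^-1 <= 1.
Proof. by have := clip_bound x half_ge0; rewrite ler_norml => /andP[? ?]; apply/andP; split;
  lra. Qed.

Lemma cell_lt h x : (0 < h)%N -> (cell h x < h)%N.
Proof. by case: h => // h _; rewrite /cell /= ltnS geq_minr. Qed.

Lemma cell_ge h x a : (0 < h)%N -> (a < h)%N ->
  (a <= cell h x)%N = (a%:R / h%:R - 2^-1 <= clip 2^-1 x).
Proof.
move=> h0 ah; have hR : 0 < h%:R :> R by rewrite ltr0n.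
have /andP[c0 _] := clip_half_itv x.
rewrite /cell leq_min (_ : (a <= h.-1)%N) ?andbT; last by lia.
by rewrite truncn_ge_nat ?mulr_ge0 // lerBlDr ler_pdivrMr // mulrC.
Qed.

Lemma cell_bounds h x : (0 < h)%N ->
  (cell h x)%:R <= h%:R * (clip 2^-1 x + 2^-1) <= (cell h x)%:R + 1.
Proof.
move=> h0; have hR : 0 < h%:R :> R by rewrite ltr0n.
have /andP[c0 c1] := clip_half_itv x; rewrite /cell; set y := h%:R * _.
have y0 : 0 <= y by rewrite mulr_ge0.
have yh : y <= h%:R by rewrite ler_piMr.
have /andP[ty yt] := truncn_itv y0.
have [th|th] := leqP (Num.truncn y) h.-1; first by rewrite ty /= natr1 ltW.
have hy : h%:R <= y by apply: le_trans ty; rewrite ler_nat; lia.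
rewrite natr1 prednK // yh andbT; apply: le_trans hy; rewrite ler_nat; lia.
Qed.

Lemma prob_uniform_ge c : - 2^-1 <= c <= 2^-1 -> P (U @^-1` `[c, +oo[) = (2^-1 - c)%:E.
Proof.
move=> /andP[c0 c1]; rewrite -[LHS]/(distribution P U `[c, +oo[%classic) hU //.
rewrite /uniform_prob integral_uniform_pdf.
have -> : `[c, +oo[%classic `&` `[- 2^-1, 2^-1]%classic = `[c, 2^-1]%classic :> set R.
  apply/seteqP; split=> x /=; rewrite !in_itv /= ?andbT.
    by move=> [cx /andP[_ ->]]; rewrite cx.
  by move=> /andP[cx ->]; split=> //; rewrite (le_trans c0 cx).
rewrite (eq_integral (cst 1%:E)); last first.
  move=> x; rewrite inE /= in_itv /= => /andP[cx xh]; rewrite /uniform_pdf (le_trans c0 cx) xh /=.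
  by rewrite (_ : 2^-1 - - 2^-1 = 1) ?invr1 //; lra.
rewrite integral_cst //= mul1e lebesgue_measure_itv /= lte_fin.
case: ltP => [_|h]; first by rewrite -EFinB.
by congr _%:E; apply/eqP; rewrite eq_sym subr_eq0 eq_le h c1.
Qed.

Lemma clip_preimage_ge c : - 2^-1 < c <= 2^-1 ->
  [set x : R | c <= clip 2^-1 x] = `[c, +oo[%classic.
Proof.
move=> /andP[c0 c1]; apply/seteqP; split=> x /=;
  rewrite in_itv /= andbT /clip le_max le_min c1 andbT.
  by case/orP=> // h; move: (lt_le_trans c0 h); rewrite ltxx.
by move=> ->; rewrite orbT.
Qed.

Lemma cell_ge_preimage h a : (0 < h)%N -> (a <= h)%N ->
  measurable [set x : R | (a <= cell h x)%N] /\
  P (U @^-1` [set x : R | (a <= cell h x)%N]) = (1 - a%:R / h%:R)%:E.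
Proof.
move=> h0; have hR : 0 < h%:R :> R by rewrite ltr0n.
rewrite leq_eqVlt => /orP[/eqP ->|ah].
  rewrite (_ : [set x | _] = set0); last first.
    by apply/seteqP; split=> x //=; rewrite leqNgt cell_lt.
  by rewrite preimage_set0 measure0 divff ?gt_eqF // subrr.
have [->|a0] := posnP a.
  rewrite (_ : [set x | _] = setT); last by apply/seteqP; split.
  by rewrite preimage_setT probability_setT mul0r subr0.
rewrite (_ : [set x | _] = [set x : R | a%:R / h%:R - 2^-1 <= clip 2^-1 x]); last first.
  by apply/seteqP; split=> x /=; rewrite cell_ge.
have q0 : 0 < a%:R / h%:R :> R by rewrite divr_gt0 // ltr0n.
have q1 : a%:R / h%:R <= 1 :> R by rewrite ler_pdivrMr // mul1r ler_nat ltnW.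
have c0 : - 2^-1 < a%:R / h%:R - 2^-1 :> R by lra.
have c1 : a%:R / h%:R - 2^-1 <= 2^-1 :> R by lra.
rewrite clip_preimage_ge ?c0 //; split; first exact: measurable_itv.
by rewrite prob_uniform_ge ?(ltW c0) //; congr _%:E; lra.
Qed.

Lemma cell_preimage1 h a : (0 < h)%N ->
  measurable [set x : R | cell h x = a] /\
  P (U @^-1` [set x : R | cell h x = a]) = (if (a < h)%N then h%:R^-1 else 0)%:E.
Proof.
move=> h0; have hR : 0 < h%:R :> R by rewrite ltr0n.
case: ltnP => ah; last first.
  rewrite (_ : [set x | _] = set0) ?preimage_set0 ?measure0 //.
  by apply/seteqP; split=> x //= E; move: (cell_lt x h0); rewrite E ltnNge ah.
have [m1 p1] := cell_ge_preimage h0 (ltnW ah); have [m2 p2] := cell_ge_preimage h0 ah.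
rewrite (_ : [set x | _] = [set x : R | (a <= cell h x)%N] `\` [set x : R | (a < cell h x)%N]);
  last first.
  apply/seteqP; split=> x /=; first by move=> ->; rewrite leqnn ltnn.
  by move=> [h1 /negP]; rewrite -leqNgt => h2; apply/eqP; rewrite eqn_leq h1 h2.
split; first exact: measurableD.
have mU A : measurable A -> measurable (U @^-1` A) by move=> mA; exact: measurable_funPTI.
have -> : U @^-1` ([set x : R | (a <= cell h x)%N] `\` [set x : R | (a < cell h x)%N]) =
   (U @^-1` [set x : R | (a <= cell h x)%N]) `\` (U @^-1` [set x : R | (a < cell h x)%N]) by [].
rewrite measureD; [|exact: mU|exact: mU|by rewrite (le_lt_trans (probability_le1 _ _)) ?ltry
  //; exact: mU].
rewrite setIidr; last by move=> x /=; exact: ltnW.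
by rewrite [X in (X - _)%E]p1 [X in (_ - X)%E]p2 -EFinB; congr _%:E;
  rewrite -natr1 mulrDl mul1r; ring.
Qed.

Lemma measurable_cell h : (0 < h)%N -> measurable_fun [set: R] (fun x => (cell h x)%:R : R).
Proof.
move=> h0; rewrite (_ : (fun x => _) = fun x => \sum_(a < h) a%:R * \1_[set x : R | cell h x =
  a] x); last first.
  apply/funext=> x; rewrite (bigD1 (Ordinal (cell_lt x h0))) //= indicE mem_set // mulr1 big1
    ?addr0 // => a.
  by rewrite indicE; case: (boolP (_ \in _)); rewrite ?mulr0 // inE /= => Ea /eqP[]; apply: val_inj.
apply: measurable_sum => a; apply: measurable_funM => //.
by apply: measurable_indic; exact: (cell_preimage1 a h0).1.
Qed.

Lemma sum_natr_ord (h : nat) : \sum_(j < h) (j%:R : R) = h%:R * (h%:R - 1) / 2.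
Proof.
elim: h => [|h IH]; first by rewrite big_ord0 !mul0r.
by rewrite big_ord_recr /= IH -natr1; field.
Qed.

Lemma integrable_cell h : (0 < h)%N -> P.-integrable setT (EFin \o (fun x => (cell h (U x))%:R)).
Proof.
move=> h0; apply: (@integrable_bounded _ _ _ P _ h%:R) => [|x].
  exact: measurableT_comp (measurable_cell h0) (measurable_funP U).
by rewrite normr_nat ler_nat ltnW // cell_lt.
Qed.

Lemma Rexpectation_cell h : (0 < h)%N -> \int[P]_x ((cell h (U x))%:R : R) = (h%:R - 1) / 2.
Proof.
move=> h0; have hR : 0 < h%:R :> R by rewrite ltr0n.
pose Z x : 'I_h := Ordinal (cell_lt (U x) h0).
have ZE (a : 'I_h) : Z @^-1` [set a] = U @^-1` [set x | cell h x = a].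
  by apply/seteqP; split=> x /=; [move=> <- | move=> E; exact: val_inj].
have [|_] := @finite_Rexpectation _ _ _ P _ Z (fun a : 'I_h => a%:R).
  by move=> a; rewrite ZE; apply: measurable_funPTI => //; exact: (cell_preimage1 a h0).1.
rewrite /= => ->; rewrite (eq_bigr (fun a : 'I_h => a%:R * h%:R^-1)); last first.
  by move=> a _; rewrite ZE (cell_preimage1 a h0).2 ltn_ord.
by rewrite -mulr_suml sum_natr_ord; field; rewrite gt_eqF.
Qed.

Lemma measurable_clipU c : measurable_fun setT (fun x => clip c (U x)).
Proof. exact: measurableT_comp (measurable_clip c) (measurable_funP U). Qed.

Lemma integrable_clipU c : 0 <= c -> P.-integrable setT (EFin \o (fun x => clip c (U x))).
Proof.
move=> c0; apply: (@integrable_bounded _ _ _ P _ c); first exact: measurable_clipU.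
by move=> x; exact: clip_bound.
Qed.

(** The mean is that of the cells up to [O(1 / n)], which avoids
    integrating against the uniform density. *)
Lemma Rexpectation_clip_half : \int[P]_x clip 2^-1 (U x) = 0.
Proof.
have iU := integrable_clipU half_ge0.
have step n : `|\int[P]_x clip 2^-1 (U x)| <= 3 / 2 / n.+1%:R.
  have hR : 0 < n.+1%:R :> R by rewrite ltr0n.
  have iC := integrable_cell (ltn0Sn n).
  have i1 : P.-integrable setT (EFin \o (fun x => n.+1%:R * clip 2^-1 (U x) - (cell n.+1 (U
    x))%:R)).
    by apply: integrable_subR => //; exact: integrable_mulrl.
  have b x : n.+1%:R * clip 2^-1 (U x) - (cell n.+1 (U x))%:R <= 1 - n.+1%:R / 2.
    by have := cell_bounds (U x) (ltn0Sn n); rewrite mulrDr => /andP[_]; lra.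
  have b' x : - n.+1%:R / 2 <= n.+1%:R * clip 2^-1 (U x) - (cell n.+1 (U x))%:R.
    by have := cell_bounds (U x) (ltn0Sn n); rewrite mulrDr => /andP[+ _]; lra.
  have E : \int[P]_x (n.+1%:R * clip 2^-1 (U x) - (cell n.+1 (U x))%:R) =
      n.+1%:R * \int[P]_x clip 2^-1 (U x) - (n.+1%:R - 1) / 2.
    by rewrite RintegralB ?RintegralZl ?Rexpectation_cell //; exact: integrable_mulrl.
  have h1 : n.+1%:R * \int[P]_x clip 2^-1 (U x) - (n.+1%:R - 1) / 2 <= 1 - n.+1%:R / 2.
    rewrite -E -[leRHS](Rexpectation_cst P); apply: le_Rintegral => //.
    exact: finite_measure_integrable_cst.
  have h2 : - n.+1%:R / 2 <= n.+1%:R * \int[P]_x clip 2^-1 (U x) - (n.+1%:R - 1) / 2.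
    rewrite -E -[leLHS](Rexpectation_cst P); apply: le_Rintegral => //.
    exact: finite_measure_integrable_cst.
  rewrite ler_pdivlMr // -[X in _ * X](gtr0_norm hR) -normrM mulrC ler_norml.
  by apply/andP; split; lra.
apply/eqP; rewrite -normr_eq0 eq_le normr_ge0 andbT; apply/ler_addgt0Pl => e e0; rewrite addr0.
apply: le_trans (step (Num.truncn (3 / 2 / e))) _.
rewrite ler_pdivrMr ?ltr0n // [leRHS]mulrC -ler_pdivrMr //.
by apply: ltW; exact: truncnS_gt.
Qed.

Lemma uniform_half_clip_ae : {ae P, forall x, clip 2^-1 (U x) = U x}.
Proof.
have E : P (U @^-1` `[- 2^-1, 2^-1]) = 1%E.
  rewrite -[LHS]/(distribution P U `[- 2^-1, 2^-1]%classic) hU //.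
  exact: (integral_uniform_pdf1 (opp_half_lt_half R)).
exists (~` (U @^-1` `[- 2^-1, 2^-1])); split.
- by apply: measurableC; apply: measurable_funPTI.
- rewrite probability_setC; last by apply: measurable_funPTI.
  by rewrite E subee.
- move=> x /=; apply: contra_not; rewrite /= in_itv /= => h.
  by apply: clip_id; rewrite ler_norml.
Qed.
End UniformDiscretisation.

(** * Coupling the ranks with independent uniform variables *)

Section Coupling.
Context (R : realType) (b : nat) (hb : (1 < b)%N).
Context (dO : measure_display) (Omega : measurableType dO) (P : probability Omega R).
Variable U : nat -> nat -> {RV P >-> R}.
Hypothesis hU : forall i j, uniform_half (U i j).
Hypothesis hind : mutually_independent P (fun ij : nat * nat => (U ij.1 ij.2 : Omega -> R)).
Variable m : nat.

Local Notation V := (bary_node b m).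
Local Notation anc := (@bary_anc b m).
Local Notation hsize := (subtree_size anc).

(** The uniform variable that drives the rank of the node [u]. *)
Definition node_U (u : V) := U (tag u) (enum_rank (tagged u)).

Lemma cell_lt_card u x : (cell (hsize u) (node_U u x) < #|V|)%N.
Proof.
exact: leq_trans (cell_lt _ (ltn0Sn _)) (subtree_size_le (@bary_anc_irr b m) u).
Qed.

Definition cell_ranks (x : Omega) : {ffun V -> 'I_#|V|} :=
  [ffun u => Ordinal (cell_lt_card u x)].

(** The cells of independent uniform variables have the joint law of the
    ranks, by [sum_ranks]. *)
Lemma prob_cell_ranks (r : {ffun V -> 'I_#|V|}) :
  measurable (cell_ranks @^-1` [set r]) /\
  P (cell_ranks @^-1` [set r]) =
    (if r \in rank_box anc then (\prod_u (hsize u)%:R)^-1 else 0)%:E.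
Proof.
pose idx (u : V) : nat * nat := (tag u : nat, enum_rank (tagged u) : nat).
have idx_inj : injective idx := @bary_node_index_inj b m.
pose J := [seq idx u | u <- index_enum V].
pose C (u : V) := [set x : R | cell (hsize u) x = r u].
(* Independence is stated for families indexed by pairs of integers, so
   each event is attached to the pair that indexes its node and the
   remaining pairs get the sure event. *)
pose A (i : nat * nat) : set R := if [pick u | idx u == i] is Some u then C u else setT.
have Aidx u : A (idx u) = C u.
  by rewrite /A; case: pickP => [v /eqP/idx_inj -> //|/(_ u)]; rewrite eqxx.
have mC u : measurable (C u) by exact: (cell_preimage1 (hU 0 0) (r u) (ltn0Sn _)).1.
have mA i : measurable (A i) by rewrite /A; case: pickP.
have E : cell_ranks @^-1` [set r] = \bigcap_(i in [set` J]) (U i.1 i.2 @^-1` A i).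
  apply/seteqP; split=> [x /= xr i /= /mapP[u _ ->]|x H]; rewrite /=.
    by rewrite Aidx /C /= -[r u]/(fun_of_fin r u) -xr ffunE.
  apply/ffunP=> u; apply: val_inj; rewrite ffunE /=.
  have := H (idx u); rewrite /= Aidx; apply; apply: map_f; exact: mem_index_enum.
split.
  by rewrite E bigcap_seq; apply: bigsetI_measurable => // i _; exact: measurable_funPTI.
rewrite E (hind _ mA); last by rewrite map_inj_uniq // index_enum_uniq.
rewrite big_map.
rewrite (eq_bigr (fun u => (if (r u < hsize u)%N then (hsize u)%:R^-1 else 0)%:E)); last first.
  by move=> u _; rewrite Aidx -(cell_preimage1 (hU (idx u).1 (idx u).2) (r u) (ltn0Sn _)).2.
rewrite prodEFin; congr _%:E; case: ifPn => [/familyP rb|rNb].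
  rewrite -prodfV; apply: eq_bigr => u _.
  by have := rb u; rewrite unfold_in /= => ->.
have [u ru] : exists u, ~~ (r u < hsize u)%N.
  apply/existsP; rewrite -negb_forall; apply: contra rNb => /forallP H.
  by apply/familyP=> u; rewrite unfold_in /=; exact: H.
by rewrite (bigD1 u) //= ifN ?mul0r.
Qed.

Lemma Rexpectation_cell_ranks (G : {ffun V -> 'I_#|V|} -> R) :
  P.-integrable setT (EFin \o (fun x => G (cell_ranks x))) /\
  \int[P]_x G (cell_ranks x) =
    (\prod_u (hsize u)%:R)^-1 * \sum_(r in rank_box anc) G r.
Proof.
have [|si ->] := @finite_Rexpectation _ _ _ P _ cell_ranks G.
  by move=> r; exact: (prob_cell_ranks r).1.
split=> //; rewrite mulr_sumr [RHS]big_mkcond /=; apply: eq_bigr => r _.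
by rewrite (prob_cell_ranks r).2 /=; case: ifP; rewrite ?mulr0 // mulrC.
Qed.

Definition centred_sum (r : {ffun V -> 'I_#|V|}) : R :=
  \sum_u ((r u)%:R - ((hsize u)%:R - 1) / 2) / (bary_size b m)%:R.

Definition coupled_inversions (x : Omega) : R := centred_sum (cell_ranks x).

Section Labelling.
Context (d : measure_display) (T : measurableType d) (Q : probability T R).
Variable lam : T -> {ffun V -> 'I_#|V|}.
Hypothesis hlam : uniform_labelling Q lam.

(** Both sides average [G] over the box of admissible rank vectors. *)
Lemma Rexpectation_labelling_ranks (G : {ffun V -> 'I_#|V|} -> R) :
  Q.-integrable setT (EFin \o (fun w => G (ranks (@bary_anc_irr b m) (lam w)))) /\
  \int[Q]_w G (ranks (@bary_anc_irr b m) (lam w)) = \int[P]_x G (cell_ranks x).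
Proof.
have injP (f : {ffun V -> 'I_#|V|}) : reflect (bijective f) (injectiveb f).
  apply: (iffP (injectiveP f)) => [inj|[g fK _]]; last exact: can_inj fK.
  by apply: inj_card_bij => //; rewrite card_ord.
have [bij law] := hlam.
have fib f : measurable (lam @^-1` [set f]) /\
    fine (Q (lam @^-1` [set f])) = if injectiveb f then (#|V| `!)%:R^-1 else 0.
  case: ifPn => [/injP/law[mf ->] //|nf].
  rewrite (_ : lam @^-1` [set f] = set0) ?measure0 //.
  by apply/seteqP; split=> w //= E; move: nf; rewrite -E => /injP; apply; exact: bij.
have [|si ->] := @finite_Rexpectation _ _ _ Q _ lam (fun f => G (ranks (@bary_anc_irr b m) f)).
  by move=> f; exact: (fib f).1.
split=> //; rewrite (Rexpectation_cell_ranks G).2.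
rewrite -(sum_ranks (@bary_anc_irr b m) (@bary_anc_trans b m) (@bary_anc_forest b m)).
rewrite mulr_sumr [RHS]big_mkcond /=; apply: eq_bigr => f _.
by rewrite (fib f).2; case: ifP; rewrite ?mulr0 // mulrC.
Qed.

Lemma normalized_inversionsE w :
  normalized_inversions Q lam w = centred_sum (ranks (@bary_anc_irr b m) (lam w)).
Proof.
have E w' : (inversions anc (lam w'))%:R =
    \sum_u (ranks (@bary_anc_irr b m) (lam w') u)%:R :> R.
  rewrite inversions_sum_rank natr_sum; apply: eq_bigr => u _; by rewrite ffunE.
rewrite /normalized_inversions expectationE; last first.
  rewrite (_ : (fun w' => _) = fun w' => \sum_u (ranks (@bary_anc_irr b m) (lam w') u)%:R);
    last exact/funext.
  exact: (Rexpectation_labelling_ranks (fun r => \sum_u (r u)%:R)).1.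
rewrite /= E; under eq_Rintegral do rewrite E.
rewrite (Rexpectation_labelling_ranks (fun r => \sum_u (r u)%:R)).2.
have [|_ ->] := @Rexpectation_sum _ _ _ P _ (index_enum V) (fun u x => (cell_ranks x u)%:R : R).
  by move=> u _; exact: (Rexpectation_cell_ranks (fun r => (r u)%:R)).1.
rewrite -sumrB mulr_suml; apply: eq_bigr => u _; congr ((_ - _) / _).
under eq_Rintegral do rewrite ffunE /=.
exact: (Rexpectation_cell (hU _ _) (ltn0Sn _)).
Qed.
End Labelling.
End Coupling.

(** * Estimates for the coupling *)

Lemma sum_expn_le (b d : nat) : (1 < b)%N -> (\sum_(i < d) b ^ i <= b ^ d)%N.
Proof.
move=> b1; elim: d => [|d IH]; first by rewrite big_ord0.
rewrite big_ord_recr /= expnS; apply: leq_trans (leq_add IH (leqnn _)) _.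
by rewrite addnn -muln2 mulnC leq_mul2r b1 orbT.
Qed.

Lemma bary_size_split (b m d : nat) : (1 < b)%N -> (d <= m)%N ->
  bary_size b m = (\sum_(i < d) b ^ i + b ^ d * bary_size b (m - d))%N.
Proof.
move=> b1 dm; rewrite !bary_sizeE // -subSn //.
rewrite -!(big_mkord predT (fun i => b ^ i)%N) (@big_cat_nat _ _ _ d) //=; last by lia.
congr (_ + _)%N; rewrite -{1}[d]add0n big_addn big_distrr /=.
by apply: eq_bigr => i _; rewrite expnD mulnC.
Qed.

Lemma bary_size_ge (b m : nat) : (1 < b)%N -> (2 ^ m <= bary_size b m)%N.
Proof.
move=> b1; rewrite bary_sizeE // big_ord_recr /=; apply: leq_trans (leq_addl _ _).
by case: m => [|m]; rewrite ?expn0 ?leq_exp2r.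
Qed.

Section BaryRatio.
Variables (R : realFieldType) (b m : nat).
Hypothesis b1 : (1 < b)%N.

Lemma bary_size_gt0 : (0 < bary_size b m)%N.
Proof. by apply: leq_trans (bary_size_ge m b1); rewrite expn_gt0. Qed.

(** The [b ^ d] nodes of depth [d] root subtrees of equal size, and fewer
    than [b ^ d] nodes lie above them. *)
Lemma bary_ratio d : (d <= m)%N ->
  0 <= ((bary_size b m)%:R / b%:R ^+ d - (bary_size b (m - d))%:R : R) <= 1.
Proof.
move=> dm; have bd : 0 < b%:R ^+ d :> R by rewrite exprn_gt0 // ltr0n ltnW.
rewrite (bary_size_split b1 dm) natrD natrM natrX mulrDl mulrAC mulfV ?gt_eqF // mul1r addrK.
rewrite divr_ge0 ?ler0n ?(ltW bd) //= ler_pdivrMr // mul1r -natrX ler_nat.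
exact: sum_expn_le.
Qed.

Lemma sum_inv_pow_le : \sum_(d < m.+1) (b%:R ^+ d)^-1 <= 2 :> R.
Proof.
apply: le_trans (_ : \sum_(d < m.+1) (2^-1) ^+ d <= _).
  apply: ler_sum => d _; rewrite exprVn lef_pV2 ?posrE ?exprn_gt0 ?ltr0n //; last by lia.
  by rewrite lerXn2r ?nnegrE ?ler0n ?ler_nat.
have E : (1 - 2^-1) * \sum_(d < m.+1) (2^-1) ^+ d = 1 - 2^-1 ^+ m.+1 :> R.
  by rewrite -[1 - 2^-1]opprB mulNr -subrX1 opprB.
have p : 0 <= 2^-1 ^+ m.+1 :> R by rewrite exprn_ge0 // invr_ge0.
by move: E; move: (\sum_(d < _) _) => s E; lra.
Qed.

(** At depth [d] there are [b ^ d] ratios, each at most [1 / b ^ d], which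
    leaves the geometric series in [1 / b]. *)
Lemma sum_sqr_subtree_ratio :
  \sum_(u : bary_node b m) ((subtree_size (@bary_anc b m) u)%:R / (bary_size b m)%:R) ^+ 2 <= 2
    :> R.
Proof.
have n0 : 0 < (bary_size b m)%:R :> R by rewrite ltr0n bary_size_gt0.
have bp d : 0 < b%:R ^+ d :> R by rewrite exprn_gt0 // ltr0n ltnW.
apply: le_trans (_ : \sum_(u : bary_node b m) (b%:R ^+ tag u)^-1 ^+ 2 <= _).
  apply: ler_sum => u _; rewrite lerXn2r ?nnegrE ?invr_ge0 ?(ltW (bp _)) ?divr_ge0 ?ler0n //.
  rewrite bary_subtree_size // ler_pdivrMr // mulrC.
  by have /andP[] := bary_ratio (leq_ord (tag u)); rewrite subr_ge0.
rewrite (@sum_bary_nodes b m R (fun d _ => (b%:R ^+ d)^-1 ^+ 2)).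
apply: le_trans sum_inv_pow_le; rewrite le_eqVlt; apply/orP; left; apply/eqP; apply: eq_bigr => d _.
rewrite sumr_const_nat subn0 -[_ *+ _]mulr_natl natrX expr2 mulrA mulfV ?mul1r // gt_eqF //.
Qed.
End BaryRatio.

Section ExpBound.
Variable R : realType.

(** For [x > 1] the last term alone dominates, as [x <= 2 * x ^ 2]. For
    [x <= 1] it suffices that
    [e ^ x <= (1 - x / 2) ^ -2 <= 1 + x + 2 * x ^ 2]. *)
Lemma expR_le_sqr (x : R) : expR x <= x + expR (2 * x ^+ 2).
Proof.
have e2 := expR_ge1Dx (2 * x ^+ 2).
have [x1|x1] := lerP x 1; last first.
  apply: le_trans (_ : expR (2 * x ^+ 2) <= _); last by rewrite lerDr; lra.
  by rewrite ler_expR; nra.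
apply: le_trans (_ : 1 + x + 2 * x ^+ 2 <= _); last by lra.
have e0 := expR_gt0 (- (x / 2)).
have h : expR x * expR (- (x / 2)) ^+ 2 = 1.
  by rewrite expr2 -!expRD (_ : x + _ = 0) ?expR0 //; field.
have e1 : 1 - x / 2 <= expR (- (x / 2)) by apply: expR_ge1Dx.
have p : 0 < 1 - x / 2 by lra.
have q : (1 - x / 2) ^+ 2 <= expR (- (x / 2)) ^+ 2 by rewrite lerXn2r // ?nnegrE ltW.
rewrite -(ler_pM2r (exprn_gt0 2 e0)) h.
apply: le_trans (_ : 1 <= (1 + x + 2 * x ^+ 2) * (1 - x / 2) ^+ 2) _.
  rewrite (_ : _ * _ = 1 + x ^+ 2 * ((1 - x) * (5 - 2 * x) / 4)); last by field.
  by rewrite lerDl mulr_ge0 ?sqr_ge0 // divr_ge0 // mulr_ge0; lra.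
by rewrite ler_wpM2l //; nra.
Qed.

(** The linear term of [expR_le_sqr] averages to zero. *)
Lemma mean_exp_centred_le (h : nat) (s : R) : (0 < h)%N ->
  h%:R^-1 * \sum_(j < h) expR (s * (j%:R - (h%:R - 1) / 2)) <= expR (2 * (s * h%:R) ^+ 2).
Proof.
move=> h0; have hR : 0 < h%:R :> R by rewrite ltr0n.
rewrite mulrC ler_pdivrMr //.
apply: le_trans (_ : \sum_(j < h) (s * (j%:R - (h%:R - 1) / 2) + expR (2 * (s * h%:R) ^+ 2)) <= _).
  apply: ler_sum => j _; apply: le_trans (expR_le_sqr _) _; rewrite lerD2l ler_expR.
  rewrite ler_wpM2l // !exprMn ler_wpM2l ?sqr_ge0 //.
  have : (j%:R <= h%:R :> R) by rewrite ler_nat ltnW.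
  have : (0 <= j%:R :> R) by [].
  have : (1 <= h%:R :> R) by rewrite ler1n.
  move: (h%:R : R) (j%:R : R) => y z y1 z0 zy.
  rewrite -subr_ge0 subr_sqr mulr_ge0 //; lra.
have S : \sum_(j < h) (j%:R - (h%:R - 1) / 2) = 0 :> R.
  rewrite sumrB sum_natr_ord sumr_const card_ord -[((h%:R - 1) / 2) *+ h]mulr_natl.
  by rewrite mulrA subrr.
by rewrite big_split /= -mulr_sumr S mulr0 add0r sumr_const card_ord [leRHS]mulr_natr.
Qed.
End ExpBound.

(** * Almost sure convergence of the coupled variables *)

Section CoupledConvergence.
Context (R : realType) (b : nat) (hb : (1 < b)%N).
Context (dO : measure_display) (Omega : measurableType dO) (P : probability Omega R).
Variable U : nat -> nat -> {RV P >-> R}.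
Hypothesis hU : forall i j, uniform_half (U i j).
Hypothesis hind : mutually_independent P (fun ij : nat * nat => (U ij.1 ij.2 : Omega -> R)).

Local Notation mfun f := (measurable_fun [set: Omega] (f : Omega -> R)).
Local Notation intg f := (P.-integrable [set: Omega] (EFin \o (f : Omega -> R))).

Lemma Rexpectation_mul_centred (k l : nat * nat) (f g : R -> R) (M : R) : k != l ->
  measurable_fun setT f -> measurable_fun setT g ->
  (forall y, `|f y| <= M) -> (forall y, `|g y| <= M) ->
  \int[P]_x f (U k.1 k.2 x) = 0 ->
  \int[P]_x (f (U k.1 k.2 x) * g (U l.1 l.2 x)) = 0.
Proof.
move=> kl mf mg fM gM f0.
rewrite (@indep_Rexpectation_mul _ _ _ P (fun x => f (U k.1 k.2 x)) (fun x => g (U l.1 l.2 x))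
  M) //.
- by rewrite f0 mul0r.
- exact: measurableT_comp mf (measurable_funP _).
- exact: measurableT_comp mg (measurable_funP _).
move=> A B mA mB.
have mfA : measurable (f @^-1` A) by rewrite -[X in measurable X]setTI; exact: mf.
have mgB : measurable (g @^-1` B) by rewrite -[X in measurable X]setTI; exact: mg.
pose C (i : nat * nat) := if i == k then f @^-1` A else g @^-1` B.
have := hind (J := [:: k; l]) (A := C); rewrite /= inE kl /= => /(_ isT).
rewrite !big_cons big_nil mule1 /C eqxx eq_sym (negbTE kl) => <-.
  congr (P _); apply/seteqP; split=> x /=.
    move=> [xA xB] i /=; rewrite !inE => /orP[] /eqP -> /=; rewrite ?eqxx //.
    by rewrite eq_sym (negbTE kl).
  move=> H; split; first by have := H k; rewrite /= mem_head eqxx; exact.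
  by have := H l; rewrite /= !inE eqxx orbT eq_sym (negbTE kl); exact.
by move=> i; case: ifP.
Qed.

(** The [i]-th level of the limit series, with the uniform variables
    clipped so that bounds hold everywhere; almost surely this changes
    nothing, by [levels_clip_ae]. *)
Definition clipped_level (i : nat) (x : Omega) : R :=
  \sum_(0 <= j < b ^ i) clip 2^-1 (U i j x) / b%:R ^+ i.

Let bpos i : 0 < b%:R ^+ i :> R. Proof. by rewrite exprn_gt0 // ltr0n ltnW. Qed.

Let pow_inv_le (n k : nat) (c : R) : (2 ^ k <= n)%N -> 0 <= c -> c <= n%:R^-1 ->
  n%:R * c ^+ 2 <= 2^-1 ^+ k.
Proof.
move=> kn c0 cn; have n0 : 0 < n%:R :> R by rewrite ltr0n (leq_trans _ kn) // expn_gt0.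
apply: le_trans (_ : n%:R * n%:R^-1 ^+ 2 <= _).
  by rewrite ler_wpM2l ?(ltW n0) // lerXn2r ?nnegrE ?invr_ge0 ?(ltW n0).
rewrite expr2 mulrA divff ?gt_eqF // mul1r exprVn lef_pV2 ?posrE ?exprn_gt0 //.
by rewrite -natrX ler_nat.
Qed.

Lemma measurable_clipped_level i : mfun (clipped_level i).
Proof.
apply: measurable_sum => j; apply: measurable_funM => //.
exact: measurableT_comp (measurable_clip _) (measurable_funP _).
Qed.

(** The level consists of [b ^ i] orthogonal terms of size at most
    [b ^ (- i)]. *)
Lemma clipped_level_sqr i :
  intg (fun x => clipped_level i x ^+ 2) /\
  \int[P]_x (clipped_level i x ^+ 2) <= 2^-1 ^+ i.
Proof.
pose f (y : R) := clip 2^-1 y / b%:R ^+ i.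
have mf : measurable_fun setT f by apply: measurable_funM => //; exact: measurable_clip.
have fM y : `|f y| <= (b%:R ^+ i)^-1.
  rewrite normrM normfV (gtr0_norm (bpos i)) ler_piMl ?invr_ge0 ?(ltW (bpos i)) //.
  by apply: le_trans (clip_bound _ _) _; lra.
have f0 j : \int[P]_x f (U i j x) = 0.
  rewrite RintegralZr // ?Rexpectation_clip_half ?mul0r //.
  by apply: integrable_clipU; lra.
have [] := @sum_sqr_Rexpectation_le _ _ _ P _ (index_iota 0 (b ^ i)) (fun j x => f (U i j x))
  (b%:R ^+ i)^-1.
- exact: iota_uniq.
- by move=> j; exact: measurableT_comp mf (measurable_funP _).
- by move=> j x; exact: fM.
- move=> j j' jj'; apply: (@Rexpectation_mul_centred (i, j) (i, j') f f (b%:R ^+ i)^-1) => //.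
  by rewrite xpair_eqE eqxx.
move=> si le; split=> //; apply: le_trans le _; rewrite size_iota subn0.
apply: pow_inv_le; rewrite ?invr_ge0 ?(ltW (bpos i)) ?natrX //.
by case: i {f mf fM f0 si} => [|i]; rewrite ?expn0 ?leq_exp2r.
Qed.

Lemma clipped_series_cvg_ae : {ae P, forall x, cvgn (series (clipped_level ^~ x))}.
Proof.
apply: series_cvg_ae => [i|i|i]; first exact: measurable_clipped_level.
  exact: (clipped_level_sqr i).1.
exact: (clipped_level_sqr i).2.
Qed.

Lemma levels_clip_ae : {ae P, forall x, forall i j, clip 2^-1 (U i j x) = U i j x}.
Proof.
by apply: ae_foralln => i; apply: ae_foralln => j; exact: uniform_half_clip_ae.
Qed.

Lemma measurable_coupled m : mfun (coupled_inversions b U m).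
Proof.
have /measurable_int : intg (coupled_inversions b U m).
  exact: (Rexpectation_cell_ranks hU hind (@centred_sum R b m)).1.
by move/measurable_EFinP.
Qed.

(** The gap is a sum over the [n] nodes of orthogonal terms of size at most
    [1 / n]. *)
Lemma coupling_gap_sqr m :
  let D x := coupled_inversions b U m x - series (clipped_level ^~ x) m.+1 in
  intg (fun x => D x ^+ 2) /\ \int[P]_x (D x ^+ 2) <= 2^-1 ^+ m.
Proof.
move=> D; set n := bary_size b m.
have n0 : 0 < n%:R :> R by rewrite ltr0n bary_size_gt0.
pose h (u : bary_node b m) := subtree_size (@bary_anc b m) u.
pose f (u : bary_node b m) (y : R) :=
  ((cell (h u) y)%:R - ((h u)%:R - 1) / 2) / n%:R - clip 2^-1 y / b%:R ^+ tag u.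
have DE : D = fun x => \sum_(u : bary_node b m) f u (node_U U u x).
  apply/funext=> x; rewrite sumrB /D; congr (_ - _).
    by apply: eq_bigr => u _; rewrite ffunE.
  rewrite /series /= big_mkord; rewrite -(@sum_bary_nodes b m R (fun i j => clip 2^-1 (U i j x)
    / b%:R ^+ i)).
  by [].
have mf u : measurable_fun setT (f u).
  apply: measurable_funB; apply: measurable_funM => //; last exact: measurable_clip.
  by apply: measurable_funB => //; exact: measurable_cell (hU 0 0) _ (ltn0Sn _).
(* The cell index [J] is within 1/2 of [H * (c + 1/2) - 1/2], and replacing
   [H] by [n / B], which differs from it by at most 1, costs at most
   another 1/2 because [|c| <= 1/2]. *)
have fM u y : `|f u y| <= n%:R^-1.
  have := cell_bounds y (ltn0Sn _ : (0 < h u)%N); have := clip_half_itv y.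
  have := @bary_ratio R b m hb (tag u) (leq_ord _).
  rewrite -[bary_size b (m - tag u)](bary_subtree_size hb u) -/(h u) -/n.
  rewrite /f; set B := b%:R ^+ tag u; have B0 : 0 < B by exact: bpos.
  move: (clip _ _) ((cell _ _)%:R : R) ((h u)%:R : R) => c J H /andP[r0 r1] /andP[c0 c1]
    /andP[j0 j1].
  rewrite (_ : _ - _ = (J - (H - 1) / 2 - c * (n%:R / B)) / n%:R); last by field; rewrite !gt_eqF.
  rewrite normrM normfV (gtr0_norm n0) ler_piMl ?invr_ge0 ?(ltW n0) //.
  have q : `|c * (n%:R / B - H)| <= 2^-1.
    by rewrite normrM -[leRHS]mulr1 ler_pM // ler_norml; apply/andP; split; lra.
  rewrite (_ : J - _ - _ = J - (H - 1) / 2 - H * c - c * (n%:R / B - H)); last by ring.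
  move: q; move: (c * (_ - H)) => z; rewrite !ler_norml => /andP[? ?]; apply/andP; split; nra.
have f0 u : \int[P]_x f u (node_U U u x) = 0.
  have iC := integrable_cell (hU (tag u) (enum_rank (tagged u))) (ltn0Sn _ : (0 < h u)%N).
  have iK : intg (fun=> ((h u)%:R - 1) / 2) by exact: finite_measure_integrable_cst.
  have iX : intg (fun x => clip 2^-1 (node_U U u x)) by apply: integrable_clipU; lra.
  have i1 : intg (fun x => (cell (h u) (node_U U u x))%:R - ((h u)%:R - 1) / 2) by exact:
    integrable_subR.
  rewrite RintegralB //; [|exact: integrable_mulrr|exact: integrable_mulrr].
  rewrite !RintegralZr // RintegralB // Rexpectation_cst Rexpectation_clip_half; last exact: hU.
  by rewrite Rexpectation_cell ?subrr ?mul0r ?subr0 //; exact: hU.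
have [] := @sum_sqr_Rexpectation_le _ _ _ P _ (enum (bary_node b m)) (fun u x => f u (node_U U
  u x)) n%:R^-1.
- exact: enum_uniq.
- by move=> u; exact: measurableT_comp (mf u) (measurable_funP _).
- by move=> u x; exact: fM.
- move=> u v uv; apply: (@Rexpectation_mul_centred (tag u : nat, enum_rank (tagged u) : nat)
    (tag v : nat, enum_rank (tagged v) : nat) (f u) (f v) n%:R^-1).
  + by apply: contra_neq uv; exact: (@bary_node_index_inj b m).
  + exact: mf.
  + exact: mf.
  + exact: fM.
  + exact: fM.
  + exact: f0.
rewrite -cardE card_bary_node // DE => si le.
have E : (fun x => (\sum_u f u (node_U U u x)) ^+ 2) =
  (fun x => (\sum_(u <- enum (bary_node b m)) f u (node_U U u x)) ^+ 2).
  by apply/funext=> x; rewrite big_enum.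
rewrite E; split=> //; apply: le_trans le _; apply: pow_inv_le; rewrite ?invr_ge0 ?(ltW n0) //.
exact: bary_size_ge.
Qed.

(** The gaps to the partial sums of the level series are almost surely
    summable, hence tend to 0. *)
Lemma coupled_cvg_ae (X : Omega -> R) : is_level_series b P U X ->
  {ae P, forall x, (fun m => coupled_inversions b U m x) @ \oo --> X x}.
Proof.
move=> hX.
have gap0 : {ae P, forall x, cvgn (series (fun m => coupled_inversions b U m x - series
  (clipped_level ^~ x) m.+1))}.
  apply: (@series_cvg_ae _ _ _ P (fun m x => coupled_inversions b U m x - series (clipped_level
    ^~ x) m.+1)) => m.
  - apply: measurable_funB; first exact: measurable_coupled.
    by apply: measurable_sum => i; exact: measurable_clipped_level.
  - exact: (coupling_gap_sqr m).1.
  - exact: (coupling_gap_sqr m).2.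
apply: filterS3 hX gap0 levels_clip_ae => x Xx gx cx.
have {}gx := cvg_series_cvg_0 gx.
have {}Xx : series (clipped_level ^~ x) @ \oo --> X x.
  rewrite (_ : series _ = series (fun i => \sum_(0 <= j < b ^ i) U i j x / b%:R ^+ i)) //.
  congr series; apply/funext => i; apply: eq_bigr => j _; by rewrite cx.
rewrite -[X x]add0r.
rewrite (_ : (fun m => _) = fun m => (coupled_inversions b U m x - series (clipped_level ^~ x)
  m.+1) + series (clipped_level ^~ x) m.+1); last first.
  by apply/funext => m; rewrite subrK.
by apply: cvgD; [exact: gx | rewrite (cvg_shiftS (series (clipped_level ^~ x)))].
Qed.

(** The bound is uniform in [m]: each node contributes
    [e ^ (2 (t h u / n) ^ 2)], and the squares of the ratios [h u / n] sum
    to at most 2. *)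
Lemma coupled_exp_moment m (t : R) :
  intg (fun x => expR (t * coupled_inversions b U m x)) /\
  \int[P]_x expR (t * coupled_inversions b U m x) <= expR (4 * t ^+ 2).
Proof.
have [si E] := Rexpectation_cell_ranks hU hind (fun r => expR (t * @centred_sum R b m r)).
split=> //; rewrite E.
pose h (u : bary_node b m) := subtree_size (@bary_anc b m) u.
set n := (bary_size b m)%:R : R.
pose g (u : bary_node b m) (j : nat) := expR (t / n * (j%:R - ((h u)%:R - 1) / 2)).
rewrite (eq_bigr (fun r : {ffun bary_node b m -> 'I_#|bary_node b m|} => \prod_u g u (r u)));
  last first.
  move=> r _; rewrite /centred_sum mulr_sumr expR_sum; apply: eq_bigr => u _.
  by congr expR; rewrite mulrA mulrAC.
rewrite sum_rank_box_prod; last exact: bary_anc_irr.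
rewrite -prodfV -big_split /=.
apply: le_trans (_ : \prod_u expR (2 * (t / n * (h u)%:R) ^+ 2) <= _).
  apply: ler_prod => u _; rewrite mean_exp_centred_le // andbT mulr_ge0 ?invr_ge0 ?ler0n //.
  by apply: sumr_ge0 => j _; exact: expR_ge0.
rewrite -expR_sum ler_expR.
rewrite (eq_bigr (fun u => 2 * t ^+ 2 * ((h u)%:R / n) ^+ 2)); last by move=> u _;
  rewrite !exprMn; ring.
rewrite -mulr_sumr; have := @sum_sqr_subtree_ratio R b m hb; rewrite -/n -/h.
have := sqr_ge0 t; move: (\sum_u _) => S t2 S2; nra.
Qed.

(** The upper limit of the partial sums is measurable everywhere and is
    their limit almost surely. *)
Lemma level_series_exists : exists X : {RV P >-> R}, is_level_series b P U X.
Proof.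
pose S n x := series (clipped_level ^~ x) n.
have mS n : mfun (S n) by apply: measurable_sum => i; exact: measurable_clipped_level.
pose X x := fine (limn_esup (fun n => (S n x)%:E)).
have mX : mfun X.
  apply: measurableT_comp; first exact: (fine_measurable measurableT).
  by apply: measurable_fun_limn_esup => n; exact/measurable_EFinP.
pose X' : {RV P >-> R} := HB.pack X (isMeasurableFun.Build _ _ _ _ _ mX).
exists X'.
apply: filterS2 clipped_series_cvg_ae levels_clip_ae => x cv cx /=.
have -> : X x = limn (S ^~ x).
  have cl : (fun n => (S n x)%:E) @ \oo --> (limn (S ^~ x))%:E.
    by apply/cvg_EFin => //; near=> n.
  by rewrite /X (cvg_limn_einf_sup cl).2.
rewrite (_ : series _ = S ^~ x) //.
rewrite /S; congr series; apply/funext => i; apply: eq_bigr => j _; by rewrite cx.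
Unshelve. all: by end_near. Qed.

End CoupledConvergence.

(** * Transfer of limits to functions of exponential growth *)

Section ExpDominated.
Variable R : realType.

Definition exp_dominated (F : R -> R) :=
  exists C t, forall x, `|F x| <= C * (expR (t * x) + expR (- t * x)).

Lemma exp_dominated_bounded (F : R -> R) M : (forall x, `|F x| <= M) -> exp_dominated F.
Proof.
by move=> FM; exists M, 0 => x; rewrite oppr0 !mul0r expR0; have := FM x;
  have := normr_ge0 (F x); lra.
Qed.

Lemma exp_dominated_exp t : exp_dominated (fun x => expR (t * x)).
Proof.
exists 1, t => x; rewrite mul1r ger0_norm ?expR_ge0 //.
by rewrite lerDl expR_ge0.
Qed.

Lemma expR_abs_le (x : R) : expR `|x| <= expR x + expR (- x).
Proof.
have := expR_ge0 x; have := expR_ge0 (- x).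
by case: (ger0P x) => _; lra.
Qed.

Lemma exprn_le_expR (x : R) k : 0 <= x -> x ^+ k <= k`!%:R * expR x.
Proof.
move=> x0; case: k => [|k].
  by rewrite expr0 mul1r; apply: le_trans (expR_ge1Dx x); rewrite lerDl.
rewrite mulrC -ler_pdivrMr ?ltr0n ?fact_gt0 //.
by apply: le_trans (expR_ge1Dxn k x0); rewrite lerDr.
Qed.

Lemma exp_dominated_pow k : exp_dominated (fun x => x ^+ k).
Proof.
exists k`!%:R, 1 => x; rewrite normrX mul1r mulN1r.
apply: le_trans (exprn_le_expR _ (normr_ge0 x)) _.
by rewrite ler_wpM2l // expR_abs_le.
Qed.

End ExpDominated.

Section Transfer.
Context (R : realType) (b : nat) (hb : (1 < b)%N).
Context (dO : measure_display) (Omega : measurableType dO) (P : probability Omega R).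
Variable U : nat -> nat -> {RV P >-> R}.
Hypothesis hU : forall i j, uniform_half (U i j).
Hypothesis hind : mutually_independent P (fun ij : nat * nat => (U ij.1 ij.2 : Omega -> R)).
Variable X : {RV P >-> R}.
Hypothesis hX : is_level_series b P U X.

Local Notation intg f := (P.-integrable [set: Omega] (EFin \o (f : Omega -> R))).

(** The square of an exponentially dominated [F] is itself exponentially
    dominated, so [coupled_exp_moment] bounds [F] of the coupled variables
    in mean square. *)
Lemma coupled_Rexpectation_cvg (F : R -> R) : continuous F -> exp_dominated F ->
  intg (fun x => F (X x)) /\
  \int[P]_x F (coupled_inversions b U m x) @[m --> \oo] --> \int[P]_x F (X x).
Proof.
move=> cF [C [t FC]].
have mF : measurable_fun setT F := continuous_measurable_fun cF.
have mc m := measurable_coupled b hU hind m.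
pose G m x := 2 * C ^+ 2 * (expR (2 * t * coupled_inversions b U m x) +
  expR (- (2 * t) * coupled_inversions b U m x)).
have FG m x : F (coupled_inversions b U m x) ^+ 2 <= G m x.
  rewrite -real_normK ?num_real // /G; set y := coupled_inversions _ _ _ _.
  have -> : 2 * t * y = t * y + t * y by ring.
  have -> : - (2 * t) * y = - t * y + - t * y by ring.
  rewrite !expRD; have := FC y; have := expR_ge0 (t * y); have := expR_ge0 (- t * y).
  move: (expR (t * y)) (expR (- t * y)) => u v v0 u0 Fuv.
  apply: le_trans (_ : (C * (u + v)) ^+ 2 <= _).
    by rewrite lerXn2r ?nnegrE //; apply: le_trans Fuv.
  by have := sqr_ge0 (C * (u - v)); nra.
have [i1 i2] : (forall m, intg (fun x => expR (2 * t * coupled_inversions b U m x))) /\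
    (forall m, intg (fun x => expR (- (2 * t) * coupled_inversions b U m x))).
  by split=> m; exact: (coupled_exp_moment hb hU hind m _).1.
have iG m : intg (G m) by apply: integrable_mulrl; exact: integrable_addR.
have iF2 m : intg (fun x => F (coupled_inversions b U m x) ^+ 2).
  apply: (@le_integrable_norm _ _ _ P _ (G m)) => //.
    by apply: measurable_funX; exact: measurableT_comp mF (mc m).
  by move=> x; rewrite ger0_norm ?sqr_ge0.
apply: (@L2_bounded_cvg_Rintegral _ _ _ P (fun m x => F (coupled_inversions b U m x)) _
  (2 * C ^+ 2 * (expR (4 * (2 * t) ^+ 2) + expR (4 * (- (2 * t)) ^+ 2)))) => //.
- by move=> m; exact: measurableT_comp mF (mc m).
- exact: measurableT_comp mF (measurable_funP X).
- apply: filterS (coupled_cvg_ae hb hU hind hX) => x Xx.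
  exact: (cvg_comp (fun m => coupled_inversions b U m x) F Xx (cF _)).
- move=> m; apply: le_trans (_ : \int[P]_x G m x <= _); first exact: le_Rintegral.
  rewrite /G RintegralZl //; last exact: integrable_addR.
  rewrite RintegralD //; apply: ler_wpM2l; first by rewrite mulr_ge0 ?sqr_ge0.
  by apply: lerD; exact: (coupled_exp_moment hb hU hind m _).2.
Qed.

Lemma expectation_cvg (dT : nat -> measure_display) (T : forall m, measurableType (dT m))
  (Q : forall m, probability (T m) R)
  (lam : forall m, T m -> {ffun bary_node b m -> 'I_#|bary_node b m|})
  (hlam : forall m, uniform_labelling (Q m) (@lam m)) (F : R -> R) :
  continuous F -> exp_dominated F ->
  ('E_(Q m)[F \o normalized_inversions (Q m) (@lam m)] @[m --> \oo] --> 'E_P[F \o X])%E.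
Proof.
move=> cF dF; have [iFX cv] := coupled_Rexpectation_cvg cF dF.
rewrite expectationE //.
rewrite (_ : (fun m => _) = fun m => (\int[P]_x F (coupled_inversions b U m x))%:E).
  by apply/cvg_EFin => //; near=> n.
apply/funext => m.
have [iQ E] := Rexpectation_labelling_ranks hU hind (hlam m) (fun r => F (@centred_sum R b m r)).
have NE : F \o normalized_inversions (Q m) (@lam m) =
    (fun w => F (@centred_sum R b m (ranks (@bary_anc_irr b m) (lam m w)))).
  by apply/funext => w /=; rewrite (normalized_inversionsE hU hind (hlam m)).
by rewrite NE expectationE // E.
Unshelve. all: by end_near. Qed.

End Transfer.

(** * Auxiliary estimates on exponential, cosine and powers *)

Section ElementaryAnalysis.
Variable R : realType.

Lemma sum_exp_coeff_le (x : R) n : \sum_(0 <= j < n) `|x| ^+ j / j`!%:R <= expR x + expR (- x).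
Proof.
apply: le_trans (expR_abs_le x).
have x0 := normr_ge0 x.
apply: (@nondecreasing_cvgn_le _ (series (exp_coeff `|x|))); last exact: is_cvg_series_exp_coeff.
by apply/nondecreasing_seqP => k; rewrite /series /= big_nat_recr //= lerDl exp_coeff_ge0.
Qed.

Lemma cvg_cos_series (z : R) :
  series (fun j => ((~~ odd j)%:R * (-1) ^+ j./2 * j`!%:R^-1) * z ^+ j) @ \oo --> cos z.
Proof.
rewrite -(congr1 series (cos_coeffE z)) unlock.
exact: is_cvg_series_cos_coeff.
Qed.

Lemma cvg_sin_series (z : R) :
  series (fun j => ((odd j)%:R * (-1) ^+ j.-1./2 * j`!%:R^-1) * z ^+ j) @ \oo --> sin z.
Proof.
rewrite -(congr1 series (sin_coeffE z)) unlock.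
exact: is_cvg_series_sin_coeff.
Qed.

Lemma cos_expansion : exists C : R, 0 <= C /\
  forall w, `|w| <= 1 -> `|1 - cos w - w ^+ 2 / 2| <= C * w ^+ 4.
Proof.
pose c j : R := (~~ odd j)%:R * (-1) ^+ j./2 * j`!%:R^-1.
have cv : cvgn (series (fun j => c j * 2 ^+ j)).
  by apply/cvg_ex; exists (cos 2); exact: cvg_cos_series.
have [C HC] := power_series_remainder (ltr0n R 2 : 0 < 2) cv 4.
have pos w : 0 < w <= 1 -> `|1 - cos w - w ^+ 2 / 2| <= `|C| * w ^+ 4.
  move=> w01; have := HC w (cos w); rewrite divff // => /(_ w01 (@cvg_cos_series w)).
  rewrite !big_ord_recr big_ord0 /= /c /= => h.
  rewrite -normrN; apply: le_trans (_ : C * w ^+ 4 <= _); last first.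
    by rewrite ler_wpM2r ?ler_norm // exprn_ge0 // ltW; case/andP: w01.
  apply: le_trans h; rewrite le_eqVlt; apply/orP; left; apply/eqP; congr `|_|.
  by rewrite !mul0r !addr0 !add0r expr0 expr1 fact0 (_ : 2`! = 2)%N //; field.
exists `|C|; split=> // w w1; have [w0|w0|->] := ltgtP w 0.
- have := pos (- w); rewrite cosN sqrrN (_ : (- w) ^+ 4 = w ^+ 4) ?oppr_gt0 ?w0 /=; last by ring.
  apply.
  by apply: le_trans w1; rewrite ler0_norm // ltW.
- by apply: pos; rewrite w0 /=; apply: le_trans w1; exact: ler_norm.
- by rewrite cos0 subrr sub0r expr0n /= mul0r oppr0 normr0 mulr_ge0.
Qed.

(** With [r] between [sqrt q] and 1, the sequence [k * r ^ k] is bounded,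
    and [k * q ^ k <= (k * r ^ k) * r ^ k]. *)
Lemma cvg_natr_mul_expr (q : R) : 0 <= q < 1 -> k%:R * q ^+ k @[k --> \oo] --> (0 : R).
Proof.
move=> /andP[q0 q1]; pose r := (1 + q) / 2.
have r0 : 0 < r by rewrite /r; lra.
have r1 : r < 1 by rewrite /r; lra.
have qr : q <= r * r by rewrite /r; have := sqr_ge0 (1 - q); nra.
clearbody r.
have kr k : k%:R * r ^+ k <= (1 - r)^-1.
  rewrite -[leRHS]mul1r ler_pdivlMr ?subr_gt0 //.
  elim: k => [|k IH]; first by rewrite !mul0r.
  have rk : r ^+ k <= 1 by rewrite exprn_ile1 // ltW.
  have rk0 : 0 <= r ^+ k by rewrite exprn_ge0 // ltW.
  have h1 : r * (k%:R * r ^+ k * (1 - r)) <= r * 1 by rewrite ler_wpM2l // ltW.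
  have h2 : r * r ^+ k * (1 - r) <= 1 * (1 - r).
    apply: ler_wpM2r; first by rewrite subr_ge0 ltW.
    by rewrite -exprS exprn_ile1 // ltW.
  by rewrite -natr1 exprS; lra.
apply: (@squeeze_cvgr _ _ _ _ (fun=> 0) (fun k => (1 - r)^-1 * r ^+ k)).
- apply: nearW => k; rewrite mulr_ge0 ?exprn_ge0 //=.
  apply: le_trans (_ : k%:R * (r * r) ^+ k <= _).
    by apply: ler_wpM2l => //; apply: lerXn2r; rewrite ?nnegrE ?mulr_ge0 // ltW.
  by rewrite exprMn mulrA ler_wpM2r // exprn_ge0 // ltW.
- exact: cvg_cst.
- rewrite -[X in _ --> X](mulr0 (1 - r)^-1); apply: cvgMr.
  by apply: cvg_expr; rewrite ger0_norm // ltW.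
Qed.

Lemma bernoulli_ineq (x : R) n : 0 <= x <= 1 -> 1 - n%:R * x <= (1 - x) ^+ n.
Proof.
move=> /andP[x0 x1]; elim: n => [|n IH]; first by rewrite mul0r subr0.
rewrite exprS -natr1; have : 0 <= (1 - x) ^+ n by rewrite exprn_ge0 // subr_ge0.
have : 0 <= n%:R * x ^+ 2 by rewrite mulr_ge0 ?sqr_ge0.
by move: IH; move: (n%:R : R) ((1 - x) ^+ n) => N p; nra.
Qed.

Lemma expr_le_inv (x : R) n : 0 <= x <= 1 -> (1 - x) ^+ n * (1 + n%:R * x) <= 1.
Proof.
move=> /andP[x0 x1]; elim: n => [|n IH]; first by rewrite mul0r addr0 mulr1.
rewrite exprSr -natr1 -mulrA; apply: le_trans IH; rewrite ler_wpM2l ?exprn_ge0 ?subr_ge0 //.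
by have := ler0n R n; move: (n%:R : R) => N; nra.
Qed.

(** An exponent [N] with [N * u ^ k] tending to 0 for [0 <= u < c <= 1] and
    to infinity for [u >= c > 0]. *)
Definition step_exponent (c : R) (k : nat) : nat := (Num.truncn (k%:R * c^-1 ^+ k)).+1.

(** For fixed [k] these are polynomials in [u] with values in the unit
    interval. [bernoulli_ineq] shows that they tend to 1 for [u < c], and
    [expr_le_inv] that they tend to 0 for [u >= c]. *)
Lemma step_approx (c u : R) : 0 < c <= 1 -> 0 <= u <= 1 ->
  (1 - u ^+ k) ^+ step_exponent c k @[k --> \oo] --> ((u < c)%R%:R : R).
Proof.
move=> /andP[c0 c1] /andP[u0 u1].
have uk k : 0 <= u ^+ k <= 1 by rewrite exprn_ge0 //= exprn_ile1.
have ck k : 0 <= k%:R * c^-1 ^+ k by rewrite mulr_ge0 // exprn_ge0 // invr_ge0 ltW.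
have Nge k : k%:R * c^-1 ^+ k <= (step_exponent c k)%:R by rewrite ltW // truncnS_gt.
have Nle k : (step_exponent c k)%:R <= k%:R * c^-1 ^+ k + 1.
  by rewrite /step_exponent -natr1 lerD2r truncn_le.
case: (ltP u c) => uc.
  have q1 : 0 <= u / c < 1 by rewrite divr_ge0 ?(ltW c0) //= ltr_pdivrMr // mul1r.
  apply: (@squeeze_cvgr _ _ _ _ (fun k => 1 - (k%:R * (u / c) ^+ k + u ^+ k)) (fun=> 1)).
  - apply: nearW => k; apply/andP; split; last first.
      by have /andP[? ?] := uk k; rewrite exprn_ile1 ?subr_ge0 // gerBl.
    apply: le_trans (bernoulli_ineq (step_exponent c k) (uk k)); rewrite lerD2l lerN2.
    have /andP[p0 _] := uk k; apply: le_trans (ler_wpM2r p0 (Nle k)) _.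
    by rewrite mulrDl mul1r expr_div_n exprVn -!mulrA [c ^- k * _]mulrC.
  - rewrite -[X in _ --> X]subr0 -[X in _ --> _ - X](addr0 0); apply: cvgB; first exact: cvg_cst.
    apply: cvgD; first exact: cvg_natr_mul_expr.
    by apply: cvg_expr; rewrite ger0_norm // (lt_le_trans uc).
  - exact: cvg_cst.
apply: (@squeeze_cvgr _ _ _ _ (fun=> 0) (fun k => k.+1%:R^-1)).
- apply: nearW => k; have /andP[p0 p1] := uk k.
  rewrite exprn_ge0 ?subr_ge0 //= -[leRHS]mul1r ler_pdivlMr ?ltr0n //.
  apply: le_trans (expr_le_inv (step_exponent c k) (uk k));
    rewrite ler_wpM2l ?exprn_ge0 ?subr_ge0 //.
  rewrite -natr1 addrC lerD2l; apply: le_trans (ler_wpM2r p0 (Nge k)).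
  rewrite -mulrA -[leLHS]mulr1 ler_wpM2l // -exprMn mulrC exprn_ege1 //.
  by rewrite ler_pdivlMr // mul1r.
- exact: cvg_cst.
- exact: cvg_harmonic.
Qed.

Lemma natSinv_small (e : R) : 0 < e -> \forall k \near \oo, k.+1%:R^-1 < e.
Proof. by move=> e0; exact: (near_infty_natSinv_lt (PosNum e0)). Qed.
End ElementaryAnalysis.

(** * Moments determine the law *)

Section MomentDeterminacy.
Context (R : realType).
Context d (T : measurableType d) (P : probability T R) (X : T -> R).
Context d' (T' : measurableType d') (P' : probability T' R) (Y : T' -> R).
Hypotheses (mX : measurable_fun setT X) (mY : measurable_fun setT Y).
Hypothesis iX : forall k, P.-integrable setT (EFin \o (fun x => X x ^+ k)).
Hypothesis iY : forall k, P'.-integrable setT (EFin \o (fun y => Y y ^+ k)).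
Hypothesis XY : forall k, \int[P]_x (X x ^+ k) = \int[P']_y (Y y ^+ k).
Hypothesis eX : forall t, P.-integrable setT (EFin \o (fun x => expR (t * X x))).

Definition agree (f : R -> R) := \int[P]_x f (X x) = \int[P']_y f (Y y).

Lemma agree_polynomial (c : nat -> R) (t : R) n :
  let f (x : R) := \sum_(0 <= j < n) c j * (t * x) ^+ j in
  [/\ P.-integrable setT (EFin \o (fun x => f (X x))),
      P'.-integrable setT (EFin \o (fun y => f (Y y))) & agree f].
Proof.
move=> f; have fE x : f x = \sum_(0 <= j < n) (c j * t ^+ j) * x ^+ j.
  by apply: eq_bigr => j _; rewrite exprMn mulrA.
have [|sX eqX] := @Rexpectation_sum _ _ _ P _ (index_iota 0 n) (fun j x => (c j * t ^+ j) * X x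
  ^+ j).
  by move=> j _; exact: integrable_mulrl.
have [|sY eqY] := @Rexpectation_sum _ _ _ P' _ (index_iota 0 n) (fun j y => (c j * t ^+ j) * Y
  y ^+ j).
  by move=> j _; exact: integrable_mulrl.
have EX : (fun x => f (X x)) = (fun x => \sum_(0 <= j < n) (c j * t ^+ j) * X x ^+ j) by
  apply/funext=> x; rewrite fE.
have EY : (fun x => f (Y x)) = (fun x => \sum_(0 <= j < n) (c j * t ^+ j) * Y x ^+ j) by
  apply/funext=> x; rewrite fE.
split; rewrite /agree ?EX ?EY // eqX eqY; apply: eq_bigr => j _.
by rewrite !RintegralZl // XY.
Qed.

(** The even Taylor sums of [e ^ (t y) + e ^ (- t y)] are nonnegative, and
    their expectations are combinations of moments, hence at most the
    expectation of the full sum under [X]. *)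
Lemma exp_integrable_of_moments t : P'.-integrable setT (EFin \o (fun y => expR (t * Y y) +
  expR (- (t * Y y)))).
Proof.
pose c j : R := (1 + (-1) ^+ j) / j`!%:R.
have c0 j : 0 <= c j.
  rewrite divr_ge0 // -signr_odd; case: (odd j); rewrite ?expr1 ?expr0; lra.
pose F n (x : R) := \sum_(0 <= j < n) c j * (t * x) ^+ j.
have term0 j (z : R) : 0 <= c j * z ^+ j.
  rewrite /c -signr_odd; case: (boolP (odd j)) => oj; first by rewrite expr1 subrr !mul0r.
  by rewrite mulr_ge0 ?divr_ge0 // ?exprn_even_ge0 //; rewrite expr0; lra.
have FE n x : F n x = series (exp_coeff (t * x)) n + series (exp_coeff (- (t * x))) n.
  rewrite /F /series /= -big_split /=; apply: eq_bigr => j _.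
  by rewrite /exp_coeff /c /= [(- (t * x)) ^+ j]exprNn; ring.
have Fcv x : F ^~ x @ \oo --> expR (t * x) + expR (- (t * x)).
  rewrite (_ : F ^~ x = fun n => series (exp_coeff (t * x)) n + series (exp_coeff (- (t * x))) n).
    by apply: cvgD; exact: is_cvg_series_exp_coeff.
  by apply/funext => n.
have Fnd x : nondecreasing_seq (F ^~ x).
  by apply/nondecreasing_seqP => k; rewrite /F big_nat_recr //= lerDl.
have Fle n x : F n x <= expR (t * x) + expR (- (t * x)).
  rewrite -(cvg_lim (@Rhausdorff R) (Fcv x)); apply: nondecreasing_cvgn_le => //.
  by apply/cvg_ex; eexists; exact: Fcv.
have iE : P.-integrable setT (EFin \o (fun x => expR (t * X x) + expR (- (t * X x)))).
  by apply: integrable_addR => //; under eq_fun do rewrite -mulNr.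
have mE : measurable_fun setT (fun x : R => expR (t * x) + expR (- (t * x))).
  apply: measurable_funD; apply: measurableT_comp; rewrite ?measurable_expR //.
  by apply: measurableT_comp => //; exact: mulrl_measurable.
apply: (proj1 (@fatou_Rintegral _ _ _ P' (fun n y => F n (Y y)) _
  (\int[P]_x (expR (t * X x) + expR (- (t * X x)))) _ _ _ _ _ _ _)).
- move=> n; have [_ + _] := agree_polynomial c t n.
  by move/measurable_int/measurable_EFinP.
- exact: measurableT_comp mE mY.
- by apply: aeW => y; exact: Fcv.
- by move=> n y; apply: sumr_ge0 => j _; exact: term0.
- by move=> y; rewrite addr_ge0 ?expR_ge0.
- by move=> n; have [] := agree_polynomial c t n.
- move=> n; have [i1 _ <-] := agree_polynomial c t n.
  by apply: le_Rintegral => // x _; exact: Fle.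
Qed.

(** The Taylor polynomials of [f] are dominated by
    [e ^ (t y) + e ^ (- t y)], which is integrable on both sides. *)
Lemma agree_entire (c : nat -> R) (f : R -> R) t :
  (forall j, `|c j| <= j`!%:R^-1) -> continuous f ->
  (forall z, series (fun j => c j * z ^+ j) @ \oo --> f z) ->
  agree (fun x => f (t * x)).
Proof.
move=> cj cf sf.
pose F n (x : R) := \sum_(0 <= j < n) c j * (t * x) ^+ j.
have FM n x : `|F n x| <= expR (t * x) + expR (- (t * x)).
  apply: le_trans (ler_norm_sum _ _ _) _; apply: le_trans (sum_exp_coeff_le (t * x) n).
  by apply: ler_sum => j _; rewrite normrM normrX mulrC ler_wpM2l // exprn_ge0.
have mf : measurable_fun setT (fun x => f (t * x)).
  by apply: measurableT_comp; [exact: continuous_measurable_fun | exact: mulrl_measurable].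
have iE : P.-integrable setT (EFin \o (fun x => expR (t * X x) + expR (- (t * X x)))).
  by apply: integrable_addR => //; under eq_fun do rewrite -mulNr.
have cX : \int[P]_x F n (X x) @[n --> \oo] --> \int[P]_x f (t * X x).
  apply: (proj2 (@dominated_Rintegral _ _ _ P (fun n x => F n (X x)) _ _ _ _ _ iE _)).
  - by move=> n; have [+ _ _] := agree_polynomial c t n; move/measurable_int/measurable_EFinP.
  - exact: measurableT_comp mf mX.
  - by apply: aeW => x; exact: sf.
  - by move=> n x; exact: FM.
have cY : \int[P']_y F n (Y y) @[n --> \oo] --> \int[P']_y f (t * Y y).
  apply: (proj2 (@dominated_Rintegral _ _ _ P' (fun n y => F n (Y y)) _ _ _ _ _
    (exp_integrable_of_moments t) _)).
  - by move=> n; have [_ + _] := agree_polynomial c t n; move/measurable_int/measurable_EFinP.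
  - exact: measurableT_comp mf mY.
  - by apply: aeW => x; exact: sf.
  - by move=> n x; exact: FM.
rewrite (_ : (fun n => _) = (fun n => \int[P']_y F n (Y y))) in cX.
  exact: cvg_unique cX cY.
by apply/funext => n; have [] := agree_polynomial c t n.
Qed.

Let bounded_integrable (g : R -> R) M : measurable_fun setT g -> (forall x, `|g x| <= M) ->
  P.-integrable setT (EFin \o (fun x => g (X x))) /\ P'.-integrable setT (EFin \o (fun y => g
    (Y y))).
Proof.
move=> mg gM; split.
  by apply: (@integrable_bounded _ _ _ P _ M) => //; exact: measurableT_comp mg mX.
by apply: (@integrable_bounded _ _ _ P' _ M) => //; exact: measurableT_comp mg mY.
Qed.

Lemma agree_lin (g h : R -> R) (M : R) (u v : R) : measurable_fun setT g -> measurable_fun setT h ->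
  (forall x, `|g x| <= M) -> (forall x, `|h x| <= M) ->
  agree g -> agree h -> agree (fun x => u * g x + v * h x).
Proof.
move=> mg mh gM hM ag ah; have [i1 i2] := bounded_integrable mg gM;
  have [j1 j2] := bounded_integrable mh hM.
by rewrite /agree !RintegralD ?RintegralZl ?ag ?ah //; exact: integrable_mulrl.
Qed.

Let mcos (s q : R) : measurable_fun setT (fun x : R => cos (s * x + q)).
Proof.
apply: measurableT_comp; first exact: (continuous_measurable_fun (@continuous_cos R)).
by apply: measurable_funD => //; exact: mulrl_measurable.
Qed.

Let cos_le1 (z : R) : `|cos z| <= 1.
Proof. by rewrite ler_norml cos_geN1 cos_le1. Qed.

Let sin_le1 (z : R) : `|sin z| <= 1.
Proof. by rewrite ler_norml sin_geN1 sin_le1. Qed.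

Lemma agree_cos (s q : R) : agree (fun x => cos (s * x + q)).
Proof.
have ac : agree (fun x => cos (s * x)).
  apply: (@agree_entire _ cos s _ _ (@cvg_cos_series R)); last exact: continuous_cos.
  move=> j; rewrite !normrM normrX normrN1 expr1n mulr1 normr_nat ger0_norm ?invr_ge0 //.
  by rewrite ler_piMl ?invr_ge0 //; case: odd.
have as_ : agree (fun x => sin (s * x)).
  apply: (@agree_entire _ sin s _ _ (@cvg_sin_series R)); last exact: continuous_sin.
  move=> j; rewrite !normrM normrX normrN1 expr1n mulr1 normr_nat ger0_norm ?invr_ge0 //.
  by rewrite ler_piMl ?invr_ge0 //; case: odd.
rewrite (_ : (fun x => _) = fun x => cos q * cos (s * x) + (- sin q) * sin (s * x)); last first.
  by apply/funext => x; rewrite cosD; ring.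
apply: (@agree_lin (fun x => cos (s * x)) (fun x => sin (s * x)) 1).
- by have := mcos s 0; under eq_fun do rewrite addr0.
- apply: measurableT_comp; first exact: (continuous_measurable_fun (@continuous_sin R)).
  exact: mulrl_measurable.
- by move=> x; exact: cos_le1.
- by move=> x; exact: sin_le1.
- exact: ac.
- exact: as_.
Qed.

(** Products of cosines are linear combinations of cosines; a further
    cosine factor makes the induction on [k] go through. *)
Lemma agree_cos_pow (s q : R) k (t p : R) : agree (fun x => cos (s * x + q) ^+ k * cos (t * x + p)).
Proof.
elim: k t p => [|k IH] t p.
  by under eq_fun do rewrite expr0 mul1r; exact: agree_cos.
rewrite (_ : (fun x => _) = fun x => 2^-1 * (cos (s * x + q) ^+ k * cos ((s + t) * x + (q + p))) +
   2^-1 * (cos (s * x + q) ^+ k * cos ((s - t) * x + (q - p)))); last first.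
  apply/funext => x; have -> : (s + t) * x + (q + p) = (s * x + q) + (t * x + p) by ring.
  have -> : (s - t) * x + (q - p) = (s * x + q) - (t * x + p) by ring.
  by move: (s * x + q) (t * x + p) => A B; rewrite cosD cosB exprS; field.
have bd (t' p' : R) x : `|cos (s * x + q) ^+ k * cos (t' * x + p')| <= 1.
  by rewrite normrM -[leRHS]mulr1 ler_pM // normrX exprn_ile1.
by apply: (@agree_lin _ _ 1) => //; apply: measurable_funM => //; exact: measurable_funX.
Qed.

Lemma agree_poly_cos (s q : R) (p : {poly R}) : agree (fun x => p.[cos (s * x + q)]).
Proof.
have ak k : agree (fun x => cos (s * x + q) ^+ k).
  by have := agree_cos_pow s q k 0 0; rewrite /agree;
    under eq_Rintegral do rewrite mul0r addr0 cos0 mulr1;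
      under [in RHS]eq_Rintegral do rewrite mul0r addr0 cos0 mulr1.
have int k : P.-integrable setT (EFin \o (fun x => cos (s * X x + q) ^+ k)) /\
    P'.-integrable setT (EFin \o (fun y => cos (s * Y y + q) ^+ k)).
  apply: (@bounded_integrable (fun x => cos (s * x + q) ^+ k) 1); first exact: measurable_funX.
  by move=> x; rewrite normrX exprn_ile1.
rewrite /agree; under eq_Rintegral do rewrite horner_coef.
under [in RHS]eq_Rintegral do rewrite horner_coef.
have [|_ ->] := @Rexpectation_sum _ _ _ P _ (index_enum 'I_(size p)) (fun j x => p`_j * cos (s
  * X x + q) ^+ j).
  by move=> j _; apply: integrable_mulrl; exact: (int _).1.
have [|_ ->] := @Rexpectation_sum _ _ _ P' _ (index_enum 'I_(size p)) (fun j y => p`_j * cos (s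
  * Y y + q) ^+ j).
  by move=> j _; apply: integrable_mulrl; exact: (int _).2.
apply: eq_bigr => j _; rewrite RintegralZl //; last exact: (int _).1.
rewrite RintegralZl //; last exact: (int _).2.
by congr (_ * _); exact: ak.
Qed.

Lemma agree_limit (g : nat -> R -> R) (f : R -> R) (M : R) :
  (forall k, measurable_fun setT (g k)) -> measurable_fun setT f ->
  (forall k x, `|g k x| <= M) -> (forall x, g ^~ x @ \oo --> f x) ->
  (forall k, agree (g k)) -> agree f.
Proof.
move=> mg mf gM gf ag.
have cX : \int[P]_x g n (X x) @[n --> \oo] --> \int[P]_x f (X x).
  apply: (@bounded_cvg_Rintegral _ _ _ P (fun n x => g n (X x)) _ M) => [n||| n x].
  - exact: measurableT_comp (mg n) mX.
  - exact: measurableT_comp mf mX.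
  - by apply: aeW => x; exact: gf.
  - exact: gM.
have cY : \int[P']_y g n (Y y) @[n --> \oo] --> \int[P']_y f (Y y).
  apply: (@bounded_cvg_Rintegral _ _ _ P' (fun n x => g n (Y x)) _ M) => [n||| n x].
  - exact: measurableT_comp (mg n) mY.
  - exact: measurableT_comp mf mY.
  - by apply: aeW => x; exact: gf.
  - exact: gM.
rewrite (_ : (fun n => _) = (fun n => \int[P']_y g n (Y y))) in cX.
  exact: cvg_unique cX cY.
by apply/funext => n; exact: ag.
Qed.

(** This indicator is the bounded limit of polynomials in the cosine, by
    [step_approx]. *)
Lemma agree_cos_lt (s q c : R) : 0 < c <= 1 ->
  agree (fun x => ((1 - cos (s * x + q)) / 2 < c)%R%:R).
Proof.
move=> c01.
have mu : measurable_fun setT (fun x : R => (1 - cos (s * x + q)) / 2).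
  by apply: measurable_funM => //; apply: measurable_funB.
have u01 x : 0 <= (1 - cos (s * x + q)) / 2 <= 1.
  by have := cos_le1 (s * x + q); rewrite ler_norml => /andP[? ?]; apply/andP; split; lra.
pose p k : {poly R} := (1 - ((2^-1)%:P * (1 - 'X)) ^+ k) ^+ step_exponent c k.
have pE k x : (p k).[cos (s * x + q)] = (1 - ((1 - cos (s * x + q)) / 2) ^+ k) ^+ step_exponent c k.
  by rewrite /p !hornerE [2^-1 * _]mulrC.
apply: (@agree_limit (fun k x => (p k).[cos (s * x + q)]) _ 1).
- move=> k; under eq_fun do rewrite pE.
  by apply: measurable_funX; apply: measurable_funB => //; exact: measurable_funX.
- rewrite (_ : (fun x => _) = \1_[set x | (1 - cos (s * x + q)) / 2 < c]).
    apply: measurable_indic; rewrite -[X in measurable X]setTI.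
    by apply: (measurable_fun_ltr mu (measurable_cst c)).
  by apply/funext => x; rewrite indicE; congr (nat_of_bool _)%:R; apply/idP/idP; rewrite inE.
- move=> k x; rewrite pE; have /andP[u0 u1] := u01 x.
  have v0 : 0 <= ((1 - cos (s * x + q)) / 2) ^+ k by rewrite exprn_ge0.
  have v1 : ((1 - cos (s * x + q)) / 2) ^+ k <= 1 by rewrite exprn_ile1.
  by rewrite ger0_norm ?exprn_ge0 ?subr_ge0 // exprn_ile1 ?subr_ge0 // gerBl.
- by move=> x; under eq_fun do rewrite pE; exact: step_approx.
- by move=> k; exact: agree_poly_cos.
Qed.

(** For small frequencies [(1 - cos (2 * e * (x - a))) / 2] is
    [e ^ 2 * (x - a) ^ 2] up to [O(e ^ 4)], so comparing it with a
    threshold near [e ^ 2 * r ^ 2] decides whether [|x - a| <= r]. *)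
Lemma agree_abs_le (a r : R) : 0 < r -> agree (fun x => (`|x - a| <= r)%R%:R).
Proof.
move=> r0; have [C [C0 HC]] := cos_expansion R.
pose s k : R := k.+1%:R^-1.
have s0 k : 0 < s k by rewrite invr_gt0 ltr0n.
(* The summand [s k] adds [s k ^ 3] to the threshold, which outweighs the
   error [O(s k ^ 4)] and puts the points at distance exactly [r] inside;
   the minimum keeps the threshold in the range of [agree_cos_lt]. *)
pose c k : R := Num.min 1 (s k ^+ 2 * (r ^+ 2 + s k)).
have c01 k : 0 < c k <= 1.
  by rewrite /c lt_min ltr01 ge_min lexx /= andbT mulr_gt0 ?exprn_gt0 // addr_gt0 // exprn_gt0.
have mind (f g : R -> R) : measurable_fun setT f -> measurable_fun setT g ->
    measurable_fun setT (fun x => ((f x < g x)%R%:R : R)).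
  move=> mf mg; rewrite (_ : (fun x => _) = \1_[set x | f x < g x]).
    by apply: measurable_indic; rewrite -[X in measurable X]setTI; exact: measurable_fun_ltr.
  by apply/funext => x; rewrite indicE; congr (nat_of_bool _)%:R; apply/idP/idP; rewrite inE.
apply: (@agree_limit (fun k x => ((1 - cos (2 * s k * x + - (2 * s k * a))) / 2 < c k)%R%:R) _ 1).
- move=> k; apply: mind => //.
  by apply: measurable_funM => //; apply: measurable_funB.
- rewrite (_ : (fun x => _) = fun x => 1 - (r < `|x - a|)%R%:R).
    apply: measurable_funB => //; apply: mind => //.
    by apply: measurableT_comp => //; exact: measurable_funB.
  by apply/funext => x; case: leP; rewrite ?subr0 ?subrr.
- by move=> k x; rewrite normr_nat lern1 leq_b1.
- move=> x; apply: cvg_near_cst; pose z := x - a.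
  pose K := 8 * C * z ^+ 4.
  have z4 : 0 <= z ^+ 4 by rewrite exprn_even_ge0.
  have K0 : 0 <= K by apply: mulr_ge0 => //; exact: mulr_ge0.
  have d0 : 0 < (if r < `|x - a| then (z ^+ 2 - r ^+ 2) / 2 else 1).
    case: ifPn => // rz; rewrite divr_gt0 // subr_gt0 -[z ^+ 2]real_normK ?num_real //.
    by rewrite ltrXn2r // ?nnegrE ?normr_ge0 // ltW.
  near=> k; rewrite /=.
  have s1 : s k < (2 * `|z| + 1)^-1.
    by near: k; apply: natSinv_small; rewrite invr_gt0 ltr_wpDl // mulr_ge0.
  have s2 : s k < (r ^+ 2 + 1)^-1.
    by near: k; apply: natSinv_small; rewrite invr_gt0 ltr_wpDl // sqr_ge0.
  have s3 : s k < (K + 1)^-1 by near: k; apply: natSinv_small; rewrite invr_gt0 ltr_wpDl.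
  have s4 : s k < (if r < `|x - a| then (z ^+ 2 - r ^+ 2) / 2 else 1).
    by near: k; exact: natSinv_small.
  have sle1 : s k <= 1 by rewrite invf_le1 ?ltr0n // ler1n.
  have sk := s0 k; rewrite /c; move: (s k) sk sle1 s1 s2 s3 s4 => e e0 e1 s1 s2 s3 s4.
  have w1 : `|2 * e * z| <= 1.
    rewrite normrM gtr0_norm ?mulr_gt0 //.
    move: s1; rewrite -[X in _ < X]mul1r ltr_pdivlMr ?ltr_wpDl ?mulr_ge0 //.
    by have := normr_ge0 z; nra.
  have r2 := sqr_ge0 r.
  have c1 : e ^+ 2 * (r ^+ 2 + e) <= 1.
    move: s2; rewrite -[X in _ < X]mul1r ltr_pdivlMr ?ltr_wpDl // => s2.
    apply: le_trans (_ : e * (r ^+ 2 + 1) <= 1); last exact: ltW.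
    by rewrite expr2 ler_pM ?mulr_ge0 ?addr_ge0 ?(ltW e0) ?lerD2l // ler_piMr // ltW.
  rewrite min_r //.
  have -> : 2 * e * x + - (2 * e * a) = 2 * e * z by rewrite /z; ring.
  have := HC _ w1; set u := (1 - cos _) / 2.
  have -> : 1 - cos (2 * e * z) - (2 * e * z) ^+ 2 / 2 =
    2 * (u - e ^+ 2 * z ^+ 2) by rewrite /u; field.
  have -> : C * (2 * e * z) ^+ 4 = 2 * (e ^+ 4 * K) by rewrite /K; ring.
  rewrite normrM [`|2|]ger0_norm // ler_pM2l // => hu.
  have {hu} : `|u - e ^+ 2 * z ^+ 2| < e ^+ 3.
    apply: le_lt_trans hu _; rewrite exprSr -[ltRHS]mulr1 -mulrA ltr_pM2l ?exprn_gt0 //.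
    by move: s3; rewrite -[X in _ < X]mul1r ltr_pdivlMr ?ltr_wpDl //; nra.
  rewrite ltr_norml => /andP[u1 u2].
  have e2 : 0 < e ^+ 2 by rewrite exprn_gt0.
  have z2 : z ^+ 2 = `|x - a| ^+ 2 by rewrite real_normK ?num_real.
  have E3 : e ^+ 3 = e ^+ 2 * e by rewrite exprSr.
  case: (leP `|x - a| r) s4 => [zr _|rz s4].
    have : z ^+ 2 <= r ^+ 2 by rewrite z2 lerXn2r // nnegrE ?normr_ge0 // ltW.
    rewrite -(ler_pM2l e2) => h.
    by rewrite (_ : (u < _) = true) //; rewrite mulrDr; lra.
  rewrite (_ : (u < _) = false) //; apply/negbTE; rewrite -leNgt mulrDr.
  have : e ^+ 2 * (2 * e) <= e ^+ 2 * (z ^+ 2 - r ^+ 2) by rewrite ler_pM2l //; lra.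
  by rewrite mulrBr; lra.
- by move=> k; exact: agree_cos_lt.
Unshelve. all: by end_near. Qed.

(** The half-line is the increasing union of the intervals of centre
    [c - k] and radius [k]. *)
Lemma agree_le (c : R) : agree (fun x => (x <= c)%R%:R).
Proof.
have mle (q : R) : measurable_fun setT (fun x : R => ((x <= q)%R%:R : R)).
  rewrite (_ : (fun x => _) = \1_(`]-oo, q]%classic)); first exact: measurable_indic.
  by apply/funext => x; rewrite indicE; congr (nat_of_bool _)%:R; apply/idP/idP;
    rewrite inE /= in_itv.
apply: (@agree_limit (fun k x => (`|x - (c - k.+1%:R)| <= k.+1%:R)%R%:R) _ 1).
- move=> k; apply: (measurableT_comp (mle _)); apply: measurableT_comp => //;
  exact: measurable_funB.
- exact: mle.
- by move=> k x; rewrite normr_nat lern1 leq_b1.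
- move=> x; apply: cvg_near_cst; near=> k; congr (nat_of_bool _)%:R.
  have kx : `|x - c| <= k.+1%:R.
    by apply: (@le_trans _ _ k%:R); [near: k; exact: nbhs_infty_ger | rewrite ler_nat].
  have k0 : 0 < k.+1%:R :> R by rewrite ltr0n.
  apply/idP/idP; rewrite ler_norml; first by case/andP=> _; lra.
  by move: kx; rewrite ler_norml => /andP[? ?] ?; apply/andP; split; lra.
- by move=> k; apply: agree_abs_le; rewrite ltr0n.
Unshelve. all: by end_near. Qed.

End MomentDeterminacy.

Lemma same_distribution_of_moments (R : realType)
    d (T : measurableType d) (P : probability T R) (X : {RV P >-> R})
    d' (T' : measurableType d') (P' : probability T' R) (Y : {RV P' >-> R}) :
  has_moments P X -> has_moments P' Y -> (forall k, moment P X k = moment P' Y k) ->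
  (forall t, P.-integrable setT (EFin \o (fun x => expR (t * X x)))) ->
  same_distribution Y X.
Proof.
move=> iX iY XY eX.
have XY' k : \int[P]_x (X x ^+ k) = \int[P']_y (Y y ^+ k).
  by have := XY k; rewrite /moment !expectationE //; [exact: iY | exact: iX].
have cdfE (c : R) : distribution P X `]-oo, c]%classic = distribution P' Y `]-oo, c]%classic.
  have H e (S : measurableType e) (Q : probability S R) (Z : {RV Q >-> R}) :
      distribution Q Z `]-oo, c]%classic = (\int[Q]_x (Z x <= c)%R%:R)%:E.
    rewrite (_ : (fun x => _) = \1_(Z @^-1` `]-oo, c]%classic)); last first.
      by apply/funext => x; rewrite indicE; congr (nat_of_bool _)%:R; apply/idP/idP;
        rewrite inE /= in_itv.
    have mZ : measurable (Z @^-1` `]-oo, c]%classic) by exact: measurable_funPTI.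
    rewrite /Rintegral integral_indic // setIT fineK //.
    by rewrite fin_num_measure.
  by rewrite !H (agree_le (measurable_funP X) (measurable_funP Y) iX iY XY' eX).
have ocE (a e : R) : distribution P' Y `]a, e]%classic = distribution P X `]a, e]%classic.
  have [ae|ea] := leP a e; last by rewrite set_itv_ge ?measure0 // bnd_simp -leNgt ltW.
  have -> : `]a, e]%classic = `]-oo, e]%classic `\` `]-oo, a]%classic.
    by rewrite -[RHS]setCK setCD setCitvl setUC -[LHS]setCK setCitv.
  rewrite !measureD ?setIidr //; try exact: subset_itvl.
  - by rewrite [X in (X - _)%E](esym (cdfE e)) [X in (_ - X)%E](esym (cdfE a)).
  - by rewrite -ge0_fin_numE // fin_num_measure.
  - by rewrite -ge0_fin_numE // fin_num_measure.
move=> A mA.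
apply: (@measure_unique _ R _ (@ocitv R) (fun n => `]- n%:R,
  n%:R]%classic) _ _ _ _ (distribution P' Y) (distribution P X)) => //.
- exact: ocitvI.
- by move=> i; exact: is_ocitv.
- by rewrite -subTset => x _; exists (Num.truncn `|x|).+1 => //=; rewrite in_itv /=;
  have := truncnS_gt `|x|; rewrite ltr_norml => /andP[-> /ltW ->].
- by move=> I [[a e] _ <-]; exact: ocE.
- by move=> k; rewrite -ge0_fin_numE // fin_num_measure.
Qed.

(** * Cumulants of the limit *)

Section Cumulants.
Context d (T : measurableType d) (R : realType) (P : probability T R) (X : T -> R).

Lemma moment0 : moment P X 0 = 1.
Proof.
rewrite /moment (_ : (fun w => X w ^+ 0) = cst 1); last by apply/funext => w; rewrite expr0.
rewrite expectationE /= ?Rexpectation_cst //.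
exact: finite_measure_integrable_cst.
Qed.

Definition scaled_moment k : R := moment P X k / k`!%:R.

Lemma scaled_moment0 : scaled_moment 0 = 1.
Proof. by rewrite /scaled_moment moment0 fact0 divr1. Qed.

Lemma cumulantS (c : nat -> R) k : log_recursion scaled_moment c k.+1 ->
  cumulant P X k.+1 = k`!%:R * c k.
Proof.
move=> rec; have := log_recursion_coef scaled_moment0 rec.
rewrite /cumulant /mgf_trunc; move: (_`_k.+1) => L <-.
by rewrite factS natrM mulrA [k`!%:R * _]mulrC.
Qed.

Lemma log_recursion_weaken (a c : nat -> R) j k : (j <= k)%N -> log_recursion a c k ->
  log_recursion a c j.
Proof. by move=> jk rec i ij; apply: rec; exact: leq_trans jk. Qed.
End Cumulants.

(** The recursion that computes cumulants from moments can be solved for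
    the moments. *)
Lemma moment_eq_of_cumulants (R : realType)
    d (T : measurableType d) (P : probability T R) (X : T -> R)
    d' (T' : measurableType d') (P' : probability T' R) (Y : T' -> R) :
  (forall k, cumulant P X k.+1 = cumulant P' Y k.+1) ->
  forall k, moment P X k = moment P' Y k.
Proof.
move=> XY k.
have [c rec] := log_recursion_exists k (scaled_moment0 P X).
have [c' rec'] := log_recursion_exists k (scaled_moment0 P' Y).
have f0 j : j`!%:R != 0 :> R by rewrite pnatr_eq0 -lt0n fact_gt0.
have cc' j : (j < k)%N -> c j = c' j.
  move=> jk; apply: (mulfI (f0 j)).
  by rewrite -(cumulantS (log_recursion_weaken jk rec)) -(cumulantS (log_recursion_weaken jk rec')).
have E0 : scaled_moment P X 0 = scaled_moment P' Y 0 by rewrite !scaled_moment0.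
have := log_recursion_inj E0 rec rec' cc' (leqnn k).
by rewrite /scaled_moment => /(mulIf (invr_neq0 (f0 k))).
Qed.

Section LimitCumulants.
Context (R : realType) (b : nat) (hb : (1 < b)%N).
Context (dO : measure_display) (Omega : measurableType dO) (P : probability Omega R).
Variable U : nat -> nat -> {RV P >-> R}.
Hypothesis hU : forall i j, uniform_half (U i j).
Hypothesis hind : mutually_independent P (fun ij : nat * nat => (U ij.1 ij.2 : Omega -> R)).
Variable B : nat -> R.
Hypothesis hB : bernoulli_numbers B.

Let beta : fps R := Fps (fun k => B k / k`!%:R).
Let betaE : beta * fexpm1X R = 1 := bernoulli_fps hB.

(** The moment series of a sum of independent variables is the product of
    their moment series, so logarithmic derivatives add up over the nodes. *)
Lemma coupled_log_recursion m k :
  log_recursion (fun j => \int[P]_x (coupled_inversions b U m x ^+ j) / j`!%:R)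
    (fun i => \sum_(u : bary_node b m) (bary_size b m)%:R^-1 ^+ i.+1 *
       fcoef (unif_logderiv beta (subtree_size (@bary_anc b m) u)) i) k.
Proof.
pose h (u : bary_node b m) := subtree_size (@bary_anc b m) u.
pose n : R := (bary_size b m)%:R.
pose L u := fconst n^-1 * fscale n^-1 (unif_logderiv beta (h u)).
pose F u := fconst (h u)%:R^-1 * \sum_(j < h u) fexp (n^-1 * (j%:R - ((h u)%:R - 1) / 2)).
have FL u : fderiv (F u) = L u * F u by apply: (fderiv_centered_unif betaE).
have DA := fderiv_prod_log (index_enum (bary_node b m)) FL.
have A j : \int[P]_x (coupled_inversions b U m x ^+ j) / j`!%:R = fcoef (\prod_u F u) j.
  rewrite (Rexpectation_cell_ranks hU hind (fun r => @centred_sum R b m r ^+ j)).2.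
  rewrite big_split -(sum_rank_box_prod (fun u j => fexp (n^-1 * (j%:R - ((h u)%:R - 1) /
    2)))); last exact: bary_anc_irr.
  have -> : \prod_u fconst (h u)%:R^-1 = fconst (\prod_u (h u)%:R : R)^-1.
    rewrite -prodfV; apply/esym/(big_morph (@fconst R)) => //; exact: fconstM.
  rewrite fcoef_constM -mulrA; congr (_ * _); rewrite fcoef_sum mulr_suml; apply: eq_bigr => r _.
  rewrite -fexp_sum /=; congr (_ ^+ j / _).
  by apply: eq_bigr => u _; rewrite mulrC.
move=> j _; have := congr1 (fun f => fcoef f j) DA; rewrite fcoefM /= -A => ->.
apply: eq_bigr => i _; rewrite -A; congr (_ * _).
rewrite fcoef_sum; apply: eq_bigr => u _.
by rewrite fcoef_constM [_^-1 ^+ i.+1]exprS -mulrA.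
Qed.

(** The coefficient [k] of [beta] is [B k / k!], and the other factor is
    the sum of the geometric series of ratio [1 / b ^ i]. *)
Definition limit_logderiv i : R :=
  if i == 0%N then 0 else fcoef beta i.+1 * (b%:R ^+ i / (b%:R ^+ i - 1)).

(** Depth [k] contributes [b ^ k * (h / n) ^ (i+1)], close to [b ^ (- k i)]
    as [h / n] is within [1 / n] of [b ^ (- k)]. Summed over the [m + 1]
    levels the error is [O(m / n)], and [n] grows exponentially in [m]. *)
Lemma subtree_power_sum_cvg i : (0 < i)%N ->
  \sum_(u : bary_node b m) (bary_size b m)%:R^-1 ^+ i.+1 *
       ((subtree_size (@bary_anc b m) u)%:R ^+ i.+1 - 1) @[m --> \oo]
  --> (b%:R ^+ i / (b%:R ^+ i - 1) : R).
Proof.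
move=> i0; pose q : R := b%:R^-1 ^+ i.
have bR : 1 < b%:R :> R by rewrite ltr1n.
have b0 : 0 < b%:R :> R by apply: lt_trans bR.
have q0 : 0 < q by rewrite exprn_gt0 // invr_gt0.
have q1 : q < 1 by rewrite exprn_ilt1 ?invr_ge0 ?(ltW b0) ?invf_lt1 // -lt0n.
have -> : b%:R ^+ i / (b%:R ^+ i - 1) = 1 * (1 - q)^-1 :> R.
  have bi : 1 < b%:R ^+ i :> R by rewrite exprn_egt1 // -lt0n.
  rewrite /q exprVn; move: (b%:R ^+ i : R) bi => z z1.
  by field; rewrite !gt_eqF ?subr_gt0 // (lt_trans ltr01 z1).
have qn : `|q| < 1 by rewrite gtr0_norm.
have geo := cvg_geometric_series (a := 1) qn.
have {}geo : (fun m => series (geometric 1 q) m.+1) @ \oo --> 1 * (1 - q)^-1.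
  by rewrite (cvg_shiftS (series (geometric 1 q))).
pose S m : R := \sum_(u : bary_node b m) (bary_size b m)%:R^-1 ^+ i.+1 *
       ((subtree_size (@bary_anc b m) u)%:R ^+ i.+1 - 1).
have bnd m : 0 <= series (geometric 1 q) m.+1 - S m <= i.+2%:R * (2 * (m.+1%:R * 2^-1 ^+ m.+1)).
  pose n : R := (bary_size b m)%:R.
  have n0 : 0 < n by rewrite ltr0n bary_size_gt0.
  have n1 : 1 <= n by rewrite ler1n bary_size_gt0.
  have nV : n^-1 <= 2^-1 ^+ m.
    by rewrite exprVn lef_pV2 ?posrE ?exprn_gt0 // -natrX ler_nat bary_size_ge.
  pose y (k : nat) : R := (bary_size b (m - k))%:R / n.
  have SE : S m = \sum_(k < m.+1) (b ^ k)%:R * (y k ^+ i.+1 - n^-1 ^+ i.+1).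
    rewrite /S (eq_bigr (fun u : bary_node b m => y (tag u) ^+ i.+1 - n^-1 ^+ i.+1)); last first.
      by move=> u _; rewrite bary_subtree_size // mulrBr mulr1 -exprMn [_^-1 * _]mulrC.
    rewrite (@sum_bary_nodes b m R (fun k _ => y k ^+ i.+1 - n^-1 ^+ i.+1)); apply: eq_bigr => k _.
    by rewrite sumr_const_nat subn0 -[LHS]mulr_natl.
  have GE : series (geometric 1 q) m.+1 = \sum_(k < m.+1) (b ^ k)%:R * (b%:R ^+ k)^-1 ^+ i.+1.
    rewrite /series /= big_mkord; apply: eq_bigr => k _.
    rewrite /q natrX exprS mulrA divff ?mul1r ?expf_neq0 ?gt_eqF //.
    by rewrite !exprVn -!exprM mulnC.
  have nE : n = \sum_(k < m.+1) (b ^ k)%:R :> R by rewrite /n bary_sizeE // natr_sum.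
  have term k : (k <= m)%N -> 0 <= (b%:R ^+ k)^-1 ^+ i.+1 - y k ^+ i.+1 <= i.+1%:R * n^-1 *
    (b%:R ^+ k)^-1.
    move=> km; have bk : 0 < b%:R ^+ k :> R by rewrite exprn_gt0.
    have /andP[r0 r1] := @bary_ratio R b m hb k km.
    pose x : R := (b%:R ^+ k)^-1; rewrite -/x.
    have x0 : 0 <= x by rewrite invr_ge0 ltW.
    have x1 : x <= 1 by rewrite invf_le1 // exprn_ege1 // ltW.
    have y0 : 0 <= y k by rewrite divr_ge0 // ltW.
    have xy : y k <= x by rewrite ler_pdivrMr // mulrC -subr_ge0.
    have dxy : x - y k <= n^-1.
      rewrite -(ler_pM2r n0) mulVf ?gt_eqF // mulrBl divfK ?gt_eqF //.
      by rewrite [x * n]mulrC.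
    apply/andP; split; first by rewrite subr_ge0 lerXn2r ?nnegrE.
    rewrite subrXX mulrC.
    have sumle : \sum_(j < i.+1) x ^+ (i.+1.-1 - j) * y k ^+ j <= i.+1%:R * x.
      rewrite [leRHS]mulr_natl -[X in _ *+ X]card_ord -sumr_const.
      apply: ler_sum => j _; apply: le_trans (_ : x ^+ (i - j) * x ^+ j <= _).
        by rewrite ler_wpM2l ?exprn_ge0 // lerXn2r ?nnegrE.
      by rewrite -exprD subnK ?leq_ord // ler_iXnr.
    apply: le_trans (_ : i.+1%:R * x * n^-1 <= _); last by rewrite mulrAC.
    apply: ler_pM => //; last by rewrite subr_ge0.
    by apply: sumr_ge0 => j _; rewrite mulr_ge0 ?exprn_ge0.
  have nVi : n^-1 ^+ i <= n^-1.
    by rewrite ler_iXnr ?invr_ge0 ?(ltW n0) // invf_le1.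
  have nV0 : 0 <= n^-1 by rewrite invr_ge0 ltW.
  have -> : series (geometric 1 q) m.+1 - S m =
      \sum_(k < m.+1) (b ^ k)%:R * ((b%:R ^+ k)^-1 ^+ i.+1 - y k ^+ i.+1) + n^-1 ^+ i.
    rewrite GE SE -sumrB (eq_bigr (fun k : 'I_m.+1 => (b ^ k)%:R * ((b%:R ^+ k)^-1 ^+ i.+1 - y
      k ^+ i.+1)
      + (b ^ k)%:R * n^-1 ^+ i.+1)); last by move=> k _; ring.
    by rewrite big_split /= -mulr_suml -nE exprS mulrA divff ?gt_eqF // mul1r.
  have bk k : 0 < (b ^ k)%:R :> R by rewrite natrX exprn_gt0.
  apply/andP; split.
    rewrite addr_ge0 ?exprn_ge0 //; apply: sumr_ge0 => k _.
    by rewrite mulr_ge0 ?(ltW (bk _)) //; have /andP[] := term k (leq_ord k).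
  apply: le_trans (_ : \sum_(k < m.+1) (i.+1%:R * n^-1) + n^-1 <= _).
    apply: lerD => //; apply: ler_sum => k _.
    have /andP[_ tk] := term k (leq_ord k).
    apply: le_trans (ler_wpM2l (ltW (bk k)) tk) _.
    by rewrite mulrCA natrX divff ?mulr1 // gt_eqF // -natrX.
  rewrite sumr_const card_ord -[(i.+1%:R * n^-1) *+ m.+1]mulr_natl.
  apply: le_trans (_ : i.+2%:R * m.+1%:R * n^-1 <= _).
    rewrite (_ : i.+2%:R * _ * _ = m.+1%:R * (i.+1%:R * n^-1) + m.+1%:R * n^-1); last first.
      by rewrite -[i.+2%:R]natr1; ring.
    by rewrite lerD2l ler_peMl // ler1n.
  rewrite -mulrA ler_wpM2l // mulrCA ler_wpM2l // exprS mulrA divff ?mul1r //.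
have cv0 : i.+2%:R * (2 * (m.+1%:R * 2^-1 ^+ m.+1)) @[m --> \oo] --> (0 : R).
  rewrite -(mulr0 i.+2%:R); apply: cvgMr; rewrite -(mulr0 2); apply: cvgMr.
  rewrite (cvg_shiftS (fun m => m%:R * 2^-1 ^+ m : R)); apply: cvg_natr_mul_expr.
  by apply/andP; split; lra.
have cvd : series (geometric 1 q) m.+1 - S m @[m --> \oo] --> (0 : R).
  apply: (@squeeze_cvgr _ _ _ _ (fun=> 0) (fun m => i.+2%:R * (2 * (m.+1%:R * 2^-1 ^+ m.+1)))).
  - by apply: nearW => m; exact: bnd.
  - exact: cvg_cst.
  - exact: cv0.
rewrite (_ : (fun m => _) = fun m => series (geometric 1 q) m.+1 - (series (geometric 1 q) m.+1
  - S m)).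
  by rewrite -[X in _ --> X]subr0; exact: cvgB.
by apply/funext => m; rewrite subKr.
Qed.

(** Both the moments and the coefficients of the logarithmic derivatives
    converge. *)
Lemma limit_log_recursion (X : {RV P >-> R}) : is_level_series b P U X ->
  forall k, log_recursion (scaled_moment P X) limit_logderiv k.
Proof.
move=> hX k j _.
pose a m i := \int[P]_x (coupled_inversions b U m x ^+ i) / i`!%:R.
have ca i : a m i @[m --> \oo] --> scaled_moment P X i.
  have [iXi cv] := coupled_Rexpectation_cvg hb hU hind hX (@exprn_continuous R i)
    (exp_dominated_pow R i).
  by rewrite /scaled_moment /moment expectationE //=; apply: cvgMl.
pose c m i := \sum_(u : bary_node b m) (bary_size b m)%:R^-1 ^+ i.+1 *
       fcoef (unif_logderiv beta (subtree_size (@bary_anc b m) u)) i.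
have cc i : c m i @[m --> \oo] --> limit_logderiv i.
  rewrite /limit_logderiv; case: (posnP i) => [->|i0].
    rewrite (_ : (fun m => _) = cst 0); first exact: cvg_cst.
    by apply/funext => m; rewrite /c big1 // => u _; rewrite mulr0.
  rewrite (_ : (fun m => _) = fun m => fcoef beta i.+1 * \sum_(u : bary_node b m) (bary_size b
    m)%:R^-1 ^+ i.+1 *
       ((subtree_size (@bary_anc b m) u)%:R ^+ i.+1 - 1)).
    by apply: cvgMr; exact: subtree_power_sum_cvg.
  apply/funext => m; rewrite /c mulr_sumr; apply: eq_bigr => u _.
  by rewrite /unif_logderiv /= gtn_eqF // mulrCA.
have cl : j.+1%:R * a m j.+1 @[m --> \oo] --> j.+1%:R * scaled_moment P X j.+1.
  by apply: cvgMr; exact: ca.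
have cr : \sum_(i < j.+1) c m i * a m (j - i)%N @[m --> \oo] -->
    \sum_(i < j.+1) limit_logderiv i * scaled_moment P X (j - i)%N.
  elim: (index_enum _) => [|i s IH].
    rewrite big_nil (_ : (fun m => _) = cst 0); first exact: cvg_cst.
    by apply/funext => m; rewrite big_nil.
  rewrite big_cons (_ : (fun m => _) =
    fun m => c m i * a m (j - i)%N + \sum_(l <- s) c m l * a m (j - l)%N).
    by apply: cvgD => //; apply: cvgM.
  by apply/funext => m; rewrite big_cons.
apply: cvg_unique cl _ => //.
rewrite (_ : (fun m => j.+1%:R * _) = fun m => \sum_(i < j.+1) c m i * a m (j - i)%N) //.
by apply/funext => m; exact: (@coupled_log_recursion m j.+1 j (ltnSn j)).
Qed.

Lemma cumulant_level_series (X : {RV P >-> R}) : is_level_series b P U X ->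
  forall k, (1 <= k)%N -> cumulant P X (2 * k - 1) = 0 /\
    cumulant P X (2 * k) = B (2 * k)%N / (2 * k)%:R
            * (b%:R ^+ (2 * k - 1) / (b%:R ^+ (2 * k - 1) - 1)).
Proof.
move=> hX [//|k] _; have rec := limit_log_recursion hX.
have -> : (2 * k.+1 - 1 = (2 * k).+1)%N by lia.
have -> : (2 * k.+1 = (2 * k).+2)%N by lia.
rewrite !(cumulantS (rec _)) /limit_logderiv; split.
  case: k => [|k]; first by rewrite muln0 eqxx mulr0.
  rewrite (_ : (2 * k.+1 = k.*2.+2)%N) /=; last by rewrite -mul2n; lia.
  by have := beta_odd betaE k; rewrite /= => ->; rewrite mul0r mulr0.
rewrite /= [((2 * k).+2)`!]factS natrM.
have f0 : ((2 * k).+1)`!%:R != 0 :> R by rewrite pnatr_eq0 -lt0n fact_gt0.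
rewrite mulrA; congr (_ * _).
move: f0; move: ((2 * k).+1`!%:R : R) => F F0.
have n0 : (2 * k).+2%:R != 0 :> R by rewrite pnatr_eq0.
move: (B _) n0; move: ((2 * k).+2%:R : R) => n x n0.
by field; rewrite F0 n0.
Qed.
End LimitCumulants.

(** * Limit law of the number of inversions *)

Theorem theorem1p11 (R : realType) (b : nat) (hb : (2 <= b)%N)
  (dT : nat -> measure_display) (T : forall m, measurableType (dT m))
  (Q : forall m, probability (T m) R)
  (lam : forall m, T m -> {ffun bary_node b m -> 'I_#|bary_node b m|})
  (hlam : forall m, uniform_labelling (Q m) (lam m))
  (dO : measure_display) (Omega : measurableType dO) (P : probability Omega R)
  (U : nat -> nat -> {RV P >-> R})
  (hU : forall i j, uniform_half (U i j))
  (hind : mutually_independent P (fun ij : nat * nat => (U ij.1 ij.2 : Omega -> R)))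
  (B : nat -> R) (hB : bernoulli_numbers B) :
  (exists X : {RV P >-> R}, is_level_series b P U X) /\
  forall X : {RV P >-> R}, is_level_series b P U X ->
  [/\ cvg_in_distribution Q (fun m => normalized_inversions (Q m) (@lam m)) P X,
      forall t : R,
        ('M_P X t < +oo)%E /\
        'M_(Q m) (normalized_inversions (Q m) (@lam m)) t @[m --> \oo]
          --> 'M_P X t,
      has_moments P X /\
      (forall k : nat, (1 <= k)%N ->
        cumulant P X (2 * k - 1) = 0 /\
        cumulant P X (2 * k) =
          B (2 * k)%N / (2 * k)%:R
          * (b%:R ^+ (2 * k - 1) / (b%:R ^+ (2 * k - 1) - 1)))
    & forall (dY : measure_display) (OmegaY : measurableType dY)
        (PY : probability OmegaY R) (Y : {RV PY >-> R}),
        has_moments PY Y ->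
        (forall k : nat, (1 <= k)%N ->
          cumulant PY Y (2 * k - 1) = 0 /\
          cumulant PY Y (2 * k) =
            B (2 * k)%N / (2 * k)%:R
            * (b%:R ^+ (2 * k - 1) / (b%:R ^+ (2 * k - 1) - 1))) ->
        same_distribution Y X].
Proof.
split; first exact: (level_series_exists hb hU hind).
move=> X hX.
have transfer F : continuous F -> exp_dominated F -> _ :=
  @expectation_cvg R b hb dO Omega P U hU hind X hX dT T Q lam hlam F.
have integ F (cF : continuous F) (dF : exp_dominated F) :
    P.-integrable setT (EFin \o (fun x => F (X x))).
  exact: (coupled_Rexpectation_cvg hb hU hind hX cF dF).1.
have cexp (t : R) : continuous (fun x : R => expR (t * x)).
  move=> x; apply: (@continuous_comp _ _ _ (fun y : R => t * y) expR); last exact: continuous_expR.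
  exact: mulrl_continuous.
have iexp t : P.-integrable setT (EFin \o (fun x => expR (t * X x))).
  exact: (integ _ (cexp t) (exp_dominated_exp t)).
have mom : has_moments P X.
  move=> k; exact: (integ _ (@exprn_continuous R k) (exp_dominated_pow R k)).
have cum := cumulant_level_series hb hU hind hB hX.
split.
- move=> f cf [M fM]; exact: (transfer f cf (exp_dominated_bounded fM)).
- move=> t.
  have mgfE d' (S : measurableType d') (Q' : probability S R) (Z : S -> R) :
      'M_Q' Z t = ('E_Q'[(fun x => expR (t * x)) \o Z])%E.
    by rewrite /mmt_gen_fun; congr ('E_Q'[_])%E; apply/funext => w /=; rewrite mulrC.
  split; first by rewrite mgfE expectationE ?ltry //; exact: iexp.
  rewrite mgfE (_ : (fun m => _) =
    fun m => ('E_(Q m)[(fun x => expR (t * x)) \o normalized_inversions (Q m) (@lam m)])%E).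
    exact: (transfer _ (cexp t) (exp_dominated_exp t)).
  by apply/funext => m; exact: mgfE.
- by split.
- move=> dY OmegaY PY Y momY cumY.
  apply: same_distribution_of_moments => //.
  apply: moment_eq_of_cumulants => k.
  have [j [->|->]] : exists j, (k.+1 = 2 * j.+1 - 1)%N \/ (k.+1 = 2 * j.+1)%N.
    by exists (k./2); have := odd_double_half k; case: (odd k) => /= <-; [right|left]; lia.
  + by rewrite (cum j.+1 isT).1 (cumY j.+1 isT).1.
  + by rewrite (cum j.+1 isT).2 (cumY j.+1 isT).2.
Qed.
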